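(* For every nonconstant inner function $I$ such that $I(0)=0$, the equality $$\mathcal{H}\left(\tfrac{I(1+I^2)}{2}\right)=\mathcal{H}\left(\tfrac{1+I^2}{2}\right)$$ holds as sets.
   Context: $\mathbb{D}$ is the open unit disk, $\mathbb{T}=\partial\mathbb{D}$, and $H^2$ is the Hardy space on $\mathbb{D}$ with norm $\|\cdot\|$, identified via boundary values with a closed subspace of $L^2(\mathbb{T})$. For $\varphi\in L^\infty(\mathbb{T})$ the Toeplitz operator on $H^2$ is $T_\varphi f=P(\varphi f)$, where $P$ is the orthogonal projection of $L^2(\mathbb{T})$ onto $H^2$. For $b$ in the closed unit ball of $H^\infty$, the de Branges-Rovnyak space $\mathcal{H}(b)$ is the image of $H^2$ under $(1-T_bT_{\overline b})^{1/2}$, with the range norm defined by $\|(1-T_bT_{\overline b})^{1/2}f\|_b=\|f\|$ for $f\in(\ker(1-T_bT_{\overline b})^{1/2})^\perp$. Equality ''as sets'' means that the two spaces consist of the same functions (the norms may differ). *)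

(* Defs.v *)
From HB Require Import structures.
From mathcomp Require Import all_boot all_order all_algebra.
From mathcomp Require Import complex.
From mathcomp Require Import all_classical all_reals all_analysis.

Set Implicit Arguments.
Unset Strict Implicit.
Unset Printing Implicit Defensive.

Import Order.TTheory GRing.Theory Num.Theory ComplexField Normc.
Import numFieldNormedType.Exports.

Local Open Scope classical_set_scope.
Local Open Scope ring_scope.
Local Open Scope complex_scope.

(* The complex numbers are R[i] for an arbitrary
   R : realType.  The alias R[i]^o only serves to select the norm topology of
   the complex plane.

   Functions on the disk are functions on the subtype [disk R], so that
   equality of sets of such functions is equality as sets of functions on the
   disk.  Functions on the circle T are represented by their pullback under
   t |-> e^{it} to [0, 2 pi], with the normalized measure dt / (2 pi). *)

Definition disk (R : realType) := {z : R[i] | normc z < 1}.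

Lemma disk0_subproof (R : realType) : normc (0 : R[i]) < 1.
Proof. by rewrite normc0 ltr01. Qed.

Definition disk0 (R : realType) : disk R := exist _ 0 (disk0_subproof R).

(* Extension by 0, so that radial limits can be written with plain filters. *)
Definition disk_ext (R : realType) (f : disk R -> R[i]) (z : R[i]) : R[i] :=
  if insub z is Some w then f w else 0.

Definition power_series_of (R : realType) (a : nat -> R[i])
    (f : disk R -> R[i]) : Prop :=
  forall z : disk R,
    series (fun n => a n * val z ^+ n) @ \oo --> (f z : R[i]^o).

Definition analytic (R : realType) (f : disk R -> R[i]) : Prop :=
  exists a, power_series_of a f.

Definition hardy2 (R : realType) : set (disk R -> R[i]) :=
  [set f | exists a, power_series_of a f /\
     (\sum_(0 <= n <oo) (normc (a n) ^+ 2)%:E < +oo)%E].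

Definition Hoo (R : realType) : set (disk R -> R[i]) :=
  [set f | analytic f /\ exists M : R, forall z, normc (f z) <= M].

Definition angles (R : realType) : set R := [set` `[0 : R, 2 * pi]].
Arguments angles R : clear implicits.

Definition expit (R : realType) (t : R) : R[i] := cos t +i* sin t.

Definition circle_L2 (R : realType) : set (R -> R[i]) :=
  [set g : R -> R[i] | [/\
     measurable_fun (angles R) (fun t : R => complex.Re (g t) : R),
     measurable_fun (angles R) (fun t : R => complex.Im (g t) : R) &
     (\int[lebesgue_measure]_(t in angles R) (normc (g t) ^+ 2)%:E < +oo)%E]].

Definition circle_mean (R : realType) (g : R -> R[i]) : R[i] :=
  ((2 * pi)^-1 *
     \int[lebesgue_measure]_(t in angles R) complex.Re (g t)) +i*
  ((2 * pi)^-1 *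
     \int[lebesgue_measure]_(t in angles R) complex.Im (g t)).

Definition circle_inner (R : realType) (u v : R -> R[i]) : R[i] :=
  circle_mean (fun t => u t * (v t)^*).

Definition has_radial_limits (R : realType) (f : disk R -> R[i])
    (g : R -> R[i]) : Prop :=
  {ae (@lebesgue_measure R), forall t, t \in angles R ->
     (disk_ext f (r%:C * expit t) : R[i]^o) @[r --> (1 : R)^'-] -->
       (g t : R[i]^o)}.

(* The boundary function of f, as a representative of a class in L^2(T): it
   exists for every f in H^2 (hence for every f in H^oo) and any two candidates
   agree a.e. *)
Definition bdry (R : realType) (f : disk R -> R[i]) : R -> R[i] :=
  xget (fun=> 0) [set g | circle_L2 g /\ has_radial_limits f g].

Definition hardy_inner (R : realType) (f g : disk R -> R[i]) : R[i] :=
  circle_inner (bdry f) (bdry g).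

Definition hardy_norm (R : realType) (f : disk R -> R[i]) : R :=
  Num.sqrt (complex.Re (hardy_inner f f)).

(* Orthogonal projection of L^2(T) onto H^2, the latter being identified with
   its space of boundary functions: P u is the element f of H^2 such that
   u - bdry f is orthogonal to H^2. *)
Definition hardy_proj (R : realType) (u : R -> R[i]) : disk R -> R[i] :=
  xget (fun=> 0) [set f | hardy2 f /\ forall h, hardy2 h ->
    circle_inner (fun t => u t - bdry f t) (bdry h) = 0].

Definition toeplitz (R : realType) (phi : R -> R[i]) (f : disk R -> R[i]) :
    disk R -> R[i] :=
  hardy_proj (fun t => phi t * bdry f t).

(* Operators on H^2 are total maps on functions on the disk, of which only the
   restriction to H^2 matters. *)
Definition bounded_operator (R : realType)
    (A : (disk R -> R[i]) -> (disk R -> R[i])) : Prop :=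
  [/\ forall f, hardy2 f -> hardy2 (A f),
      forall (c : R[i]) f g, hardy2 f -> hardy2 g ->
        A (fun z => c * f z + g z) = (fun z => c * A f z + A g z) &
      exists M : R, forall f, hardy2 f -> hardy_norm (A f) <= M * hardy_norm f].

(* The order of R[i] makes 0 <= w mean that w is real and nonnegative. *)
Definition positive_operator (R : realType)
    (A : (disk R -> R[i]) -> (disk R -> R[i])) : Prop :=
  bounded_operator A /\ forall f, hardy2 f -> 0 <= hardy_inner (A f) f.

(* The positive square root of X; on H^2 it is unique, and it exists whenever
   X is a positive operator. *)
Definition op_sqrt (R : realType)
    (X : (disk R -> R[i]) -> (disk R -> R[i])) :
    (disk R -> R[i]) -> (disk R -> R[i]) :=
  xget (fun _ _ => 0)
    [set A | positive_operator A /\ forall f, hardy2 f -> A (A f) = X f].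

(* 1 - T_b T_{conj b} *)
Definition defect (R : realType) (b : disk R -> R[i]) (f : disk R -> R[i]) :
    disk R -> R[i] :=
  fun z => f z - toeplitz (bdry b) (toeplitz (fun t => (bdry b t)^*) f) z.

(* The de Branges-Rovnyak space H(b), as a set of functions on the disk; it is
   meaningful for b in the closed unit ball of H^oo. *)
Definition dbr (R : realType) (b : disk R -> R[i]) : set (disk R -> R[i]) :=
  op_sqrt (defect b) @` @hardy2 R.

Definition inner_function (R : realType) (I : disk R -> R[i]) : Prop :=
  Hoo I /\
  {ae (@lebesgue_measure R), forall t, t \in angles R -> normc (bdry I t) = 1}.

(* Main.v *)
Require Import Defs.
From mathcomp Require Import all_boot all_order all_algebra.
From mathcomp Require Import complex.
From mathcomp Require Import all_classical all_reals all_analysis measurable_realfun.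
From mathcomp Require Import ring lra.

(** Let V be multiplication by I, an isometry of H^2, and B = (1 + V^2) / 2, so that the two symbols
    give the Toeplitz operators V B and B.  Since V and B commute, the defects
    X1 = 1 - V B B^* V^* and X2 = 1 - B B^* satisfy X1 - X2 = B D B^* where D = 1 - V V^* is a
    projection; hence X2 <= X1.  Conversely D B^* f = D f - D (f - w) / 2 with w = V^*^2 f, while
    4 <X2 f, f> = 2 |f|^2 - 2 |w|^2 + |f - w|^2, which gives X1 - X2 <= 4 X2.  So X2 <= X1 <= 5 X2,
    and by Douglas' lemma the square roots of X1 and X2 have the same range.

    H^2 is embedded in L^2(T) by Fatou's theorem, proved by Poisson integration at the Lebesgue points
    of the L^2 limit of the partial sums.  The space is used as a real Hilbert space for the real part
    of its inner product; self-adjointness over the reals is enough for square roots and for Douglas'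
    lemma. *)

Set Implicit Arguments.
Unset Strict Implicit.
Unset Printing Implicit Defensive.

Import Order.TTheory GRing.Theory Num.Theory ComplexField Normc.
Import numFieldNormedType.Exports.

Local Open Scope classical_set_scope.
Local Open Scope ring_scope.
Local Open Scope complex_scope.

(** * Operators on a complete inner product space *)

(** The maps [bdry], [hardy_proj] and [op_sqrt] are choices by [xget] with a default value, so
    nothing can be said of them before a candidate is constructed. Fatou's theorem supplies one for
    [bdry], the Riesz lemma one for the projection onto H^2, and an iteration one for the square
    root. Each choice is then controlled by a characterization: boundary functions up to a null set,
    projections by orthogonality, and a root A of X by |A f|^2 = <X f, f>. This last identity turns
    the comparison of ranges into a comparison of quadratic forms. The complex structure, hidden by
    the real inner product, returns in two places: the constructed root must commute with complex
    scalars to be a [bounded_operator], and the symmetry of the chosen root comes from the reality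
    of the complex number <A f, f>. The factor 4 is the cost of |x - y|^2 <= 2 |x|^2 + 2 |y|^2 for x
    = D f and y = D (f - w) / 2; adding X2 itself gives 5. *)

Section InnerProduct.
Variables (R : realType) (E : lmodType R) (H : set E) (ip : E -> E -> R).

(** Only semi-definite, because on functions on the circle the form vanishes at every function that
    is zero almost everywhere. Definiteness is the separate [ip_definite], available for H^2. All
    laws are relative to [H], since operators and inner products are total maps with no control
    outside it. *)
Record inner_on : Prop := InnerOn {
  inner0 : H 0;
  inner_lin : forall c u v, H u -> H v -> H (c *: u + v);
  ip_linl : forall c u v w, H u -> H v -> H w ->
    ip (c *: u + v) w = c * ip u w + ip v w;
  ip_sym : forall u v, H u -> H v -> ip u v = ip v u;
  ip_ge0 : forall u, H u -> 0 <= ip u u }.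

Record operator_on (A : E -> E) : Prop := OperatorOn {
  op_in : forall u, H u -> H (A u);
  op_lin : forall c u v, H u -> H v -> A (c *: u + v) = c *: A u + A v }.

Definition sqn u := ip u u.
Definition nrm u := Num.sqrt (sqn u).

Lemma nrmE u : nrm u = Num.sqrt (sqn u).
Proof. by []. Qed.

Definition ip_cauchy (u : nat -> E) := forall e, 0 < e -> exists N,
  forall m n, (N <= m)%N -> (N <= n)%N -> sqn (u m - u n) < e.

Definition ip_complete := forall u : nat -> E, (forall n, H (u n)) ->
  ip_cauchy u -> exists2 l, H l & (fun n => sqn (u n - l)) @ \oo --> (0 : R).

Definition ip_definite := forall u, H u -> sqn u = 0 -> u = 0.

Hypothesis io : inner_on.

Lemma inner_0 : H 0. Proof. exact: inner0. Qed.

Lemma innerZ c u : H u -> H (c *: u).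
Proof. by move=> Hu; rewrite -[_ *: _]addr0; exact: inner_lin io _ _ _ Hu (inner0 io). Qed.

Lemma innerD u v : H u -> H v -> H (u + v).
Proof. by move=> Hu Hv; rewrite -[u]scale1r; exact: inner_lin. Qed.

Lemma innerN u : H u -> H (- u).
Proof. by move=> Hu; rewrite -scaleN1r; exact: innerZ. Qed.

Lemma innerB u v : H u -> H v -> H (u - v).
Proof. by move=> Hu Hv; apply: innerD => //; exact: innerN. Qed.

Local Hint Resolve inner_0 innerZ innerD innerN innerB : core.

Lemma ip0l w : H w -> ip 0 w = 0.
Proof.
move=> Hw; have := ip_linl io 1 (inner0 io) (inner0 io) Hw.
rewrite scale1r addr0 mul1r => h; lra.
Qed.

Lemma ipZl c u w : H u -> H w -> ip (c *: u) w = c * ip u w.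
Proof. by move=> Hu Hw; rewrite -[c *: u]addr0 ip_linl// ip0l// addr0. Qed.

Lemma ipDl u v w : H u -> H v -> H w -> ip (u + v) w = ip u w + ip v w.
Proof. by move=> Hu Hv Hw; rewrite -{1}[u]scale1r ip_linl// mul1r. Qed.

Lemma ipNl u w : H u -> H w -> ip (- u) w = - ip u w.
Proof. by move=> Hu Hw; rewrite -scaleN1r ipZl// mulN1r. Qed.

Lemma ipBl u v w : H u -> H v -> H w -> ip (u - v) w = ip u w - ip v w.
Proof. by move=> Hu Hv Hw; rewrite ipDl ?ipNl; auto. Qed.

Lemma ipZr c u w : H u -> H w -> ip w (c *: u) = c * ip w u.
Proof. by move=> Hu Hw; rewrite (ip_sym io Hw) ?ipZl ?(ip_sym io Hu); auto. Qed.

Lemma ipDr u v w : H u -> H v -> H w -> ip w (u + v) = ip w u + ip w v.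
Proof.
by move=> Hu Hv Hw; rewrite (ip_sym io Hw) ?ipDl ?(ip_sym io Hu) ?(ip_sym io Hv); auto.
Qed.

Lemma ipNr u w : H u -> H w -> ip w (- u) = - ip w u.
Proof. by move=> Hu Hw; rewrite -scaleN1r ipZr// mulN1r. Qed.

Lemma ipBr u v w : H u -> H v -> H w -> ip w (u - v) = ip w u - ip w v.
Proof. by move=> Hu Hv Hw; rewrite ipDr ?ipNr; auto. Qed.

Lemma sqnD u v : H u -> H v -> sqn (u + v) = sqn u + 2 * ip u v + sqn v.
Proof.
move=> Hu Hv; rewrite /sqn ipDl ?ipDr; auto.
by rewrite (ip_sym io Hv Hu); ring.
Qed.

Lemma sqnZ c u : H u -> sqn (c *: u) = c ^+ 2 * sqn u.
Proof. by move=> Hu; rewrite /sqn ipZl ?ipZr; auto; rewrite mulrA. Qed.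

Lemma sqnN u : H u -> sqn (- u) = sqn u.
Proof. by move=> Hu; rewrite -scaleN1r sqnZ// sqrrN expr1n mul1r. Qed.

Lemma sqnB u v : H u -> H v -> sqn (u - v) = sqn u - 2 * ip u v + sqn v.
Proof. by move=> Hu Hv; rewrite sqnD ?sqnN ?ipNr; auto; ring. Qed.

Lemma sqn_distC u v : H u -> H v -> sqn (u - v) = sqn (v - u).
Proof. by move=> Hu Hv; rewrite -sqnN ?opprB; auto. Qed.

Lemma sqn_ge0 u : H u -> 0 <= sqn u. Proof. exact: ip_ge0. Qed.

Lemma nrm_sqr u : H u -> nrm u ^+ 2 = sqn u.
Proof. by move=> Hu; rewrite sqr_sqrtr// sqn_ge0. Qed.

Lemma nrm_ge0 u : 0 <= nrm u. Proof. exact: sqrtr_ge0. Qed.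

Lemma cauchy_schwarz u v : H u -> H v -> `|ip u v| <= nrm u * nrm v.
Proof.
move=> Hu Hv.
have key s : 0 <= sqn u - 2 * s * ip u v + s ^+ 2 * sqn v.
  have := sqn_ge0 (innerB Hu (innerZ s Hv)).
  by rewrite sqnB ?sqnZ ?ipZr; auto; rewrite mulrA.
rewrite -(@ler_pXn2r _ 2)// ?nnegrE ?mulr_ge0 ?nrm_ge0//.
rewrite exprMn !nrm_sqr// real_normK ?num_real//.
have [v0|v0] := eqVneq (sqn v) 0.
  have [-> |uv0] := eqVneq (ip u v) 0; first by rewrite v0 mulr0 expr0n.
  (* With [sqn v = 0] this value of s makes the quadratic equal to - sqn u - 2, which is
     negative. *)
  exfalso; have := key ((sqn u + 1) / ip u v).
  rewrite v0 mulr0 addr0 -mulrA mulfVK//.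
  by have := sqn_ge0 Hu; move=> ? ?; lra.
have vp : 0 < sqn v by rewrite lt_def v0 sqn_ge0.
have := key (ip u v / sqn v).
have -> : sqn u - 2 * (ip u v / sqn v) * ip u v + (ip u v / sqn v) ^+ 2 * sqn v =
  (sqn u * sqn v - ip u v ^+ 2) / sqn v by field.
by rewrite pmulr_lge0 ?invr_gt0// subr_ge0.
Qed.

Lemma nrmD u v : H u -> H v -> nrm (u + v) <= nrm u + nrm v.
Proof.
move=> Hu Hv; rewrite -(@ler_pXn2r _ 2)// ?nnegrE ?addr_ge0 ?nrm_ge0//.
rewrite nrm_sqr ?sqnD// ?sqrrD ?nrm_sqr; auto.
have := cauchy_schwarz Hu Hv; have := ler_norm (ip u v); move=> ? ?; lra.
Qed.

Lemma nrmZ c u : H u -> nrm (c *: u) = `|c| * nrm u.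
Proof. by move=> Hu; rewrite /nrm sqnZ// sqrtrM ?sqr_ge0// sqrtr_sqr. Qed.

Lemma nrmN u : H u -> nrm (- u) = nrm u.
Proof. by move=> Hu; rewrite /nrm sqnN. Qed.

Lemma nrm_dist u v w : H u -> H v -> H w -> nrm (u - w) <= nrm (u - v) + nrm (v - w).
Proof. by move=> Hu Hv Hw; rewrite (le_trans _ (nrmD _ _)) ?addrA ?subrK; auto. Qed.

Lemma nrm_distC u v : H u -> H v -> nrm (u - v) = nrm (v - u).
Proof. by move=> Hu Hv; rewrite /nrm sqn_distC. Qed.

Lemma sqn_le u v : H u -> H v -> nrm u <= nrm v -> sqn u <= sqn v.
Proof. by move=> Hu Hv uv; rewrite -!nrm_sqr// ler_pXn2r// nnegrE nrm_ge0. Qed.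

Lemma nrm_le u v : sqn u <= sqn v -> nrm u <= nrm v.
Proof. exact: ler_wsqrtr. Qed.

Lemma cvg_sqn_nrm (u : nat -> E) :
  (fun n => sqn (u n)) @ \oo --> (0 : R) -> (fun n => nrm (u n)) @ \oo --> (0 : R).
Proof.
move=> h; have := @continuous_cvg _ _ _ _ _ _ Num.sqrt _ (@sqrt_continuous R 0) h.
by rewrite sqrtr0; exact.
Qed.

Lemma cvg_nrm_le (u : nat -> E) (v : nat -> R) : (forall n, nrm (u n) <= v n) ->
  v @ \oo --> (0 : R) -> (fun n => nrm (u n)) @ \oo --> (0 : R).
Proof.
move=> uv v0; apply: (@squeeze_cvgr _ _ _ _ (cst 0) v) => //; last exact: cvg_cst.
by near=> n; rewrite nrm_ge0 uv.
Unshelve. all: by end_near. Qed.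

Lemma nrm_eq0 u : ip_definite -> H u -> nrm u = 0 -> u = 0.
Proof. by move=> def Hu u0; apply: def => //; rewrite -nrm_sqr// u0 expr0n. Qed.

Lemma nrm_le0_eq u v : ip_definite -> H u -> H v -> nrm (u - v) <= 0 -> u = v.
Proof.
move=> def Hu Hv le0; apply/eqP; rewrite -subr_eq0; apply/eqP.
apply: nrm_eq0 => //; first by auto.
by apply/eqP; rewrite eq_le le0 nrm_ge0.
Qed.

Lemma ip_cvg (u : nat -> E) l w : (forall n, H (u n)) -> H l -> H w ->
  (fun n => sqn (u n - l)) @ \oo --> (0 : R) ->
  (fun n => ip (u n) w) @ \oo --> ip l w.
Proof.
move=> Hu Hl Hw ul; apply/subr_cvg0.
apply: (@squeeze_cvgr _ _ _ _ (fun n => - (nrm (u n - l) * nrm w))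
   (fun n => (nrm (u n - l) * nrm w))).
- near=> n; rewrite -ler_norml -ipBl; auto.
  by apply: cauchy_schwarz; auto.
- rewrite -oppr0 -(mul0r (nrm w)); apply: cvgN.
  by apply: cvgMr_tmp; exact: cvg_sqn_nrm.
- by rewrite -(mul0r (nrm w)); apply: cvgMr_tmp; exact: cvg_sqn_nrm.
Unshelve. all: by end_near. Qed.

Section Operators.
Variables (A : E -> E) (oA : operator_on A).

Lemma opD u v : H u -> H v -> A (u + v) = A u + A v.
Proof. by move=> Hu Hv; rewrite -[u in LHS]scale1r op_lin// scale1r. Qed.

Lemma op0 : A 0 = 0.
Proof.
have := opD (inner0 io) (inner0 io).
by rewrite addr0 => /eqP; rewrite addrC -subr_eq subrr eq_sym => /eqP.
Qed.

Lemma opZ c u : H u -> A (c *: u) = c *: A u.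
Proof. by move=> Hu; rewrite -[c *: u]addr0 op_lin// ?op0 ?addr0; auto. Qed.

Lemma opN u : H u -> A (- u) = - A u.
Proof. by move=> Hu; rewrite -scaleN1r opZ// scaleN1r. Qed.

Lemma opB u v : H u -> H v -> A (u - v) = A u - A v.
Proof. by move=> Hu Hv; rewrite opD ?opN; auto. Qed.

End Operators.

(* The vector representing L is the limit of A h_n along a minimizing sequence h_n of
   sqn (A h) - 2 L h. *)
Lemma riesz (A : E -> E) (L : E -> R) (C : R) : ip_complete -> operator_on A ->
  (forall c u v, H u -> H v -> L (c *: u + v) = c * L u + L v) ->
  (forall u, H u -> `|L u| <= C * nrm (A u)) ->
  exists2 g, H g & forall h, H h -> L h = ip (A h) g.
Proof.
move=> compl oA Llin Lbd.
have HA u : H u -> H (A u) by exact: op_in.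
pose J h := sqn (A h) - 2 * L h.
(* J h >= |A h|^2 - 2 C |A h|, and the square is completed. *)
have Jlb h : H h -> - C ^+ 2 <= J h.
  move=> Hh; rewrite /J -nrm_sqr; auto.
  have := Lbd _ Hh; have := ler_norm (L h).
  have := sqr_ge0 (nrm (A h) - C); rewrite sqrrB => ? ? ?; lra.
pose S := [set J h | h in H].
have infS : has_inf S.
  split; first by exists (J 0); exists 0 => //; exact: inner0 io.
  by exists (- C ^+ 2) => _ [h Hh <-]; exact: Jlb.
pose m := inf S.
have mJ h : H h -> m <= J h by move=> Hh; apply: ge_inf; [exact: infS.2|exists h].
have hex n : exists h, H h /\ J h < m + n.+1%:R^-1.
  have e0 : 0 < n.+1%:R^-1 :> R by rewrite invr_gt0.
  have [_ [h Hh <-] lt] := inf_adherent e0 infS.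
  by exists h.
have [h_ hP] := choice hex.
have Hh_ n : H (h_ n) by have [] := hP n.
have Jh_ n : J (h_ n) < m + n.+1%:R^-1 by have [] := hP n.
have Jvar n s h : H h -> J (h_ n + s *: h) =
    J (h_ n) + 2 * s * (ip (A (h_ n)) (A h) - L h) + s ^+ 2 * sqn (A h).
  move=> Hh; rewrite /J [h_ n + _]addrC op_lin// Llin// [_ + A (h_ n)]addrC.
  rewrite sqnD ?sqnZ ?ipZr; auto.
  by ring.
(* Parallelogram identity: the left side equals 2 J h + 2 J k - 4 J ((h + k) / 2), and J >= m at the
   midpoint. *)
have par h k : H h -> H k -> sqn (A h - A k) <= 2 * (J h + J k - 2 * m).
  move=> Hh Hk; have := mJ (2^-1 *: (h + k)) (innerZ _ (innerD Hh Hk)).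
  have AE : A (2^-1 *: (h + k)) = 2^-1 *: (A h + A k).
    by rewrite (opZ oA) ?(opD oA); auto.
  have L0 : L 0 = 0.
    by have := Llin 1 0 0 inner_0 inner_0; rewrite scale1r addr0 => ?; lra.
  have LE : L (2^-1 *: (h + k)) = 2^-1 * (L h + L k).
    rewrite -[_ *: _]addr0 Llin; auto; rewrite L0 addr0.
    by rewrite -{1}[h]scale1r Llin// mul1r.
  rewrite /J AE LE sqnB ?sqnZ ?sqnD; auto.
  have -> : (2^-1) ^+ 2 = 4^-1 :> R by field.
  by move=> ?; lra.
have cau : ip_cauchy (fun n => A (h_ n)).
  move=> e e0; have [N _ NP] := near_infty_natSinv_lt (PosNum (divr_gt0 e0 (ltr0Sn R 3))).
  exists N => i j Ni Nj; apply: le_lt_trans (par _ _ (Hh_ i) (Hh_ j)) _.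
  have := NP _ Ni; have := NP _ Nj; have := Jh_ i; have := Jh_ j => /=.
  by move: (J _) (J _) (_^-1) (_^-1) => ? ? ? ? ? ? ? ?; lra.
have [g Hg cg] := compl _ (fun n => HA _ (Hh_ n)) cau.
exists g => // h Hh.
pose d := ip (A h) g - L h; suff : d = 0 by rewrite /d => /eqP; rewrite subr_eq0 => /eqP.
(* The inequality m <= J (h_n + s h), passed to the limit in n, is the first-order condition at the
   infimum. *)
have key s : 0 <= 2 * s * d + s ^+ 2 * sqn (A h).
  have cl : (fun n => n.+1%:R^-1 + 2 * s * (ip (A (h_ n)) (A h) - L h) + s ^+ 2 * sqn (A h))
     @ \oo --> 0 + 2 * s * d + s ^+ 2 * sqn (A h).
    apply: cvgD; last exact: cvg_cst.
    apply: cvgD; first exact: cvg_harmonic.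
    apply: cvgMl_tmp; apply: cvgB; last exact: cvg_cst.
    by rewrite (ip_sym io (HA _ Hh) Hg); apply: ip_cvg; auto.
  rewrite -[_ * d]add0r -(cvg_lim _ cl)//; apply: limr_ge; first by apply/cvg_ex; eexists; exact: cl.
  near=> n; have := mJ _ (innerD (Hh_ n) (innerZ s Hh)).
  rewrite Jvar//; have := Jh_ n; move: (J _) (n.+1%:R^-1) => ? ? ? ?; lra.
have q0 := sqn_ge0 (HA _ Hh); set q := sqn _ in key q0.
have q1 : q + 1 != 0 by rewrite lt0r_neq0//; lra.
(* Near the minimizer - d / q of the quadratic; the added 1 keeps the quotient meaningful when q =
   0. *)
have := key (- d / (q + 1)).
have -> : 2 * (- d / (q + 1)) * d + (- d / (q + 1)) ^+ 2 * q = - (d ^+ 2 * ((q + 2) / (q + 1) ^+ 2)).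
  by field.
rewrite oppr_ge0 pmulr_lle0; last by rewrite divr_gt0 ?exprn_gt0//; lra.
by move=> d0; apply/eqP; rewrite -sqrf_eq0 eq_le d0 sqr_ge0.
Unshelve. all: by end_near. Qed.

Definition symmetric_on (A : E -> E) := forall f g, H f -> H g -> ip (A f) g = ip f (A g).

(** The case of the identity in [riesz]: g is the value at f of the adjoint of [M]. *)
Lemma bounded_representation (M : E -> E) C f : ip_complete -> operator_on M ->
  (forall h, H h -> nrm (M h) <= C * nrm h) -> H f ->
  exists2 g, H g & forall h, H h -> ip (M h) f = ip h g.
Proof.
move=> compl oM bM Hf.
apply: (@riesz id (fun h => ip (M h) f) (C * nrm f)) => // [c u v Hu Hv|u Hu].
  by rewrite op_lin// ip_linl; auto; exact: op_in.
rewrite (le_trans (cauchy_schwarz (op_in oM Hu) Hf))// mulrAC.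
by rewrite ler_wpM2r ?nrm_ge0// bM.
Qed.

(** The functional h |-> <A1 h, f> is bounded by a multiple of |A2 h|, so [riesz] gives g with <A1
    h, f> = <A2 h, g> for all h. By symmetry A1 f - A2 g is orthogonal to H, in particular to
    itself. *)
Lemma douglas (A1 A2 : E -> E) c f : ip_complete -> ip_definite -> 0 <= c ->
  operator_on A1 -> operator_on A2 -> symmetric_on A1 -> symmetric_on A2 ->
  (forall h, H h -> sqn (A1 h) <= c * sqn (A2 h)) -> H f ->
  exists2 g, H g & A1 f = A2 g.
Proof.
move=> compl def c0 o1 o2 s1 s2 le12 Hf.
have [|u Hu|g Hg gP] := @riesz A2 (fun h => ip (A1 h) f) (Num.sqrt c * nrm f) compl o2.
- by move=> d u v Hu Hv; rewrite op_lin// ip_linl//; exact: op_in.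
- rewrite (le_trans (cauchy_schwarz (op_in o1 Hu) Hf))// mulrAC.
  by rewrite ler_wpM2r ?nrm_ge0// -sqrtrM// ler_wsqrtr// le12.
exists g => //.
have HA1 := op_in o1 Hf; have HA2 := op_in o2 Hg.
apply/eqP; rewrite -subr_eq0; apply/eqP/def; first by auto.
have HB : H (A1 f - A2 g) by auto.
rewrite /sqn ipBr// -s1// -s2//; first by rewrite gP// subrr.
Qed.

(** * Square roots of 1 - Y by iteration, for a symmetric contraction Y *)

Section SquareRoot.
Variable Y : E -> E.
Hypotheses (compl : ip_complete) (def : ip_definite) (oY : operator_on Y)
  (sY : symmetric_on Y) (nY : forall f, H f -> nrm (Y f) <= nrm f).

(* The limit W of these iterates satisfies W = (Y + W^2) / 2, that is, (1 - W)^2 = 1 - Y. *)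
Fixpoint sqrt_iter n (f : E) : E :=
  if n is n'.+1 then 2^-1 *: (Y f + sqrt_iter n' (sqrt_iter n' f)) else 0.

(** The same recursion with Y replaced by the number 1. It increases and stays below its fixed point
    1, and it majorizes both the iterates and their differences. *)
Fixpoint sqrt_bound n : R :=
  if n is n'.+1 then 2^-1 * (1 + sqrt_bound n' ^+ 2) else 0.

Local Notation Z := sqrt_iter.
Local Notation q := sqrt_bound.

Lemma sqrt_iter_op n : operator_on (Z n).
Proof.
elim: n => [|n oZ]; first by split=> [//|c u v _ _] /=; rewrite scaler0 addr0.
split=> [u Hu|c u v Hu Hv] /=.
  by apply/innerZ/innerD; [exact: op_in|do 2 apply: (op_in oZ)].
rewrite (op_lin oY)// (op_lin oZ)// (op_lin oZ); [|exact: op_in..].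
rewrite !scalerDr !scalerA [2^-1 * c]mulrC -!addrA; congr (_ + _).
by rewrite addrCA.
Qed.

Lemma sqrt_iter_sym n : symmetric_on (Z n).
Proof.
elim: n => [|n IH] f g Hf Hg /=; first by rewrite ip0l// (ip_sym io)// ip0l.
have HZ u : H u -> H (Z n u) by exact: (op_in (sqrt_iter_op n)).
have HY u : H u -> H (Y u) by exact: op_in.
by rewrite ipZl ?ipZr ?ipDl ?ipDr ?sY ?IH; auto.
Qed.

Lemma sqrt_bound01 n : 0 <= q n <= 1.
Proof.
elim: n => [|n /andP[q0 q1]] /=; first by rewrite lexx ler01.
have := sqr_ge0 (q n); have : q n ^+ 2 <= 1 by rewrite expr_le1.
by move=> ? ?; apply/andP; split; lra.
Qed.

Lemma sqrt_bound_nd : nondecreasing_seq q.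
Proof.
apply/nondecreasing_seqP => n /=; have := sqr_ge0 (q n - 1); rewrite sqrrB => ?; lra.
Qed.

Lemma sqrt_iter_le n f : H f -> nrm (Z n f) <= q n * nrm f.
Proof.
elim: n f => [|n IH] f Hf /=; first by rewrite /nrm /sqn ip0l// sqrtr0 mul0r.
have HZ u : H u -> H (Z n u) by exact: (op_in (sqrt_iter_op n)).
have HY u : H u -> H (Y u) by exact: op_in.
rewrite nrmZ; auto; rewrite gtr0_norm// -mulrA ler_wpM2l//.
rewrite (le_trans (nrmD _ _))//; auto; rewrite mulrDl mul1r lerD ?nY//.
rewrite (le_trans (IH _ _)); auto; rewrite expr2 -mulrA ler_wpM2l ?IH//.
by have /andP[] := sqrt_bound01 n.
Qed.

(* Z_m^2 - Z_n^2 = Z_m (Z_m - Z_n) + (Z_m - Z_n) Z_n, so that operators need not commute. *)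
Lemma sqrt_iter_dist m n f : (n <= m)%N -> H f ->
  nrm (Z m f - Z n f) <= (q m - q n) * nrm f.
Proof.
elim: n m f => [|n IH] [|m] f //.
- by move=> _ Hf; rewrite /= !subr0 /nrm /sqn ip0l// sqrtr0 mul0r.
- by move=> _ Hf; rewrite [Z 0 f]/= [q 0]/= !subr0; exact: sqrt_iter_le.
rewrite ltnS => nm Hf /=.
have HZ k u : H u -> H (Z k u) by exact: (op_in (sqrt_iter_op k)).
have HY u : H u -> H (Y u) by exact: op_in.
have -> : 2^-1 *: (Y f + Z m (Z m f)) - 2^-1 *: (Y f + Z n (Z n f)) =
   2^-1 *: (Z m (Z m f - Z n f) + (Z m (Z n f) - Z n (Z n f))).
  rewrite (opB (sqrt_iter_op m)); auto.
  by rewrite -scalerBr opprD addrACA subrr add0r addrA subrK.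
rewrite nrmZ; auto; rewrite gtr0_norm//.
have -> : (2^-1 * (1 + q m ^+ 2) - 2^-1 * (1 + q n ^+ 2)) * nrm f =
  2^-1 * (q m * ((q m - q n) * nrm f) + (q m - q n) * (q n * nrm f)) by ring.
rewrite ler_wpM2l// (le_trans (nrmD _ _)); auto; rewrite lerD//.
  rewrite (le_trans (sqrt_iter_le _ _)); auto; rewrite ler_wpM2l ?IH//.
  by have /andP[] := sqrt_bound01 m.
rewrite (le_trans (IH _ _ _ _)); auto; rewrite ler_wpM2l ?sqrt_iter_le//.
by rewrite subr_ge0 sqrt_bound_nd.
Qed.

Lemma sqrt_iter_cvg f : H f ->
  exists2 l, H l & (fun n => sqn (Z n f - l)) @ \oo --> (0 : R).
Proof.
move=> Hf.
have HZ k u : H u -> H (Z k u) by exact: (op_in (sqrt_iter_op k)).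
apply: compl => [n|e e0]; first exact: HZ.
have cq : cvgn q.
  apply: nondecreasing_is_cvgn; first exact: sqrt_bound_nd.
  by exists 1 => _ [n _ <-]; have /andP[] := sqrt_bound01 n.
(* [nrm f + 1] replaces [nrm f], which may vanish; the bound is halved below because both indices
   are compared with the limit of [q]. *)
have d0 : 0 < Num.sqrt e / (nrm f + 1) by rewrite divr_gt0 ?sqrtr_gt0// ltr_pwDr// nrm_ge0.
have [N _ NP] := proj1 (cvgrPdist_lt _ _) cq _ (divr_gt0 d0 (ltr0Sn R 1)).
have sym m n : sqn (Z m f - Z n f) = sqn (Z n f - Z m f) by rewrite sqn_distC; auto.
exists N.
suff W m n : (n <= m)%N -> (N <= m)%N -> (N <= n)%N -> sqn (Z m f - Z n f) < e.
  move=> m n Nm Nn; have [nm|/ltnW mn] := leqP n m; first exact: W.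
  by rewrite sym; exact: W.
move=> nm Nm Nn; rewrite -nrm_sqr; auto.
rewrite -[ltRHS]sqr_sqrtr 1?ltW// ltr_pXn2r// ?nnegrE ?nrm_ge0 ?sqrtr_ge0//.
rewrite (le_lt_trans (sqrt_iter_dist nm Hf))//.
have := NP _ Nm; have := NP _ Nn; rewrite /= !ltr_norml => /andP[h1 h2] /andP[h3 h4].
have qd : q m - q n < Num.sqrt e / (nrm f + 1).
  by move: h1 h2 h3 h4; move: (lim _) (Num.sqrt e / _) => ? ? ? ? ? ?; lra.
have f1 : 0 < nrm f + 1 by rewrite ltr_pwDr// nrm_ge0.
have qmn : 0 <= q m - q n by rewrite subr_ge0 sqrt_bound_nd.
apply: (@le_lt_trans _ _ ((q m - q n) * (nrm f + 1))).
  by rewrite ler_wpM2l// lerDl.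
by rewrite -ltr_pdivlMr.
Qed.

(** A separate choice for each f. Linearity, the fixed point equation and commutation are recovered
    from the iterates by uniqueness of limits. *)
Definition sqrt_lim f := xget 0 [set l | H l /\ (fun n => sqn (Z n f - l)) @ \oo --> (0 : R)].

Definition sqrt_op f := f - sqrt_lim f.

Local Notation W := sqrt_lim.

Lemma sqrt_limP f : H f -> H (W f) /\ (fun n => sqn (Z n f - W f)) @ \oo --> (0 : R).
Proof.
move=> Hf; have [l Hl lP] := sqrt_iter_cvg Hf.
by have := @xgetPex _ 0 [set l | H l /\ (fun n => sqn (Z n f - l)) @ \oo --> (0 : R)] (ex_intro _ l (conj Hl lP)).
Qed.

Lemma sqrt_limH f : H f -> H (W f). Proof. by move=> /sqrt_limP[]. Qed.

Lemma sqrt_lim_nrm f : H f -> (fun n => nrm (Z n f - W f)) @ \oo --> (0 : R).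
Proof. by move=> /sqrt_limP[_]; exact: cvg_sqn_nrm. Qed.

Lemma nrm_lim_unique (u : nat -> E) k l : (forall n, H (u n)) -> H k -> H l ->
  (fun n => nrm (u n - k)) @ \oo --> (0 : R) ->
  (fun n => nrm (u n - l)) @ \oo --> (0 : R) -> k = l.
Proof.
move=> Hu Hk Hl uk ul; apply: nrm_le0_eq => //.
have h : (fun n => nrm (u n - k) + nrm (u n - l)) @ \oo --> (0 : R).
  by rewrite -(addr0 0); exact: cvgD.
rewrite -(cvg_lim _ h)//; apply: limr_ge; first by apply/cvg_ex; exists 0.
near=> n; rewrite (nrm_distC (Hu n) Hk); exact: nrm_dist.
Unshelve. all: by end_near. Qed.

(** T commutes with every iterate, and boundedness carries this to the limit. The intended T is
    multiplication by a complex scalar, which makes the square root complex linear. *)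
Lemma sqrt_lim_commute (T : E -> E) C : operator_on T ->
  (forall f, H f -> nrm (T f) <= C * nrm f) ->
  (forall f, H f -> T (Y f) = Y (T f)) -> forall f, H f -> T (W f) = W (T f).
Proof.
move=> oT bT TY f Hf.
have HZ k u : H u -> H (Z k u) by exact: (op_in (sqrt_iter_op k)).
have HT u : H u -> H (T u) by exact: op_in.
have HY u : H u -> H (Y u) by exact: op_in.
have HW u : H u -> H (W u) by exact: sqrt_limH.
have TZ n u : H u -> T (Z n u) = Z n (T u).
  elim: n u => [|n IH] u Hu /=; first by rewrite op0.
  by rewrite (opZ oT) ?(opD oT) ?TY ?IH; auto.
apply: (@nrm_lim_unique (fun n => Z n (T f))); auto; last by apply: sqrt_lim_nrm; auto.
apply: (@cvg_nrm_le _ (fun n => C * nrm (Z n f - W f))) => [n|].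
  by rewrite -TZ// -(opB oT); auto.
by rewrite -(mulr0 C); apply: cvgMl_tmp; exact: sqrt_lim_nrm.
Qed.

Lemma sqrt_lim_op : operator_on W.
Proof.
split=> [u Hu|c u v Hu Hv]; first exact: sqrt_limH.
have HZ k w : H w -> H (Z k w) by exact: (op_in (sqrt_iter_op k)).
have HW w : H w -> H (W w) by exact: sqrt_limH.
apply: (@nrm_lim_unique (fun n => Z n (c *: u + v))); auto.
  by apply: sqrt_lim_nrm; auto.
apply: (@cvg_nrm_le _ (fun n => `|c| * nrm (Z n u - W u) + nrm (Z n v - W v))) => [n|].
  rewrite (op_lin (sqrt_iter_op n))// opprD addrACA -scalerBr -nrmZ; auto.
  by apply: nrmD; auto.
rewrite -(addr0 0) -{1}(mulr0 `|c|); apply: cvgD; last exact: sqrt_lim_nrm.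
by apply: cvgMl_tmp; exact: sqrt_lim_nrm.
Qed.

Lemma sqrt_lim_le f : H f -> nrm (W f) <= nrm f.
Proof.
move=> Hf; have HZ k w : H w -> H (Z k w) by exact: (op_in (sqrt_iter_op k)).
have HW := sqrt_limH Hf.
have h : (fun n => nrm (Z n f - W f) + nrm f) @ \oo --> nrm f.
  by rewrite -[X in _ --> X]add0r; apply: cvgD; [exact: sqrt_lim_nrm|exact: cvg_cst].
rewrite -(cvg_lim _ h)//; apply: limr_ge; first by apply/cvg_ex; eexists; exact: h.
near=> n; have := nrmD (innerB HW (HZ n _ Hf)) (HZ n _ Hf).
rewrite subrK nrm_distC//; auto => /le_trans; apply; rewrite lerD2l.
rewrite (le_trans (sqrt_iter_le _ Hf))// ler_piMl ?nrm_ge0//.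
by have /andP[] := sqrt_bound01 n.
Unshelve. all: by end_near. Qed.

Lemma sqrt_lim_sym : symmetric_on W.
Proof.
move=> f g Hf Hg; have HZ k w : H w -> H (Z k w) by exact: (op_in (sqrt_iter_op k)).
have HW w : H w -> H (W w) by exact: sqrt_limH.
have [_ cf] := sqrt_limP Hf; have [_ cg] := sqrt_limP Hg.
have c1 : (fun n => ip (Z n f) g) @ \oo --> ip (W f) g by apply: ip_cvg; auto.
have c2 : (fun n => ip (Z n g) f) @ \oo --> ip (W g) f by apply: ip_cvg; auto.
rewrite [RHS](ip_sym io); auto; apply: (cvg_unique _ c1) => //.
have -> // : (fun n => ip (Z n f) g) = (fun n => ip (Z n g) f).
by apply/funext => n; rewrite sqrt_iter_sym// (ip_sym io); auto.
Qed.

Lemma sqrt_lim_sqr f : H f -> W f = 2^-1 *: (Y f + W (W f)).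
Proof.
move=> Hf; have HZ k w : H w -> H (Z k w) by exact: (op_in (sqrt_iter_op k)).
have HW w : H w -> H (W w) by exact: sqrt_limH.
have HY u : H u -> H (Y u) by exact: op_in.
apply: (@nrm_lim_unique (fun n => Z n.+1 f)); auto.
  by have := sqrt_lim_nrm Hf; rewrite -(cvg_shiftS (fun n => nrm (Z n f - W f))).
apply: (@cvg_nrm_le _ (fun n => nrm (Z n f - W f) + nrm (Z n (W f) - W (W f)))) => [n|].
  rewrite -[X in _ - X]/(2^-1 *: _) /= -scalerBr opprD addrACA subrr add0r nrmZ; auto.
  rewrite -(subrK (Z n (W f)) (Z n (Z n f))) -addrA -(opB (sqrt_iter_op n)); auto.
  rewrite gtr0_norm// -[leRHS]mul1r ler_pM ?nrm_ge0 ?invf_le1 ?ler1n//.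
  rewrite (le_trans (nrmD _ _)); auto; rewrite lerD2r.
  rewrite (le_trans (sqrt_iter_le _ _)); auto; rewrite ler_piMl ?nrm_ge0//.
  by have /andP[] := sqrt_bound01 n.
by rewrite -(addr0 0); apply: cvgD; apply: sqrt_lim_nrm; auto.
Qed.

Lemma sqrt_op_sqr f : H f -> sqrt_op (sqrt_op f) = f - Y f.
Proof.
move=> Hf; have HW w : H w -> H (W w) by exact: sqrt_limH.
rewrite /sqrt_op (opB sqrt_lim_op); auto.
have : 2 *: W f = Y f + W (W f).
  by rewrite {1}sqrt_lim_sqr// scalerA divff// scale1r.
move/eqP; rewrite [Y f + _]addrC -subr_eq => /eqP <-.
by rewrite opprB scaler_nat mulr2n [_ - Y f - _]addrAC addrK addrA subrK.
Qed.

Lemma sqrt_op_op : operator_on sqrt_op.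
Proof.
have oW := sqrt_lim_op; split=> [u Hu|c u v Hu Hv].
  by apply: innerB => //; exact: op_in.
by rewrite /sqrt_op (op_lin oW)// opprD addrACA -scalerBr.
Qed.

Lemma sqrt_op_sym : symmetric_on sqrt_op.
Proof.
move=> f g Hf Hg; have HW w : H w -> H (W w) by exact: sqrt_limH.
by rewrite /sqrt_op ipBl ?ipBr ?sqrt_lim_sym; auto.
Qed.

Lemma sqrt_op_ge0 f : H f -> 0 <= ip (sqrt_op f) f.
Proof.
move=> Hf; have HW w : H w -> H (W w) by exact: sqrt_limH.
rewrite /sqrt_op ipBl; auto; rewrite subr_ge0 (le_trans (ler_norm _))//.
rewrite (le_trans (cauchy_schwarz _ _)); auto.
rewrite -/(sqn f) -nrm_sqr// expr2 ler_wpM2r ?nrm_ge0// sqrt_lim_le//.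
Qed.

Lemma sqrt_op_le f : H f -> nrm (sqrt_op f) <= 2 * nrm f.
Proof.
move=> Hf; have HW w : H w -> H (W w) by exact: sqrt_limH.
rewrite /sqrt_op (le_trans (nrmD _ _)); auto.
by rewrite nrmN; auto; have := sqrt_lim_le Hf => ?; lra.
Qed.

Lemma sqrt_op_commute (T : E -> E) C : operator_on T ->
  (forall f, H f -> nrm (T f) <= C * nrm f) ->
  (forall f, H f -> T (Y f) = Y (T f)) -> forall f, H f -> T (sqrt_op f) = sqrt_op (T f).
Proof.
move=> oT bT TY f Hf; have HW w : H w -> H (W w) by exact: sqrt_limH.
by rewrite /sqrt_op (opB oT); auto; rewrite (sqrt_lim_commute oT bT TY).
Qed.

End SquareRoot.

(** Here [B] is the adjoint (1 + V'^2) / 2. With D = 1 - V V' and w = V' (V' f), |D B f|^2 <= 2 |D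
    f|^2 + |D (f - w)|^2 / 2. Since |D f|^2 = |f|^2 - |V' f|^2 <= |f|^2 - |w|^2 and D is a
    contraction, this is at most 2 |f|^2 - 2 |w|^2 + |f - w|^2, which is 4 (|f|^2 - |B f|^2). *)
Lemma shift_defect_le (V V' : E -> E) f (B := fun f => 2^-1 *: (f + V' (V' f))) :
  operator_on V -> operator_on V' -> (forall h, H h -> sqn (V h) = sqn h) ->
  (forall h k, H h -> H k -> ip (V' h) k = ip h (V k)) -> H f ->
  sqn (V' (B f)) <= sqn (B f) /\
  sqn (B f) - sqn (V' (B f)) <= 4 * (sqn f - sqn (B f)).
Proof.
move=> oV oV' isoV adj Hf.
have HV u : H u -> H (V u) by exact: op_in.
have HV' u : H u -> H (V' u) by exact: op_in.
have HB u : H u -> H (B u) by rewrite /B => ?; auto.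
pose D u := u - V (V' u).
have HD u : H u -> H (D u) by rewrite /D; auto.
(* Both |V V' u|^2 and <u, V V' u> equal |V' u|^2, by isometry and by adjunction; the contractivity
   of [V'] is a consequence. *)
have DE u : H u -> sqn (D u) = sqn u - sqn (V' u).
  move=> Hu; rewrite sqnB; auto; rewrite isoV; auto.
  by rewrite -adj; auto; rewrite -/(sqn (V' u)); ring.
have V'le u : H u -> sqn (V' u) <= sqn u.
  by move=> Hu; rewrite -subr_ge0 -DE// sqn_ge0; auto.
split; first by apply: V'le; auto.
set w := V' (V' f); have Hw : H w by rewrite /w; auto.
have fw : H (f - w) by auto.
have DBE : D (B f) = D f - 2^-1 *: D (f - w).
  have BE : B f = f - 2^-1 *: (f - w).
    rewrite /B -/w scalerDr scalerBr opprB [_ *: w - _]addrC addrA.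
    by congr (_ + _); rewrite -{2}[f]scale1r -scalerBl; congr (_ *: _); field.
  have lin u v : H u -> H v -> D (u - 2^-1 *: v) = D u - 2^-1 *: D v.
    move=> Hu Hv; rewrite /D (opB oV') ?(opB oV) ?(opZ oV') ?(opZ oV); auto.
    rewrite scalerBr !opprB [LHS]addrACA [RHS]addrACA; congr (_ + _); exact: addrC.
  by rewrite BE lin.
rewrite -DE; auto; rewrite DBE.
have S1 : sqn (D f - 2^-1 *: D (f - w)) <= 2 * sqn (D f) + 2 * sqn (2^-1 *: D (f - w)).
  have := sqn_ge0 (innerD (HD _ Hf) (innerZ 2^-1 (HD _ fw))).
  rewrite (sqnD (HD _ Hf) (innerZ 2^-1 (HD _ fw))).
  by rewrite (sqnB (HD _ Hf) (innerZ 2^-1 (HD _ fw))) => ?; lra.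
have S2 : sqn (D (f - w)) <= sqn (f - w).
  by rewrite DE// lerBlDr lerDl sqn_ge0; auto.
have S3 : sqn w <= sqn (V' f) by rewrite /w V'le; auto.
have S4 : sqn (B f) = 4^-1 * (2 * sqn f + 2 * sqn w - sqn (f - w)).
  by rewrite /B -/w sqnB ?sqnZ ?sqnD; auto; field.
move: S1; rewrite sqnZ; auto; rewrite DE// S4 => S1.
have e4 : (2^-1) ^+ 2 = 4^-1 :> R by field.
move: S1; rewrite e4 => S1; have := sqn_ge0 fw => ?; lra.
Qed.

Lemma ip_ext u v : ip_definite -> H u -> H v -> (forall k, H k -> ip u k = ip v k) -> u = v.
Proof.
move=> def Hu Hv e; apply/eqP; rewrite -subr_eq0; apply/eqP/def; first by auto.
by rewrite /sqn ipBl//; last (by auto); rewrite e ?subrr//; auto.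
Qed.

(** [B2] and [B1] are given only by their adjoint relations to [B] and [V B]; definiteness
    identifies them with (1 + V'^2) / 2 and V' [B2]. Then |f|^2 - |B1 f|^2 is the sum of |f|^2 - |B2
    f|^2 and a term at most 4 times as large. The reverse inequality even holds with constant 1; 5
    is kept so that both directions have the same form. *)
Lemma shift_adjoint_defect (V V' B2 B1 : E -> E) (B := fun f => 2^-1 *: (f + V (V f))) :
  ip_definite -> operator_on V -> operator_on V' -> (forall h, H h -> sqn (V h) = sqn h) ->
  (forall h k, H h -> H k -> ip (V' h) k = ip h (V k)) ->
  (forall h, H h -> H (B2 h)) -> (forall h k, H h -> H k -> ip (B2 h) k = ip h (B k)) ->
  (forall h, H h -> H (B1 h)) -> (forall h k, H h -> H k -> ip (B1 h) k = ip h (V (B k))) ->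
  forall f, H f -> sqn f - sqn (B1 f) <= 5 * (sqn f - sqn (B2 f)) /\
    sqn f - sqn (B2 f) <= 5 * (sqn f - sqn (B1 f)).
Proof.
move=> def oV oV' isoV adj HB2 adj2 HB1 adj1 f Hf.
have HV u : H u -> H (V u) by exact: op_in.
have HV' u : H u -> H (V' u) by exact: op_in.
have B2E h : H h -> B2 h = 2^-1 *: (h + V' (V' h)).
  move=> Hh; apply: ip_ext => //; [by auto|by auto|move=> k Hk].
  rewrite adj2// /B ipZr; auto; rewrite ipDr; auto; rewrite ipZl; auto; rewrite ipDl; auto.
  by rewrite !adj; auto.
have B1E h : H h -> B1 h = V' (B2 h).
  move=> Hh; apply: ip_ext => //; [by auto|by auto|move=> k Hk].
  have HBk : H (B k) by rewrite /B; auto.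
  rewrite adj1// -adj// -adj2; auto; congr (ip _ _).
  by rewrite !B2E; auto; rewrite (opZ oV') ?(opD oV'); auto.
have [le1] := shift_defect_le oV oV' isoV adj Hf.
rewrite B1E// B2E// in le1 * => le2.
by move: (sqn _) (sqn _) (sqn _) le1 le2 => x y z ? ?; split; lra.
Qed.

End InnerProduct.

(** * Trigonometric polynomials *)

Section Circle.
Variable R : realType.
Notation C := R[i].
Notation mu := (@lebesgue_measure R).
Implicit Types (a : nat -> C) (w z : C) (x t c d : R).

Lemma complex_ReD z w : complex.Re (z + w) = complex.Re z + complex.Re w.
Proof. by case: z w => [? ?] [? ?]. Qed.

Lemma complex_ReB z w : complex.Re (z - w) = complex.Re z - complex.Re w.
Proof. by case: z w => [? ?] [? ?]. Qed.

Lemma complex_ReM z w : complex.Re (z * w) =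
  complex.Re z * complex.Re w - complex.Im z * complex.Im w.
Proof. by case: z w => [? ?] [? ?]. Qed.

Lemma complex_ImM z w : complex.Im (z * w) =
  complex.Re z * complex.Im w + complex.Im z * complex.Re w.
Proof. by case: z w => [? ?] [? ?]. Qed.

Lemma complex_ReZ x z : complex.Re (x%:C * z) = x * complex.Re z.
Proof. by rewrite complex_ReM /= mul0r subr0. Qed.

Lemma complex_Re_sum (I : Type) (r : seq I) (P : pred I) (F : I -> C) :
  complex.Re (\sum_(i <- r | P i) F i) = \sum_(i <- r | P i) complex.Re (F i).
Proof. by apply: (big_rec2 (fun (z : C) (y : R) => complex.Re z = y)) => [|i z y _ <-]; rewrite ?complex_ReD. Qed.

Lemma normc_sqr z : normc z ^+ 2 = complex.Re z ^+ 2 + complex.Im z ^+ 2.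
Proof. by case: z => x y; rewrite /= sqr_sqrtr// addr_ge0 ?sqr_ge0. Qed.

Lemma normc_ge0 z : 0 <= normc z. Proof. by case: z => x y; exact: sqrtr_ge0. Qed.

Lemma normc_sqr_mul z : (normc z ^+ 2)%:C = z * conjc z.
Proof. by rewrite normc_sqr; case: z => x y; simpc; congr (_ +i* _); ring. Qed.

Lemma Re_sqr_le z : complex.Re z ^+ 2 <= normc z ^+ 2.
Proof. by rewrite normc_sqr lerDl sqr_ge0. Qed.

Lemma expitD x t : expit (x + t) = expit x * expit t.
Proof. by rewrite /expit cosD sinD; congr (_ +i* _); ring. Qed.

Lemma expit0 : expit (0 : R) = 1. Proof. by rewrite /expit cos0 sin0. Qed.

Lemma expitN x : expit (- x) = conjc (expit x).
Proof. by rewrite /expit cosN sinN. Qed.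

Lemma expitX x n : expit x ^+ n = expit (n%:R * x).
Proof.
by elim: n => [|n IH]; rewrite ?mul0r ?expit0// exprS IH -expitD -natr1 mulrDl mul1r addrC.
Qed.

Lemma normc_expit x : normc (expit x) = 1.
Proof. by rewrite /= cos2Dsin2 sqrtr1. Qed.

Lemma expit_conjV x : expit x * conjc (expit x) = 1.
Proof. by rewrite -expitN -expitD subrr expit0. Qed.

Lemma expit_period c : expit (c + 2 * pi) = expit c.
Proof. by rewrite expitD /expit mulr_natl cos2pi sin2pi mulr1. Qed.

Lemma Re_mul_expitX w n x : complex.Re (w * expit x ^+ n) =
  complex.Re w * cos (n%:R * x) - complex.Im w * sin (n%:R * x).
Proof. by rewrite expitX complex_ReM. Qed.

Lemma is_derive_cosZ (k x : R) : is_derive x 1 (fun x => cos (k * x)) (- k * sin (k * x)).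
Proof.
have h : is_derive x 1 (fun x => k * x) k.
  by rewrite -[X in is_derive _ _ _ X]mulr1; apply: is_deriveZ.
have -> : - k * sin (k * x) = (- sin (k * x)) * k by ring.
exact: (@is_derive1_comp _ (@cos R) (fun x => k * x)).
Qed.

Lemma is_derive_sinZ (k x : R) : is_derive x 1 (fun x => sin (k * x)) (k * cos (k * x)).
Proof.
have h : is_derive x 1 (fun x => k * x) k.
  by rewrite -[X in is_derive _ _ _ X]mulr1; apply: is_deriveZ.
rewrite mulrC.
exact: (@is_derive1_comp _ (@sin R) (fun x => k * x)).
Qed.

Lemma is_derive_continuous (F : R -> R) (x df : R) : is_derive x 1 F df -> {for x, continuous F}.
Proof. by move=> [dF _]; apply/differentiable_continuous/derivable1_diffP. Qed.

Lemma continuous_Re_expitX w n : continuous (fun x => complex.Re (w * expit x ^+ n)).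
Proof.
under eq_fun do rewrite Re_mul_expitX.
move=> x; apply: cvgB; apply: cvgMl_tmp.
  exact: (is_derive_continuous (is_derive_cosZ _ _)).
exact: (is_derive_continuous (is_derive_sinZ _ _)).
Qed.

Lemma continuous_integrable_itv (f : R -> R) c d : continuous f ->
  mu.-integrable `[c, d] (EFin \o f).
Proof.
move=> cf; apply: continuous_compact_integrable; first exact: segment_compact.
exact: continuous_subspaceT.
Qed.

Lemma Rintegral_derive (f F : R -> R) c d : c < d -> continuous f ->
  (forall x, is_derive x 1 F (f x)) -> \int[mu]_(x in `[c, d]) f x = F d - F c.
Proof.
move=> cd cf dF; have cF x : {for x, continuous F} by exact: (is_derive_continuous (dF x)).
rewrite /Rintegral (@continuous_FTC2 _ f F)//.
- exact: continuous_subspaceT.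
- split => [x _||]; first by have [] := dF x.
  + by apply: cvg_at_right_filter; exact: cF.
  + by apply: cvg_at_left_filter; exact: cF.
- by move=> x _; rewrite derive1E (@derive_val _ _ _ _ _ _ _ (dF x)).
Qed.

Lemma Rintegral_itv_cst (k : R) c d : c < d ->
  \int[mu]_(x in `[c, d]) k = k * (d - c).
Proof.
move=> cd; rewrite Rintegral_cst//; congr (_ * _).
have E : lebesgue_measure `[c, d]%classic = (d - c)%:E :> \bar R.
  by rewrite lebesgue_measure_itv/= lte_fin cd -EFinD.
by transitivity (fine (d - c)%:E) => //; rewrite -E.
Qed.

(** The condition [expit d = expit c] admits any whole number of periods: [0, 2 pi], the windows
    [t - pi, t + pi] and an interval of length 6 pi all occur later. *)
Lemma Rintegral_expitX w n c d : c < d -> expit d = expit c -> (0 < n)%N ->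
  \int[mu]_(x in `[c, d]) complex.Re (w * expit x ^+ n) = 0.
Proof.
move=> cd edc n0; have n0' : n%:R != 0 :> R by rewrite pnatr_eq0 -lt0n.
pose F x := n%:R^-1 * (complex.Re w * sin (n%:R * x) + complex.Im w * cos (n%:R * x)).
have FE x : F x = n%:R^-1 * complex.Im (w * expit x ^+ n) by rewrite expitX complex_ImM.
transitivity (F d - F c); last by rewrite !FE edc subrr.
apply: Rintegral_derive => //; first exact: continuous_Re_expitX.
move=> x; rewrite Re_mul_expitX.
have -> : complex.Re w * cos (n%:R * x) - complex.Im w * sin (n%:R * x) =
  n%:R^-1 *: (complex.Re w *: (n%:R * cos (n%:R * x)) +
              complex.Im w *: (- n%:R * sin (n%:R * x))) :> R.
  by rewrite /GRing.scale /=; field.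
have hs := is_derive_sinZ n%:R x; have hc := is_derive_cosZ n%:R x.
by apply: is_deriveZ; apply: is_deriveD; apply: is_deriveZ.
Qed.

Definition tpoly a N x : C := \sum_(n < N) a n * expit x ^+ n.

Lemma tpoly0 a x : tpoly a 0 x = 0. Proof. by rewrite /tpoly big_ord0. Qed.

Lemma tpolyS a N x : tpoly a N.+1 x = tpoly a N x + a N * expit x ^+ N.
Proof. by rewrite /tpoly big_ord_recr. Qed.

Lemma Re_tpoly a N x : complex.Re (tpoly a N x) = \sum_(n < N) complex.Re (a n * expit x ^+ n).
Proof. exact: complex_Re_sum. Qed.

Lemma continuous_Re_tpoly a N : continuous (fun x => complex.Re (tpoly a N x)).
Proof.
elim: N => [|N IH] x; first by under eq_fun do rewrite Re_tpoly big_ord0; exact: cvg_cst.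
under eq_fun do rewrite Re_tpoly big_ord_recr /= -Re_tpoly.
by apply: cvgD; [exact: IH|exact: continuous_Re_expitX].
Qed.

Lemma ReNi z : complex.Re (- 'i * z) = complex.Im z.
Proof. by case: z => x y; simpc. Qed.

(** Rotating the coefficients by -i turns imaginary parts into real parts, so that real parts alone
    need analysis. *)
Lemma Im_tpoly a N x : complex.Im (tpoly a N x) =
  complex.Re (tpoly (fun n => - 'i * a n) N x).
Proof.
by rewrite -ReNi /tpoly mulr_sumr; congr complex.Re; apply: eq_bigr => n _; rewrite mulrA.
Qed.

Lemma continuous_Im_tpoly a N : continuous (fun x => complex.Im (tpoly a N x)).
Proof. by under eq_fun do rewrite Im_tpoly; exact: continuous_Re_tpoly. Qed.

Lemma continuous_normc2_tpoly a N : continuous (fun x => normc (tpoly a N x) ^+ 2).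
Proof.
under eq_fun do rewrite normc_sqr !expr2.
move=> x; apply: cvgD; apply: cvgM;
  solve [exact: continuous_Re_tpoly | exact: continuous_Im_tpoly].
Qed.

Lemma tpoly_parseval a N c d : c < d -> expit d = expit c ->
  \int[mu]_(x in `[c, d]) (normc (tpoly a N x) ^+ 2) =
  (d - c) * \sum_(n < N) normc (a n) ^+ 2.
Proof.
move=> cd edc; elim: N => [|N IH].
  under eq_Rintegral do rewrite /tpoly big_ord0 normc0 expr0n/=.
  by rewrite Rintegral_itv_cst// big_ord0 mul0r mulr0.
(* The cross term of |p_N + a_N e^{iNx}|^2. Its frequencies N - n are positive, so it integrates to
   0. *)
pose g x := \sum_(n < N) complex.Re (2 * (a N * conjc (a n)) * expit x ^+ (N - n)).
have nE x : normc (tpoly a N.+1 x) ^+ 2 =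
    (normc (tpoly a N x) ^+ 2 + g x) + normc (a N) ^+ 2.
  rewrite /tpoly big_ord_recr /= -/(tpoly a N x).
  have -> : normc (tpoly a N x + a N * expit x ^+ N) ^+ 2 = normc (tpoly a N x) ^+ 2 +
     2 * complex.Re (a N * expit x ^+ N * conjc (tpoly a N x)) + normc (a N * expit x ^+ N) ^+ 2.
    rewrite !normc_sqr; move: (tpoly _ _ _) (a N * _) => [p q] [r s] /=; ring.
  congr (_ + _ + _); last by rewrite normcM expitX normc_expit mulr1.
  rewrite -complex_ReZ /tpoly rmorph_sum /= 2!mulr_sumr complex_Re_sum; apply: eq_bigr => n _.
  have e1 : expit x ^+ n * conjc (expit x ^+ n) = 1.
    by rewrite rmorphXn /= -exprMn expit_conjV expr1n.
  rewrite (_ : expit x ^+ N = expit x ^+ (N - n) * expit x ^+ n); last first.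
    by rewrite -exprD subnK// ltnW.
  have -> : 2 * (a N * conjc (a n)) * expit x ^+ (N - n) =
      2 * (a N * conjc (a n)) * expit x ^+ (N - n) * (expit x ^+ n * conjc (expit x ^+ n)).
    by rewrite e1 mulr1.
  have e2 : (2 : R)%:C = 2 :> C by exact: (rmorph_nat (real_complex R) 2).
  rewrite rmorphM /= e2; congr complex.Re.
  move: (expit x ^+ n) (expit x ^+ (N - n)) (conjc (expit x ^+ n)) (conjc (a n)) => ? ? ? ?; ring.
have cg M : continuous (fun x => \sum_(n < M) complex.Re (2 * (a N * conjc (a n)) * expit x ^+ (N - n))).
  elim: M => [|M IHM] x; first by under eq_fun do rewrite big_ord0; exact: cvg_cst.
  under eq_fun do rewrite big_ord_recr /=.
  by apply: cvgD; [exact: IHM|exact: continuous_Re_expitX].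
have g0 M : (M <= N)%N ->
    \int[mu]_(x in `[c, d]) (\sum_(n < M) complex.Re (2 * (a N * conjc (a n)) * expit x ^+ (N - n))) = 0.
  elim: M => [|M IHM] MN.
    by under eq_Rintegral do rewrite big_ord0; rewrite Rintegral_itv_cst// mul0r.
  under eq_Rintegral do rewrite big_ord_recr /=.
  rewrite RintegralD//; [|by apply: continuous_integrable_itv; exact: cg|].
    by rewrite IHM 1?ltnW// Rintegral_expitX// ?addr0// subn_gt0.
  by apply: continuous_integrable_itv; exact: continuous_Re_expitX.
under eq_Rintegral do rewrite nE.
have cn := @continuous_normc2_tpoly a N.
have cgN : continuous g := cg N.
rewrite RintegralD//; last 2 first.
- by apply: continuous_integrable_itv => x; apply: cvgD; [exact: cn|exact: cgN].
- by apply: continuous_integrable_itv => x; exact: cvg_cst.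
rewrite RintegralD//; [|exact: continuous_integrable_itv..].
rewrite IH g0// addr0 (Rintegral_itv_cst (normc (a N) ^+ 2) cd) big_ord_recr /= [RHS]mulrDr.
by congr (_ + _); exact: mulrC.
Qed.

End Circle.

(** * The Poisson kernel *)

Section Poisson.
Variable R : realType.
Notation C := R[i].
Notation mu := (@lebesgue_measure R).
Implicit Types (a : nat -> C) (w z : C) (x t c d r s : R).

Definition poisson r s := (1 - r ^+ 2) / (1 - 2 * r * cos s + r ^+ 2).

Lemma poisson_denom r s : 0 <= r -> (1 - r) ^+ 2 <= 1 - 2 * r * cos s + r ^+ 2.
Proof.
move=> r0; have : r * cos s <= r by rewrite ler_piMr// cos_le1.
rewrite sqrrB => ?; lra.
Qed.

Lemma poisson_denom_gt0 r s : 0 <= r < 1 -> 0 < 1 - 2 * r * cos s + r ^+ 2.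
Proof.
move=> /andP[r0 r1]; apply: lt_le_trans (poisson_denom s r0).
by rewrite exprn_gt0// subr_gt0.
Qed.

Lemma poisson_ge0 r s : 0 <= r < 1 -> 0 <= poisson r s.
Proof.
move=> r01; have /andP[r0 r1] := r01.
rewrite divr_ge0// ?(ltW (poisson_denom_gt0 _ _))// subr_ge0 expr_le1// ltW//.
Qed.

Lemma poisson_le r s : 0 <= r < 1 -> poisson r s <= 2 / (1 - r).
Proof.
move=> r01; have /andP[r0 r1] := r01.
rewrite ler_pdivrMr ?poisson_denom_gt0// mulrAC ler_pdivlMr ?subr_gt0//.
have := poisson_denom s r0; set D := 1 - _ + _ => h.
have : (1 - r ^+ 2) * (1 - r) <= 2 * (1 - r) ^+ 2.
  rewrite (_ : 1 - r ^+ 2 = (1 + r) * (1 - r)); last by ring.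
  by rewrite -mulrA -expr2 ler_wpM2r ?sqr_ge0//; lra.
move=> h2; apply: le_trans h2 _; lra.
Qed.

(** Up to s = 2, 1 - cos s = 2 sin (s / 2)^2 and sin u >= u cos 1 on [0, 1] by the mean value
    theorem. Beyond 2, cos s <= cos 2 < 0, so 1 - cos s >= 1, while s^2 / 16 <= 1 because pi < 4. *)
Lemma quadratic_le_1Bcos : exists2 k : R, 0 < k & forall s, `|s| <= pi -> k * s ^+ 2 <= 1 - cos s.
Proof.
have c0 := @cos1_gt0 R.
pose k := Num.min (cos 1 ^+ 2 / 2) (16^-1 : R).
have k0 : 0 < k by rewrite lt_min; apply/andP; split; [rewrite divr_gt0// exprn_gt0|].
exists k => // s; wlog s0 : s / 0 <= s.
  move=> h sp; have [|/ltW s0] := leP 0 s; first by move/h; exact.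
  by have := h (- s); rewrite oppr_ge0 normrN sqrrN cosN; exact.
rewrite ger0_norm// => sp.
have [s2|s2] := leP s 2; last first.
  have cs : cos s <= 0.
    rewrite (le_trans _ (ltW (@cos2_lt0 R)))//.
    have p2 := @pi_ge2 R.
    rewrite leNgt; have -> : (cos 2 < cos s) = (s < 2); last by rewrite -leNgt ltW.
    by apply: ltr_cos; rewrite in_itv/=; apply/andP; split.
  have s4 : s <= 4 by rewrite (le_trans sp)//; have := @pihalf_lt2 R => ?; lra.
  apply: (@le_trans _ _ 1); last by rewrite lerBrDr -lerBrDl subrr.
  apply: (@le_trans _ _ (16^-1 * 4 ^+ 2)); last by rewrite -natrX mulVf.
  apply: ler_pM => //; [exact: ltW|exact: sqr_ge0|by rewrite ge_min lexx orbT|by rewrite ler_pXn2r// nnegrE].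
have su : s / 2 * cos 1 <= sin (s / 2).
  have u0 : 0 <= s / 2 by rewrite divr_ge0.
  have [|x xin] := @MVT_segment R sin cos 0 (s / 2) u0 (fun x _ => is_derive_sin x).
    exact/continuous_subspaceT/continuous_sin.
  rewrite sin0 !subr0 => ->; rewrite [leLHS]mulrC ler_wpM2r//.
  move: xin; rewrite in_itv/= => /andP[x0 xs].
  have x1 : x <= 1 by rewrite (le_trans xs)// ler_pdivrMr// mul1r.
  have p2 := @pi_ge2 R.
  rewrite leNgt; have -> : (cos x < cos 1) = (1 < x); last by rewrite -leNgt.
  by apply: ltr_cos; rewrite in_itv/=; apply/andP; split => //; lra.
have -> : cos s = 1 - 2 * sin (s / 2) ^+ 2.
  by rewrite {1}[s]splitr cosD -!expr2 cos2sin2; ring.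
have h : (s / 2 * cos 1) ^+ 2 <= sin (s / 2) ^+ 2.
  rewrite ler_pXn2r// nnegrE; last first.
    by rewrite (le_trans _ su)// !mulr_ge0 ?invr_ge0// ltW.
  by rewrite !mulr_ge0 ?invr_ge0// ltW.
have : k * s ^+ 2 <= cos 1 ^+ 2 / 2 * s ^+ 2 by rewrite ler_wpM2r ?sqr_ge0// ge_min lexx.
move: h; rewrite !exprMn exprVn => h; move/le_trans; apply.
move: h; have -> : (2 ^+ 2)^-1 = 4^-1 :> R by rewrite -natrX.
by move: (cos 1 ^+ 2) (s ^+ 2) => ? ? ?; lra.
Qed.

(** The denominator is (1 - r)^2 + 2 r (1 - cos s), at least 1 - cos s once r >= 1/2. This is the
    decay of order (1 - r) / s^2 of the kernel away from its centre. *)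
Lemma poisson_le_sqr k r s : 2^-1 <= r < 1 -> 0 < k -> k * s ^+ 2 <= 1 - cos s ->
  poisson r s * (k * s ^+ 2) <= 2 * (1 - r).
Proof.
move=> /andP[r2 r1] k0 ks; have r0 : 0 <= r by rewrite (le_trans _ r2).
have r01 : 0 <= r < 1 by rewrite r0.
rewrite mulrAC ler_pdivrMr ?poisson_denom_gt0//.
have h : 1 - cos s <= 1 - 2 * r * cos s + r ^+ 2.
  have : 0 <= (1 - cos s) * (2 * r - 1) by rewrite mulr_ge0 ?subr_ge0 ?cos_le1//; lra.
  have := sqr_ge0 (1 - r); rewrite sqrrB => ? ?; lra.
apply: (@le_trans _ _ (2 * (1 - r) * (k * s ^+ 2))); last first.
  by rewrite ler_wpM2l ?(le_trans ks)// mulr_ge0// subr_ge0 ltW.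
rewrite ler_wpM2r//; first by rewrite mulr_ge0 ?sqr_ge0// ltW.
have := sqr_ge0 (1 - r); rewrite sqrrB => ?; lra.
Qed.

Lemma continuous_poisson r t : 0 <= r < 1 -> continuous (fun x => poisson r (x - t)).
Proof.
move=> r01 x; apply: cvgMl_tmp; apply: cvgV; first by rewrite lt0r_neq0// poisson_denom_gt0.
apply: cvgD; last exact: cvg_cst.
apply: cvgB; first exact: cvg_cst.
apply: cvgMl_tmp; apply: (@continuous_comp _ _ _ (fun x => x - t) cos); last exact: continuous_cos.
by apply: cvgB; [exact: cvg_id|exact: cvg_cst].
Qed.

Section Moments.
Variables (r t c d : R).
Hypotheses (r01 : 0 <= r < 1) (cd : c < d) (edc : expit d = expit c).

(** The moments of the kernel. They are found from a three-term recurrence and boundedness, instead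
    of a series expansion of the kernel. *)
Let E n w := \int[mu]_(x in `[c, d]) (poisson r (x - t) * complex.Re (w * expit (x - t) ^+ n)).

Lemma Re_expitX_shift w n x :
  complex.Re (w * expit (x - t) ^+ n) = complex.Re (w * expit (- t) ^+ n * expit x ^+ n).
Proof. by rewrite expitD exprMn -mulrA [_ ^+ n * _]mulrC. Qed.

Lemma continuous_Re_expitX_shift w n : continuous (fun x => complex.Re (w * expit (x - t) ^+ n)).
Proof. by under eq_fun do rewrite Re_expitX_shift; exact: continuous_Re_expitX. Qed.

Lemma continuous_poisson_moment w n :
  continuous (fun x => poisson r (x - t) * complex.Re (w * expit (x - t) ^+ n)).
Proof.
by move=> x; apply: cvgM; [exact: continuous_poisson|exact: continuous_Re_expitX_shift].
Qed.

(** Multiplying the kernel by its denominator leaves the constant 1 - r^2, and 2 cos s shifts the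
    frequency by one both ways; what remains is the integral of a nonconstant exponential. *)
Lemma poisson_moment_rec w n :
  (1 + r ^+ 2) * E n.+1 w - r * (E n.+2 w + E n w) = 0.
Proof.
have i m := @continuous_integrable_itv R _ c d (@continuous_poisson_moment w m).
rewrite -RintegralD// -!RintegralZl//; last first.
  apply: continuous_integrable_itv => x.
  by apply: cvgD; exact: continuous_poisson_moment.
rewrite -RintegralB//; last 2 first.
- by apply: continuous_integrable_itv => x; apply: cvgMl_tmp; exact: continuous_poisson_moment.
- apply: continuous_integrable_itv => x; apply: cvgMl_tmp.
  by apply: cvgD; exact: continuous_poisson_moment.
rewrite -[RHS](mulr0 (1 - r ^+ 2)).
rewrite -(@Rintegral_expitX R (w * expit (- t) ^+ n.+1) n.+1 c d cd edc)//.
rewrite -RintegralZl//; last by apply: continuous_integrable_itv; exact: continuous_Re_expitX.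
apply: eq_Rintegral => x _; rewrite -Re_expitX_shift.
have key : complex.Re (w * expit (x - t) ^+ n.+2) + complex.Re (w * expit (x - t) ^+ n) =
    2 * cos (x - t) * complex.Re (w * expit (x - t) ^+ n.+1).
  rewrite -complex_ReD !exprS; move: (_ ^+ n) => z.
  have cs := cos2Dsin2 (x - t); rewrite /expit; move: (cos _) (sin _) cs => p q cs.
  clear i; case: w z => [w1 w2] [z1 z2]; simpc => /=.
  apply/eqP; rewrite -subr_eq0; apply/eqP.
  transitivity ((w1 * z1 - w2 * z2) * (1 - (p ^+ 2 + q ^+ 2))); first by ring.
  by rewrite cs subrr mulr0.
rewrite -mulrDr key /poisson; field.
by rewrite lt0r_neq0// poisson_denom_gt0.
Qed.

Lemma poisson_moment0 : (1 + r ^+ 2) * E 0 1 - 2 * r * E 1 1 = (1 - r ^+ 2) * (d - c).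
Proof.
have i m := @continuous_integrable_itv R _ c d (@continuous_poisson_moment 1 m).
rewrite -!RintegralZl// -RintegralB//; last 2 first.
- by apply: continuous_integrable_itv => x; apply: cvgMl_tmp; exact: continuous_poisson_moment.
- by apply: continuous_integrable_itv => x; apply: cvgMl_tmp; exact: continuous_poisson_moment.
rewrite -Rintegral_itv_cst//; apply: eq_Rintegral => x _.
rewrite expr0 expr1 !mul1r /= /poisson; field.
by rewrite lt0r_neq0// poisson_denom_gt0.
Qed.

Lemma poisson_moment_bound w n : `|E n w| <= 2 / (1 - r) * normc w * (d - c).
Proof.
have i := @continuous_integrable_itv R _ c d (@continuous_poisson_moment w n).
rewrite (le_trans (le_normr_Rintegral _ _))// -Rintegral_itv_cst//.
apply: le_Rintegral => //; first exact: integrable_norm.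
  by apply: continuous_integrable_itv => x; exact: cvg_cst.
move=> x _; rewrite normrM ger0_norm ?poisson_ge0// ler_pM ?poisson_ge0 ?poisson_le//.
have h z : `|complex.Re z| <= normc z.
  by rewrite -(@ler_pXn2r _ 2)// ?nnegrE ?normc_ge0// real_normK ?num_real// Re_sqr_le.
by rewrite (le_trans (h _))// normcM expitX normc_expit mulr1.
Qed.

(** The recurrence has the solutions r^n and r^-n, and boundedness excludes the second: D n = E (n +
    1) - r E n satisfies D n = r D (n + 1), hence D n = r^k D (n + k), which tends to 0 with k. *)
Lemma poisson_momentS w n : E n.+1 w = r * E n w.
Proof.
pose D n := E n.+1 w - r * E n w.
have Drec m : D m = r * D m.+1.
  by have := poisson_moment_rec w m; rewrite /D => ?; lra.
have DX m k : D m = r ^+ k * D (k + m)%N.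
  elim: k => [|k IH]; first by rewrite mul1r.
  by rewrite IH exprSr -mulrA -Drec.
pose B := 2 / (1 - r) * normc w * (d - c).
have /andP[r0 r1] := r01.
have Db m : `|D m| <= B + B.
  rewrite (le_trans (ler_normB _ _))// lerD ?poisson_moment_bound//.
  rewrite normrM ger0_norm// -[leRHS]mul1r ler_pM ?poisson_moment_bound// ltW//.
have cv : (fun k => r ^+ k * (B + B)) @ \oo --> (0 : R).
  rewrite -(mul0r (B + B)); apply: cvgMr_tmp; apply: cvg_expr; by rewrite ger0_norm.
suff : `|D n| <= 0 by rewrite normr_le0 subr_eq0 => /eqP.
rewrite -(cvg_lim _ cv)//; apply: limr_ge; first by apply/cvg_ex; exists 0.
near=> k; rewrite (DX n k) normrM normrX ger0_norm// ler_wpM2l// exprn_ge0//.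
Unshelve. all: by end_near. Qed.

Lemma poisson_moment w n : E n w = (d - c) * (r ^+ n * complex.Re w).
Proof.
have /andP[r0 r1] := r01.
have E01 : E 0 1 = d - c.
  have := poisson_moment0; rewrite poisson_momentS => h.
  have r2 : 1 - r ^+ 2 != 0 by rewrite lt0r_neq0// subr_gt0 expr_lt1.
  by apply: (mulfI r2); rewrite -h; ring.
elim: n => [|n IH]; last by rewrite poisson_momentS IH exprS; ring.
rewrite expr0 mul1r -E01 /E mulrC -RintegralZl//; last first.
  exact: (@continuous_integrable_itv R _ c d (@continuous_poisson_moment 1 0)).
by apply: eq_Rintegral => x _; rewrite !expr0 !mulr1 mulrC.
Qed.

Lemma poisson_tpoly a N :
  \int[mu]_(x in `[c, d]) (poisson r (x - t) * complex.Re (tpoly a N x)) =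
  (d - c) * complex.Re (tpoly (fun n => a n * (r ^+ n)%:C) N t).
Proof.
elim: N => [|N IH].
  under eq_Rintegral do rewrite Re_tpoly big_ord0 mulr0.
  by rewrite Rintegral_itv_cst// mul0r Re_tpoly big_ord0 mulr0.
under eq_Rintegral do rewrite Re_tpoly big_ord_recr /= -Re_tpoly mulrDr.
rewrite tpolyS complex_ReD mulrDr -IH RintegralD//; last 2 first.
- by apply: continuous_integrable_itv => x; apply: cvgM;
    [exact: continuous_poisson|exact: continuous_Re_tpoly].
- by apply: continuous_integrable_itv => x; apply: cvgM;
    [exact: continuous_poisson|exact: continuous_Re_expitX].
congr (_ + _).
have -> : a N * (r ^+ N)%:C * expit t ^+ N = (r ^+ N)%:C * (a N * expit t ^+ N) by ring.
rewrite complex_ReZ -poisson_moment; apply: eq_Rintegral => x _; congr (_ * _).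
by rewrite -mulrA -exprMn -expitD addrC subrK.
Qed.

End Moments.
End Poisson.

(** * Integrals over subsets and against bounded kernels *)

Section RintegralSubset.
Context d (T : measurableType d) (R : realType) (mu : {measure set T -> \bar R}).
Implicit Types (f K : T -> R) (A B : set T).

Lemma le_Rintegral_subset A B f : measurable A -> measurable B -> A `<=` B ->
  mu.-integrable B (EFin \o f) -> (forall x, B x -> 0 <= f x) ->
  \int[mu]_(x in A) f x <= \int[mu]_(x in B) f x.
Proof.
move=> mA mB AB iB f0; have iA := integrableS mB mA AB iB.
apply: fine_le; [exact: integrable_fin_num|exact: integrable_fin_num|].
have f0' x : B x -> (0 <= (f x)%:E)%E by move=> Bx; rewrite lee_fin f0.
by apply: ge0_subset_integral => //; exact: (measurable_int mu iB).
Qed.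

Lemma Rintegral_subsetD A B f : measurable A -> measurable B -> A `<=` B ->
  mu.-integrable B (EFin \o f) ->
  \int[mu]_(x in B) f x = \int[mu]_(x in A) f x + \int[mu]_(x in B `\` A) f x.
Proof.
move=> mA mB AB iB; have E : A `|` (B `\` A) = B by exact: setDUK.
rewrite -{1}E Rintegral_setU//; [exact: measurableD|by rewrite E|].
by apply/disj_setPS => x [Ax [_ /(_ Ax)]].
Qed.

Lemma Rintegral_kernel_le A f K M : measurable A ->
  mu.-integrable A (EFin \o f) -> mu.-integrable A (EFin \o (fun x => K x * f x)) ->
  (forall x, A x -> K x <= M) -> (forall x, A x -> 0 <= f x) ->
  \int[mu]_(x in A) (K x * f x) <= M * \int[mu]_(x in A) f x.
Proof.
move=> mA iA iKA KM f0; rewrite -RintegralZl//; apply: le_Rintegral => //.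
  by have := integrableZl mA M iA; apply: eq_integrable.
by move=> x Ax; rewrite ler_wpM2r ?f0 ?KM.
Qed.

End RintegralSubset.

(** * Poisson integrals at a Lebesgue point *)

Section LebesguePoint.
Variable R : realType.
Notation mu := (@lebesgue_measure R).
Implicit Types (u : R -> R) (A : set (measurableTypeR R)).

Section Estimate.
Variables (u : R -> R) (t : R).
Notation W := `[t - pi, t + pi]%classic.
Hypotheses (iu : mu.-integrable W (EFin \o u)) (Lt : lebesgue_pt u t).

Let phi x := `|u x - u t|.

Lemma phi_integrable : mu.-integrable W (EFin \o phi).
Proof.
have ic : mu.-integrable W (EFin \o cst (u t)).
  by apply: continuous_integrable_itv => x; exact: cvg_cst.
have iB : mu.-integrable W (EFin \o (fun x => u x - u t)).
  have : mu.-integrable W ((EFin \o u) \- (EFin \o cst (u t)))%E by exact: integrableB.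
  by apply: eq_integrable.
exact: (integrable_norm iB).
Qed.

Lemma ball_sub_window h : h <= pi -> ball t h `<=` W.
Proof.
move=> hp x; rewrite /= in_itv/= ball_itv/= in_itv/= => /andP[? ?].
by apply/andP; split; lra.
Qed.

(** The ball has measure 2 h, so a mean of at most e / 2 is an integral of at most e h. The bound n
    <= pi keeps the balls inside the window. *)
Lemma lebesgue_pt_small e : 0 < e ->
  exists2 n, 0 < n <= pi & forall h, 0 < h <= n -> \int[mu]_(y in ball t h) phi y <= e * h.
Proof.
move=> e0; have e20 : 0 < e / 2 by rewrite divr_gt0.
have /fine_cvgP[fin /cvgrPdist_le/(_ _ e20)] := Lt.
move=> cv.
have [d /= d0 dP] : \forall h \near 0^'+, davg u t h \is a fin_num /\ `|0 - fine (davg u t h)| <= e / 2.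
  by near=> h; split; near: h.
exists (Num.min (d / 2) pi).
  by rewrite lt_min divr_gt0// pi_gt0/= ge_min lexx orbT.
move=> h /andP[h0]; rewrite le_min => /andP[hd hp].
have [||finh] := dP h; rewrite ?h0//=.
  by rewrite sub0r normrN gtr0_norm//; lra.
rewrite sub0r normrN => hle.
have mb : mu (ball t h) = (h *+ 2)%:E by rewrite lebesgue_measure_ball// ltW.
have iph : mu.-integrable (ball t h) (EFin \o phi).
  apply: (integrableS _ _ _ phi_integrable) => //; first exact: measurable_ball.
  exact: ball_sub_window.
have dE : davg u t h = ((h *+ 2)^-1 * \int[mu]_(y in ball t h) phi y)%:E.
  rewrite /davg /iavg mb inver mulrn_eq0 /= gt_eqF// EFinM; congr (_ * _)%E.
  rewrite /Rintegral fineK//; apply: integrable_fin_num => //; exact: measurable_ball.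
move: hle; rewrite dE /= normrM gtr0_norm ?invr_gt0 ?mulrn_wgt0// => hle.
have := le_trans (ler_wpM2l _ (ler_norm _)) hle.
rewrite mulrC ler_pdivrMr ?mulrn_wgt0// => H; apply: le_trans (H _) _.
  by rewrite invr_ge0 mulrn_wge0// ltW.
by rewrite -mulr_natr; lra.
Unshelve. all: by end_near. Qed.

Lemma poisson_phi_integrable r A : 0 <= r < 1 -> measurable A -> A `<=` W ->
  mu.-integrable A (EFin \o (fun x => poisson r (x - t) * phi x)).
Proof.
move=> r01 mA AW.
suff iW : mu.-integrable W (EFin \o (fun x => poisson r (x - t) * phi x)).
  exact: (integrableS _ _ _ iW).
have mp : measurable_fun W (fun x => poisson r (x - t)).
  by apply: measurable_funTS; apply: continuous_measurable_fun; exact: continuous_poisson.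
have mphi : measurable_fun W phi.
  by have /integrableP[/measurable_EFinP] := phi_integrable.
apply: (le_integrable _ _ _ (integrableZl _ (2 / (1 - r)) phi_integrable)) => //.
- by apply/measurable_EFinP; exact: measurable_funM.
- move=> x _; rewrite /= lee_fin [leLHS]normrM [leRHS]normrM normr_id.
  rewrite ler_wpM2r//.
  rewrite ger0_norm ?poisson_ge0//; exact: (le_trans (poisson_le _ r01) (ler_norm _)).
Qed.

(** With d = 1 - r, the kernel is at most 2 / d on balls of radius up to d, of order d / h^2 on
    dyadic annuli of radius h up to n, and of order d outside the ball of radius n. The Lebesgue
    point bound makes the first two contributions small, and r near 1 the third. *)
Lemma poisson_lebesgue_pt e : 0 < e ->
  \forall r \near 1^'-, \int[mu]_(x in W) (poisson r (x - t) * phi x) <= e.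
Proof.
move=> e0; have [k k0 kP] := @quadratic_le_1Bcos R.
(* 2 bounds the contribution of a ball of radius at most d, in units of [e1]; 32 / k is the
   correction term 16 / k * (d / h) at the smallest radius h = d / 2. *)
pose M := 2 + 32 / k; have M0 : 0 < M by rewrite addr_gt0// divr_gt0.
pose e1 := e / 2 / M; have e10 : 0 < e1 by rewrite !divr_gt0.
have [n /andP[n0 npi] nP] := lebesgue_pt_small e10.
pose Phi := \int[mu]_(x in W) phi x.
have Phi0 : 0 <= Phi by apply: Rintegral_ge0 => x _; exact: normr_ge0.
(* The part of the window outside the ball of radius n contributes at most (1 - r) * c. *)
pose c := 2 / (k * n ^+ 2) * Phi.
have c0 : 0 <= c by rewrite mulr_ge0// divr_ge0// mulr_ge0 ?sqr_ge0// ltW.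
near=> r.
have r1 : r < 1 by near: r; exact: nbhs_left_lt.
have r2 : 2^-1 <= r by near: r; apply: nbhs_left_ge; rewrite invf_lt1// ltr1n.
have rn : 1 - r <= n by rewrite lerBlDr -lerBlDl; near: r; apply: nbhs_left_ge; rewrite ltrBlDr ltrDl.
have rc : (1 - r) * (c + 1) <= e / 2.
  rewrite -ler_pdivlMr ?ltr_wpDl// lerBlDr -lerBlDl.
  by near: r; apply: nbhs_left_ge; rewrite ltrBlDr ltrDl !divr_gt0// ltr_wpDl.
have r0 : 0 <= r by rewrite (le_trans _ r2).
have r01 : 0 <= r < 1 by rewrite r0.
have r21 : 2^-1 <= r < 1 by rewrite r2.
set d := 1 - r in rn rc; have d0 : 0 < d by rewrite subr_gt0.
pose I A := \int[mu]_(x in A) (poisson r (x - t) * phi x).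
have phi0 x : 0 <= phi x by exact: normr_ge0.
have far h A : 0 < h -> measurable A -> A `<=` W -> (forall x, A x -> h <= `|x - t|) ->
    I A <= 2 * d / (k * h ^+ 2) * \int[mu]_(x in A) phi x.
  move=> h0 mA AW Ah; apply: Rintegral_kernel_le => //.
  - exact: (integrableS _ _ AW phi_integrable).
  - exact: poisson_phi_integrable.
  move=> x Ax; have hx := Ah _ Ax.
  have xpi : `|x - t| <= pi.
    by have := AW _ Ax; rewrite /= in_itv/= ler_norml => /andP[? ?]; apply/andP; split; lra.
  have kh : 0 < k * h ^+ 2 by rewrite mulr_gt0// exprn_gt0.
  rewrite ler_pdivlMr//; apply: le_trans (poisson_le_sqr r21 k0 (kP _ xpi)).
  rewrite ler_wpM2l ?poisson_ge0// ler_wpM2l ?(ltW k0)//.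
  by rewrite -[leRHS]real_normK ?num_real// ler_pXn2r// nnegrE ?ltW.
have near_ h : 0 < h -> h <= n -> I (ball t h) <= 2 / d * (e1 * h).
  move=> h0 hn; have bW := ball_sub_window (le_trans hn npi).
  apply: (@le_trans _ _ (2 / d * \int[mu]_(x in ball t h) phi x)).
    apply: Rintegral_kernel_le => //; [exact: measurable_ball|..].
    - by apply: (integrableS _ _ _ phi_integrable) => //; exact: measurable_ball.
    - by apply: poisson_phi_integrable => //; exact: measurable_ball.
    - by move=> x _; exact: poisson_le.
  by apply: ler_wpM2l; [rewrite divr_ge0// ltW|apply: nP; rewrite h0].
(* The annulus between h / 2 and h contributes at most e1 * (8 / k) * (d / h); with the correction
   term 16 / k * (d / h) the bound passes from h / 2 to h. *)
have dyadic m h : d / 2 <= h -> h <= n -> h <= 2 ^+ m * d ->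
    I (ball t h) <= e1 * (M - 16 / k * (d / h)).
  elim: m h => [|m IH] h dh hn hm.
    have h0 : 0 < h by rewrite (lt_le_trans _ dh)// divr_gt0.
    apply: le_trans (near_ h h0 hn) _; rewrite mulrCA ler_pM2l//.
    rewrite expr0 mul1r in hm.
    have h1 : 2 / d * h <= 2 by rewrite mulrAC ler_pdivrMr// ler_pM2l.
    have h2 : d / h <= 2 by rewrite ler_pdivrMr//; lra.
    have : 16 / k * (d / h) <= 16 / k * 2 by rewrite ler_wpM2l// divr_ge0// ltW.
    by rewrite /M; move: (_ / k * (d / h)) (2 / d * h) h1 => ? ? ? ?; lra.
  have h0 : 0 < h by rewrite (lt_le_trans _ dh)// divr_gt0.
  have [hd|hd] := leP h d.
    apply: le_trans (near_ h h0 hn) _; rewrite mulrCA ler_pM2l//.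
    have h1 : 2 / d * h <= 2 by rewrite mulrAC ler_pdivrMr// ler_pM2l.
    have h2 : d / h <= 2 by rewrite ler_pdivrMr//; lra.
    have : 16 / k * (d / h) <= 16 / k * 2 by rewrite ler_wpM2l// divr_ge0// ltW.
    by rewrite /M; move: (_ / k * (d / h)) (2 / d * h) h1 => ? ? ? ?; lra.
  have hh : h / 2 <= h by lra.
  have bb : ball t (h / 2) `<=` ball t h by exact: le_ball.
  have bW := ball_sub_window (le_trans hn npi).
  have mD : measurable (ball t h `\` ball t (h / 2)).
    by apply: measurableD; exact: measurable_ball.
  have DW : ball t h `\` ball t (h / 2) `<=` W by move=> x [/bW].
  have -> : I (ball t h) = I (ball t (h / 2)) + I (ball t h `\` ball t (h / 2)).
    apply: Rintegral_subsetD => //; [exact: measurable_ball..|].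
    by apply: poisson_phi_integrable => //; exact: measurable_ball.
  have S1 : I (ball t (h / 2)) <= e1 * (M - 16 / k * (d / (h / 2))).
    apply: IH; [lra|lra|].
    by move: hm; rewrite exprS => ?; lra.
  have S2 : I (ball t h `\` ball t (h / 2)) <= 2 * d / (k * (h / 2) ^+ 2) * (e1 * h).
    apply: le_trans (far (h / 2) _ _ mD DW _) _; first by rewrite divr_gt0.
      by move=> x [_]; rewrite /ball/= distrC => /negP; rewrite -leNgt.
    rewrite ler_wpM2l//.
      by rewrite divr_ge0 ?mulr_ge0 ?sqr_ge0 1?ltW.
    apply: le_trans (nP h _); last by rewrite h0.
    apply: le_Rintegral_subset => //; first exact: measurable_ball.
    by apply: (integrableS _ _ _ phi_integrable) => //; exact: measurable_ball.
  apply: le_trans (lerD S1 S2) _.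
  have -> : 2 * d / (k * (h / 2) ^+ 2) * (e1 * h) = e1 * (8 / k * (d / h)).
    by field; rewrite !gt_eqF.
  have -> : d / (h / 2) = 2 * (d / h) by field; rewrite gt_eqF.
  rewrite -mulrDr ler_pM2l//.
  have : 0 <= d / h by rewrite divr_ge0// ltW.
  have : 0 <= k^-1 by rewrite invr_ge0 ltW.
  by move: (d / h) (k^-1) => X Y Y0 X0; have := mulr_ge0 Y0 X0 => ?; lra.
have nearI : I (ball t n) <= e1 * M.
  have [m hm] : exists m, n <= 2 ^+ m * d.
    exists (Num.bound (n / d)); rewrite -ler_pdivrMr//.
    have nd : 0 <= n / d by rewrite divr_ge0// ltW.
    by rewrite (le_trans (ltW (archi_boundP nd)))// -natrX ler_nat ltnW// ltn_expl.
  have dn : d / 2 <= n by rewrite (le_trans _ rn)//; lra.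
  apply: le_trans (dyadic m n dn (lexx _) hm) _.
  rewrite ler_pM2l// gerBl mulr_ge0// divr_ge0// ltW//.
have bW := ball_sub_window npi.
have mb := measurable_ball t n.
have -> : \int[mu]_(x in W) (poisson r (x - t) * phi x) = I (ball t n) + I (W `\` ball t n).
  by apply: Rintegral_subsetD => //; exact: poisson_phi_integrable.
have mD : measurable (W `\` ball t n) by exact: measurableD.
have S2 : I (W `\` ball t n) <= d * c.
  apply: le_trans (far n _ n0 mD (@subDsetl _ _ _) _) _.
    by move=> x [_]; rewrite /ball/= distrC => /negP; rewrite -leNgt.
  have -> : d * c = 2 * d / (k * n ^+ 2) * Phi by rewrite /c; ring.
  apply: ler_wpM2l.
    by rewrite divr_ge0// ?mulr_ge0// ?sqr_ge0// ltW.
  apply: le_Rintegral_subset => //; exact: phi_integrable.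
apply: le_trans (lerD nearI S2) _.
have -> : e1 * M = e / 2 by rewrite /e1 mulfVK// gt_eqF.
move: rc; rewrite mulrDr mulr1 => ?; lra.
Unshelve. all: by end_near. Qed.

End Estimate.
End LebesguePoint.

(** * Limits of Cauchy sequences in L^2 *)

Section L2Limit.
Context d (T : measurableType d) (R : realType) (mu : {measure set T -> \bar R}).
Variables (D : set T) (p : nat -> T -> R) (B : nat -> R).
Hypotheses (mD : measurable D) (Dfin : (mu D < +oo)%E)
  (mp : forall n, measurable_fun D (p n)) (B0 : B @ \oo --> (0 : R))
  (pB : forall m n, (n <= m)%N ->
    (\int[mu]_(x in D) ((p m x - p n x) ^+ 2)%:E <= (B n)%:E)%E).

Lemma fast_subsequence : exists2 K : nat -> nat,
  (forall k, (K k <= K k.+1)%N) & forall k, (k <= K k)%N /\ B (K k) <= (4 ^+ k)^-1.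
Proof.
have ex k : exists N, forall n, (N <= n)%N -> B n <= (4 ^+ k)^-1.
  have e0 : 0 < (4 ^+ k)^-1 :> R by rewrite invr_gt0 exprn_gt0.
  have [N _ NP] := proj1 (cvgrPdist_le _ _) B0 _ e0.
  exists N => n Nn; have := NP n Nn; rewrite /= sub0r normrN; exact: le_trans (ler_norm _).
have [N NP] := choice ex.
(* Summing all thresholds makes K monotone and at least N k; the summand k gives K k >= k. *)
exists (fun k => k + \sum_(j < k.+1) N j)%N => k.
  by rewrite [in leqRHS]big_ord_recr /= leq_add// leq_addr.
split; first exact: leq_addr.
by apply: NP; rewrite big_ord_recr /= addnA leq_addl.
Qed.

(** Riesz-Fischer: a fast subsequence converges almost everywhere, and Fatou's lemma transfers the
    bounds [B n] to the limit. *)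
Lemma L2_limit : exists2 u : T -> R, measurable_fun D u &
  forall n, (\int[mu]_(x in D) ((u x - p n x) ^+ 2)%:E <= (B n)%:E)%E.
Proof.
have [K Kmono KP] := fast_subsequence.
(* 2 q <= s q^2 + 1 / s turns the L^2 bounds along a fast subsequence into summable L^1 bounds. *)
pose del k x := `|p (K k.+1) x - p (K k) x|.
have mdel k : measurable_fun D (del k).
  by apply: measurableT_comp => //; exact: measurable_funB.
have del0 k x : (0 <= (del k x)%:E)%E by rewrite lee_fin normr_ge0.
have fD : mu D \is a fin_num by rewrite ge0_fin_numE.
(* For s = 2^k, the L^2 bound s^-2 contributes 1 / (2 s) and the constant 1 / (2 s) contributes its
   product with mu D. *)
pose c := 1 + fine (mu D).
have int_del k : (\int[mu]_(x in D) (del k x)%:E <= (c / (2 ^ (k + 1))%:R)%:E)%E.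
  pose s := (2 : R) ^+ k; have s0 : 0 < s by rewrite exprn_gt0.
  have m2 : measurable_fun D (fun x => ((p (K k.+1) x - p (K k) x) ^+ 2)).
    by apply: measurable_funX; exact: measurable_funB.
  apply: (@le_trans _ _ (\int[mu]_(x in D)
      ((s / 2)%:E * ((p (K k.+1) x - p (K k) x) ^+ 2)%:E + (s^-1 / 2)%:E))%E).
    apply: ge0_le_integral => //.
    - exact/measurable_EFinP.
    - apply: emeasurable_funD => //; apply: measurable_funeM; exact/measurable_EFinP.
    - move=> x _; rewrite -EFinM -EFinD lee_fin /del -[_ ^+ 2]real_normK ?num_real//.
      set q := `|_|; have := sqr_ge0 (s * q - 1); rewrite sqrrB mulr1 expr1n => h.
      have -> : s / 2 * q ^+ 2 + s^-1 / 2 = q + ((s * q) ^+ 2 - s * q *+ 2 + 1) / (2 * s).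
        by field; rewrite gt_eqF.
      by rewrite lerDl divr_ge0// mulr_ge0// ltW.
  rewrite ge0_integralD//; last 3 first.
  - by move=> x _; rewrite -EFinM lee_fin mulr_ge0 ?sqr_ge0// divr_ge0// ltW.
  - by apply: measurable_funeM; exact/measurable_EFinP.
  - by move=> x _; rewrite lee_fin divr_ge0// invr_ge0 ltW.
  rewrite ge0_integralZl//; last 3 first.
  - exact/measurable_EFinP.
  - by move=> x _; rewrite lee_fin sqr_ge0.
  - by rewrite lee_fin divr_ge0// ltW.
  rewrite integral_cst//.
  have h := pB (Kmono k); have [_ hB] := KP k.
  have h4 : (\int[mu]_(x in D) ((p (K k.+1) x - p (K k) x) ^+ 2)%:E <= ((4 ^+ k)^-1)%:E)%E.
    by apply: le_trans h _; rewrite lee_fin.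
  apply: (@le_trans _ _ ((s / 2)%:E * ((4 ^+ k)^-1)%:E + (s^-1 / 2)%:E * mu D)%E).
    by rewrite leeD2r// lee_wpmul2l// lee_fin divr_ge0// ltW.
  rewrite -(fineK fD) -!EFinM -EFinD lee_fin /c.
  have -> : (4 ^+ k)^-1 = s^-1 * s^-1 by rewrite /s -invfM -exprMn -natrM.
  have -> : (2 ^ (k + 1))%:R = s * 2 :> R by rewrite natrX exprD expr1.
  rewrite le_eqVlt; apply/orP; left; apply/eqP; field.
  by rewrite gt_eqF.
pose g x := (\sum_(k <oo) (del k x)%:E)%E.
have g0 x : (0 <= g x)%E by apply: nneseries_ge0 => *; exact: del0.
have gfin : (\int[mu]_(x in D) g x < +oo)%E.
  rewrite integral_nneseries//; last by move=> k; exact/measurable_EFinP.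
  apply: (@le_lt_trans _ _ (\sum_(k <oo) (c / (2 ^ (k + 1))%:R)%:E)%E).
    by apply: lee_nneseries => // k _ _; exact: integral_ge0.
  have h := @cvg_geometric_eseries_half R c 0.
  have -> : (\sum_(k <oo) (c / (2 ^ (k + 1))%:R)%:E)%E = (c / 2 ^+ 0)%:E.
    exact: (cvg_lim (@ereal_hausdorff R) h).
  exact: ltry.
have mg : measurable_fun D g.
  by apply: ge0_emeasurable_sum => // k _; exact/measurable_EFinP.
have ig : mu.-integrable D g.
  apply/integrableP; split => //; apply: le_lt_trans gfin.
  apply: ge0_le_integral => //; first exact: measurableT_comp.
  by move=> x Dx; rewrite gee0_abs.
have cvg_at x : g x \is a fin_num -> cvgn (fun k => p (K k) x).
  move=> gx.
  have cs : cvgn (series (fun k => `|p (K k.+1) x - p (K k) x|)).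
    apply: nondecreasing_is_cvgn.
      apply/nondecreasing_seqP => n; rewrite /series /= big_nat_recr//= lerDl//.
    exists (fine (g x)) => _ [n _ <-]; rewrite -lee_fin fineK// /series /= -sumEFin.
    exact: nneseries_lim_ge.
  have := normed_cvg cs.
  have E : series (fun k => p (K k.+1) x - p (K k) x) = (fun k => p (K k) x - p (K 0%N) x).
    by apply/funext => n; rewrite /series /= telescope_sumr.
  rewrite E => h.
  have -> : (fun k => p (K k) x) = (fun k => (p (K k) x - p (K 0%N) x) + p (K 0%N) x).
    by apply/funext => k; rewrite subrK.
  by apply: is_cvgD => //; exact: is_cvg_cst.
(* The upper limit is measurable on all of D and agrees with the limit wherever the sum [g] is
   finite. *)
pose ue x := limn_esup (fun k => (p (K k) x)%:E).
pose u x := fine (ue x).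
have mu_ : measurable_fun D u.
  apply: measurableT_comp => //; apply: measurable_fun_limn_esup => k; exact/measurable_EFinP.
have u_lim x : g x \is a fin_num -> (fun k => p (K k) x) @ \oo --> u x.
  move=> /cvg_at cx; suff -> : u x = limn (fun k => p (K k) x) by exact: cx.
  have ce : (fun k => (p (K k) x)%:E) @ \oo --> (limn (fun k => p (K k) x))%:E.
    by apply: cvg_EFin => //; near=> k.
  rewrite /u /ue is_cvg_limn_esupE; last by apply/cvg_ex; eexists; exact: ce.
  by rewrite (cvg_lim (@ereal_hausdorff R) ce).
exists u => // n.
(* The shift by n ensures K (k + n) >= n, as [pB] requires. *)
pose f k x := ((p (K (k + n)%N) x - p n x) ^+ 2)%:E.
have mf k : measurable_fun D (f k).
  by apply/measurable_EFinP/measurable_funX; exact: measurable_funB.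
have f0 k x : D x -> (0 <= f k x)%E by move=> _; rewrite lee_fin sqr_ge0.
have fatouf := fatou mu mD mf f0.
apply: (@le_trans _ _ (\int[mu]_(x in D) limn_einf (f^~ x))%E).
  apply: ae_ge0_le_integral => //.
  - by move=> x _; rewrite lee_fin sqr_ge0.
  - by apply/measurable_EFinP/measurable_funX; exact: measurable_funB.
  - move=> x Dx; rewrite limn_einf_lim; apply: lime_ge; first exact: is_cvg_einfs.
    by near=> k; apply: le_ereal_inf_tmp => _ [m _ <-]; exact: f0.
  - have -> : (fun x => limn_einf (f^~ x)) = (fun x => - limn_esup (fun k => - f k x))%E.
      by apply/funext => x; rewrite -[LHS]oppeK -limn_esupN.
    apply: measurableT_comp => //; apply: measurable_fun_limn_esup => k.
    exact: measurableT_comp.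
  - have := integrable_ae mD ig; apply: filterS => x fx Dx.
    have ce : f^~ x @ \oo --> ((u x - p n x) ^+ 2)%:E.
      apply: cvg_EFin; first by near=> k.
      apply: (@continuous_cvg _ _ _ _ _ _ (fun y : R => y ^+ 2)); first exact: exprn_continuous.
      apply: cvgB; last exact: cvg_cst.
      by have := u_lim _ (fx Dx); rewrite -(cvg_shiftn n (fun k => p (K k) x)).
    rewrite is_cvg_limn_einfE; last by apply/cvg_ex; eexists; exact: ce.
    by rewrite (cvg_lim (@ereal_hausdorff R) ce).
apply: le_trans fatouf _; rewrite limn_einf_lim; apply: lime_le; first exact: is_cvg_einfs.
near=> k; apply: (@le_trans _ _ (\int[mu]_(x in D) f k x)%E).
  by apply: ereal_inf_lbound; exists k => //=.
apply: pB; have [h _] := KP (k + n)%N; exact: leq_trans (leq_addl _ _) h.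
Unshelve. all: by end_near. Qed.

End L2Limit.

(** * Radial limits at Lebesgue points *)

Section RadialLimit.
Variable R : realType.
Notation C := R[i].
Notation mu := (@lebesgue_measure R).
Implicit Types (a : nat -> C) (u F : R -> R).

Lemma expit_window (t : R) : expit (t + pi) = expit (t - pi).
Proof. by rewrite -(expit_period (t - pi)); congr expit; ring. Qed.

Lemma window_lt (t : R) : t - pi < t + pi.
Proof. by have := @pi_gt0 R; lra. Qed.

Local Notation window t := (`[t - pi, t + pi]%classic).

(** The damped polynomial at t is the Poisson mean of the polynomial. So 2 pi |F r - u t| is at most
    the mean of |u - u t| plus sup P_r times the L^1 distance of u to the partial sum. For fixed r
    the latter vanishes as N grows; only then does r tend to 1. *)
Lemma radial_cvg u a F t :
  mu.-integrable (window t) (EFin \o u) -> lebesgue_pt u t ->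
  (fun N => \int[mu]_(x in window t) `|u x - complex.Re (tpoly a N x)|) @ \oo --> (0 : R) ->
  (forall r, 0 <= r < 1 ->
    (fun N => complex.Re (tpoly (fun n => a n * (r ^+ n)%:C) N t)) @ \oo --> F r) ->
  F r @[r --> 1^'-] --> u t.
Proof.
move=> iu Lt cu cF; apply/cvgrPdist_le => e e0.
have pi1 : 1 <= 2 * pi :> R by have := @pi_ge2 R; lra.
near=> r.
have r1 : r < 1 by near: r; exact: nbhs_left_lt.
have r0 : 0 <= r by near: r; apply: nbhs_left_ge.
have r01 : 0 <= r < 1 by rewrite r0.
have Pe : \int[mu]_(x in window t) (poisson r (x - t) * `|u x - u t|) <= e.
  by near: r; exact: poisson_lebesgue_pt.
have wl := window_lt t; have ew := expit_window t.
have ip N : mu.-integrable (window t) (EFin \o (fun x => complex.Re (tpoly a N x))).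
  by apply: continuous_integrable_itv; exact: continuous_Re_tpoly.
have cP : continuous (fun x => poisson r (x - t)) by exact: continuous_poisson.
have iphi := phi_integrable iu.
have iPphi : mu.-integrable (window t) (EFin \o (fun x => poisson r (x - t) * `|u x - u t|)).
  by apply: (poisson_phi_integrable iu) => // x.
have iup N : mu.-integrable (window t) (EFin \o (fun x => `|u x - complex.Re (tpoly a N x)|)).
  suff h : mu.-integrable (window t) (EFin \o (fun x => u x - complex.Re (tpoly a N x))).
    exact: (integrable_norm h).
  have : mu.-integrable (window t)
      ((EFin \o u) \- (EFin \o (fun x => complex.Re (tpoly a N x))))%E by exact: integrableB.
  by apply: eq_integrable.
have cpN N : continuous (fun x => complex.Re (tpoly a N x) - u t).
  by move=> x; apply: cvgB; [exact: continuous_Re_tpoly|exact: cvg_cst].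
have key N : 2 * pi * `|complex.Re (tpoly (fun n => a n * (r ^+ n)%:C) N t) - u t| <=
    e + 2 / (1 - r) * \int[mu]_(x in window t) `|u x - complex.Re (tpoly a N x)|.
  have E : 2 * pi * (complex.Re (tpoly (fun n => a n * (r ^+ n)%:C) N t) - u t) =
      \int[mu]_(x in window t) (poisson r (x - t) * (complex.Re (tpoly a N x) - u t)).
    have -> : 2 * pi = (t + pi) - (t - pi) :> R by ring.
    have m0 := poisson_moment t r01 wl ew (u t)%:C 0.
    rewrite mulrBr -(poisson_tpoly t r01 wl ew).
    rewrite -[u t in LHS]mul1r -(expr0 r) -[u t in LHS]/(complex.Re (u t)%:C) -m0.
    rewrite -RintegralB//; last 2 first.
    - apply: continuous_integrable_itv => x; apply: cvgM; first exact: cP.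
      exact: continuous_Re_tpoly.
    - by apply: continuous_integrable_itv; exact: continuous_poisson_moment.
    by apply: eq_Rintegral => x _; rewrite expr0 mulr1 mulrBr.
  have pi0 : 0 <= 2 * pi :> R by rewrite (le_trans _ pi1).
  have cI : continuous (fun x => poisson r (x - t) * (complex.Re (tpoly a N x) - u t)).
    by move=> x; apply: cvgM; [exact: cP|exact: cpN].
  rewrite -{1}(ger0_norm pi0) -normrM E.
  rewrite (le_trans (le_normr_Rintegral _ _))//; first exact: continuous_integrable_itv.
  have iZ : mu.-integrable (window t)
      (EFin \o (fun x => 2 / (1 - r) * `|u x - complex.Re (tpoly a N x)|)).
    have := @integrableZl _ _ _ _ _ _ (2 / (1 - r)) _ (iup N).
    by move=> h; apply: eq_integrable (h _).
  rewrite -RintegralZl// (le_trans _ (lerD Pe (lexx _)))// -RintegralD//.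
  apply: le_Rintegral => //.
  - apply: integrable_norm; exact: continuous_integrable_itv.
  - have : mu.-integrable (window t) ((EFin \o (fun x => poisson r (x - t) * `|u x - u t|)%R) \+
      (EFin \o (fun x => 2 / (1 - r) * `|u x - complex.Re (tpoly a N x)|)%R))%E.
      exact: integrableD.
    by apply: eq_integrable.
  move=> x _; rewrite normrM ger0_norm ?poisson_ge0//.
  have := poisson_le (x - t) r01; have := poisson_ge0 (x - t) r01.
  move: (poisson _ _) (2 / _) => P M P0 PM.
  apply: (@le_trans _ _ (P * (`|u x - u t| + `|u x - complex.Re (tpoly a N x)|))).
    rewrite ler_wpM2l// [leRHS]addrC distrC.
    rewrite (_ : u t - _ = (u x - complex.Re (tpoly a N x)) - (u x - u t)); last by ring.
    exact: ler_normB.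
  by rewrite mulrDr lerD2l ler_wpM2r.
have cl : (fun N => e + 2 / (1 - r) *
    \int[mu]_(x in window t) `|u x - complex.Re (tpoly a N x)|) @ \oo --> e.
  rewrite -[X in _ --> X]addr0 -(mulr0 (2 / (1 - r))).
  by apply: cvgD; [exact: cvg_cst|apply: cvgMl_tmp].
have cr : (fun N => 2 * pi *
    `|complex.Re (tpoly (fun n => a n * (r ^+ n)%:C) N t) - u t|) @ \oo --> 2 * pi * `|F r - u t|.
  by apply: cvgMl_tmp; apply: cvg_norm; apply: cvgB; [exact: cF|exact: cvg_cst].
have : 2 * pi * `|F r - u t| <= e by apply: (ler_cvg_to cr cl); near=> N; exact: key.
by rewrite distrC; apply: le_trans; rewrite ler_peMl.
Unshelve. all: by end_near. Qed.

End RadialLimit.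

(** * Fatou's theorem for H^2 *)

Section L1L2.
Context d (T : measurableType d) (R : realType) (mu : {measure set T -> \bar R}).
Variables (D : set T) (q : T -> R) (b : R).
Hypotheses (mD : measurable D) (Dfin : (mu D < +oo)%E) (mq : measurable_fun D q)
  (qb : (\int[mu]_(x in D) (q x ^+ 2)%:E <= b%:E)%E).

(** From |q| <= e + q^2 / e. The free parameter e is fixed first and b made small afterwards. *)
Lemma integral_norm_le_sqr e : 0 < e ->
  (\int[mu]_(x in D) `|q x|%:E <= (e * fine (mu D) + b / e)%:E)%E.
Proof.
move=> e0; have m2 : measurable_fun D (fun x => q x ^+ 2) by exact: measurable_funX.
have fD : mu D \is a fin_num by rewrite ge0_fin_numE.
apply: (@le_trans _ _ (\int[mu]_(x in D) (e%:E + e^-1%:E * (q x ^+ 2)%:E))%E).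
  apply: ge0_le_integral => //.
  - by apply/measurable_EFinP; exact: measurableT_comp.
  - apply: emeasurable_funD => //; apply: measurable_funeM; exact/measurable_EFinP.
  - move=> x _; rewrite -EFinM -EFinD lee_fin -[_ ^+ 2]real_normK ?num_real//.
    set y := `|_|; have := sqr_ge0 (e - y); rewrite sqrrB => h.
    have -> : e + e^-1 * y ^+ 2 = y + (e ^+ 2 - e * y *+ 2 + y ^+ 2) / e + y.
      by field; rewrite gt_eqF.
    by rewrite -addrA lerDl addr_ge0 ?normr_ge0// divr_ge0// ltW.
rewrite ge0_integralD//; last 3 first.
- by move=> x _; rewrite lee_fin ltW.
- by move=> x _; rewrite -EFinM lee_fin mulr_ge0 ?sqr_ge0// invr_ge0 ltW.
- by apply: measurable_funeM; exact/measurable_EFinP.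
rewrite integral_cst// ge0_integralZl//; last 3 first.
- exact/measurable_EFinP.
- by move=> x _; rewrite lee_fin sqr_ge0.
- by rewrite lee_fin invr_ge0 ltW.
rewrite EFinD EFinM fineK// [b / e]mulrC EFinM leeD2l// lee_wpmul2l// lee_fin invr_ge0 ltW//.
Qed.

Lemma integrable_of_sqr : mu.-integrable D (EFin \o q).
Proof.
apply/integrableP; split; first exact/measurable_EFinP.
by apply: le_lt_trans (integral_norm_le_sqr ltr01) _; exact: ltry.
Qed.

Lemma Rintegral_norm_le_sqr e : 0 < e ->
  \int[mu]_(x in D) `|q x| <= e * fine (mu D) + b / e.
Proof.
move=> e0; rewrite -lee_fin /Rintegral fineK ?integral_norm_le_sqr//.
exact: (integrable_fin_num mD (integrable_norm integrable_of_sqr)).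
Qed.

End L1L2.

Section Boundary.
Variable R : realType.
Notation C := R[i].
Notation mu := (@lebesgue_measure R).
Implicit Types (a : nat -> C) (u : R -> R).

Lemma ae_imply (P Q : R -> Prop) : (forall t, P t -> Q t) ->
  {ae mu, forall t, P t} -> {ae mu, forall t, Q t}.
Proof. by move=> PQ; apply: (@filterS _ _ (ae_filter_ringOfSetsType _)). Qed.

Lemma ae_imply2 (P Q S : R -> Prop) : (forall t, P t -> Q t -> S t) ->
  {ae mu, forall t, P t} -> {ae mu, forall t, Q t} -> {ae mu, forall t, S t}.
Proof. by move=> PQ; apply: (@filterS2 _ _ (ae_filter_ringOfSetsType _)). Qed.

Definition energy a N : R := \sum_(n < N) normc (a n) ^+ 2.
Definition square_summable a := cvgn (energy a).
Definition tail_energy a N := limn (energy a) - energy a N.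

Lemma energyS a N : energy a N.+1 = energy a N + normc (a N) ^+ 2.
Proof. by rewrite /energy big_ord_recr. Qed.

Lemma energy_nd a : nondecreasing_seq (energy a).
Proof. by apply/nondecreasing_seqP => n; rewrite energyS lerDl sqr_ge0. Qed.

Lemma energy_ge0 a N : 0 <= energy a N.
Proof. by apply: sumr_ge0 => n _; exact: sqr_ge0. Qed.

Lemma energy_bounded a M : (forall N, energy a N <= M) -> square_summable a.
Proof.
by move=> h; apply: nondecreasing_is_cvgn; [exact: energy_nd|exists M => _ [n _ <-]].
Qed.

Lemma energy_EFin a N : (\sum_(0 <= n < N) (normc (a n) ^+ 2)%:E)%E = (energy a N)%:E.
Proof. by rewrite sumEFin big_mkord. Qed.

Lemma square_summableP a :
  (\sum_(0 <= n <oo) (normc (a n) ^+ 2)%:E < +oo)%E <-> square_summable a.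
Proof.
have s0 n : (0 <= (normc (a n) ^+ 2)%:E)%E by rewrite lee_fin sqr_ge0.
split=> [h|h].
  apply: (@energy_bounded _ (fine (\sum_(0 <= n <oo) (normc (a n) ^+ 2)%:E)%E)) => N.
  rewrite -lee_fin fineK; last by rewrite ge0_fin_numE// nneseries_ge0.
  by rewrite -energy_EFin; apply: nneseries_lim_ge => *.
have -> : (\sum_(0 <= n <oo) (normc (a n) ^+ 2)%:E)%E = (limn (energy a))%:E.
  apply: (cvg_lim (@ereal_hausdorff R)).
  have -> : (fun N => \sum_(0 <= n < N) (normc (a n) ^+ 2)%:E)%E = EFin \o energy a.
    by apply/funext => N; exact: energy_EFin.
  by apply: cvg_EFin => //; near=> N.
exact: ltry.
Unshelve. all: by end_near. Qed.

Lemma energy_le_lim a N : square_summable a -> energy a N <= limn (energy a).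
Proof. by move=> h; apply: nondecreasing_cvgn_le => //; exact: energy_nd. Qed.

Lemma tail_cvg0 a : square_summable a -> tail_energy a @ \oo --> (0 : R).
Proof.
move=> h; rewrite -(subrr (limn (energy a))).
by apply: cvgB; [exact: cvg_cst|exact: h].
Qed.

(** Zeroing the first N coefficients keeps the difference a [tpoly], so Parseval applies to it. *)
Lemma tpolyB a M N x : (N <= M)%N -> tpoly a M x - tpoly a N x =
  tpoly (fun n => if (n < N)%N then 0 else a n) M x.
Proof.
elim: M => [|M IH]; first by rewrite leqn0 => /eqP ->; rewrite !tpoly0 subr0.
rewrite leq_eqVlt => /predU1P[->|].
  rewrite subrr /tpoly big1// => n _; by rewrite ltn_ord mul0r.
by rewrite ltnS => NM; rewrite !tpolyS addrAC IH// ltnNge NM.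
Qed.

Lemma energy_drop a M N : (N <= M)%N ->
  energy (fun n => if (n < N)%N then 0 else a n) M = energy a M - energy a N.
Proof.
elim: M => [|M IH]; first by rewrite leqn0 => /eqP ->; rewrite /energy !big_ord0 subr0.
rewrite leq_eqVlt => /predU1P[->|].
  by rewrite subrr /energy big1// => n _; rewrite ltn_ord normc0 expr0n.
by rewrite ltnS => NM; rewrite !energyS addrAC IH// ltnNge NM.
Qed.

Lemma Re_tpoly_dist a M N c d : square_summable a ->
  (N <= M)%N -> c < d -> expit d = expit c ->
  (\int[mu]_(x in `[c, d]) ((complex.Re (tpoly a M x) - complex.Re (tpoly a N x)) ^+ 2)%:E <=
   ((d - c) * tail_energy a N)%:E)%E.
Proof.
move=> sa NM cd edc.
pose a' n := if (n < N)%N then 0 else a n.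
have E x : complex.Re (tpoly a M x) - complex.Re (tpoly a N x) = complex.Re (tpoly a' M x).
  by rewrite -complex_ReB tpolyB.
under eq_integral do rewrite E.
have c2 := @continuous_normc2_tpoly R a' M.
have i2 := continuous_integrable_itv c d c2.
have cR : continuous (fun x => complex.Re (tpoly a' M x) ^+ 2).
  under eq_fun do rewrite expr2.
  by move=> x; apply: cvgM; exact: continuous_Re_tpoly.
have i1 := continuous_integrable_itv c d cR.
rewrite -(fineK (integrable_fin_num _ i1))// lee_fin.
apply: (@le_trans _ _ ((d - c) * energy a' M)).
  rewrite -tpoly_parseval//; apply: le_Rintegral => // x _; exact: Re_sqr_le.
apply: ler_wpM2l; first by rewrite subr_ge0 ltW.
by rewrite energy_drop// /tail_energy lerD2r energy_le_lim.
Qed.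

(** Three full periods, containing the window [t - pi, t + pi] of every t in [0, 2 pi]; a single L^2
    limit on [J] thus serves all these t. *)
Local Notation J := (`[- (2 * pi), 4 * pi]%classic : set R).

Lemma J_lt : - (2 * pi) < 4 * pi :> R. Proof. by have := @pi_gt0 R; lra. Qed.

Lemma expit_J : expit (4 * pi) = expit (- (2 * pi)) :> C.
Proof.
by rewrite -[RHS]expit_period -[RHS]expit_period -[RHS]expit_period; congr expit; ring.
Qed.

(** The radial limit is stated for any F that is the limit of the damped real parts, so that it
    applies to the real part of a disk function and, for rotated coefficients, to its imaginary
    part. *)
Lemma boundary_Re a : square_summable a -> exists u,
  [/\ measurable_fun setT u,
      forall N, (\int[mu]_(x in J) ((u x - complex.Re (tpoly a N x)) ^+ 2)%:E <=
         (6 * pi * tail_energy a N)%:E)%E &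
      {ae mu, forall t, t \in angles R -> forall F : R -> R,
        (forall r, 0 <= r < 1 ->
          (fun N => complex.Re (tpoly (fun n => a n * (r ^+ n)%:C) N t)) @ \oo --> F r) ->
        F r @[r --> 1^'-] --> u t}].
Proof.
move=> sa.
have Jlen : 4 * pi - - (2 * pi) = 6 * pi :> R by ring.
have muJ : mu J = (6 * pi)%:E.
  by rewrite lebesgue_measure_itv/= lte_fin J_lt -EFinD Jlen.
have Jfin : (mu J < +oo)%E by rewrite muJ ltry.
have mJ : measurable (J : set (measurableTypeR R)) by exact: measurable_itv.
have mt N : measurable_fun (J : set (measurableTypeR R)) (fun x => complex.Re (tpoly a N x)).
  apply: measurable_funTS; apply: continuous_measurable_fun; exact: continuous_Re_tpoly.
have B0 : (fun N => 6 * pi * tail_energy a N) @ \oo --> (0 : R).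
  by rewrite -(mulr0 (6 * pi)); apply: cvgMl_tmp; exact: tail_cvg0.
have pB m n : (n <= m)%N ->
    (\int[mu]_(x in J) ((complex.Re (tpoly a m x) - complex.Re (tpoly a n x)) ^+ 2)%:E <=
     (6 * pi * tail_energy a n)%:E)%E.
  by move=> nm; rewrite -Jlen; apply: Re_tpoly_dist => //; [exact: J_lt|exact: expit_J].
have [u0 mu0 u0B] := L2_limit mJ Jfin mt B0 pB.
(* The extension by 0 is locally integrable on the line, as Lebesgue differentiation requires. *)
pose u := u0 \_ J.
have uE x : J x -> u x = u0 x by move=> Jx; rewrite /u patchE mem_set.
have mu_ : measurable_fun setT u by exact: (proj1 (measurable_restrictT _ mJ) mu0).
have uB N : (\int[mu]_(x in J) ((u x - complex.Re (tpoly a N x)) ^+ 2)%:E <=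
    (6 * pi * tail_energy a N)%:E)%E.
  apply: le_trans (u0B N); rewrite le_eqVlt; apply/orP; left; apply/eqP.
  by apply: eq_integral => x /set_mem Jx; rewrite uE.
have mq N : measurable_fun J (fun x => u x - complex.Re (tpoly a N x)).
  apply: measurable_funB; first exact: measurable_funTS.
  exact: mt.
have iq N := integrable_of_sqr mJ Jfin (mq N) (uB N).
have iu0 : mu.-integrable J (EFin \o u0).
  apply: eq_integrable (iq 0) => // x /set_mem Jx.
  by rewrite /= tpoly0 subr0 uE.
have lu : locally_integrable setT u by apply: integrable_locally_restrict.
exists u; split => //.
have := lebesgue_differentiation lu; apply: ae_imply => t Lt /set_mem.
rewrite /angles /= in_itv/= => /andP[t0 t2] F cF.
have WJ : `[t - pi, t + pi] `<=` J.
  move=> x; rewrite /= !in_itv/= => /andP[x1 x2]; have := @pi_gt0 R => ?.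
  by apply/andP; split; lra.
have iW f : mu.-integrable J (EFin \o f) -> mu.-integrable `[t - pi, t + pi] (EFin \o f).
  by move=> ifJ; apply: (integrableS _ _ _ ifJ).
apply: (radial_cvg _ Lt _ cF).
  by apply: iW; apply: eq_integrable iu0 => // x /set_mem Jx /=; rewrite uE.
apply/cvgrPdist_le => e e0; have pi0 := @pi_gt0 R.
(* Since [J] has measure 6 pi, s * mu J = e / 2; a tail below s * e / 2 bounds the other term by e /
   2. *)
pose s := e / (12 * pi); have s0 : 0 < s by rewrite divr_gt0// mulr_gt0.
have [N _ NP] := proj1 (cvgrPdist_le _ _) B0 _ (mulr_gt0 s0 (divr_gt0 e0 (ltr0Sn R 1))).
exists N => // n Nn /=; rewrite sub0r normrN ger0_norm; last first.
  by apply: Rintegral_ge0 => x _; exact: normr_ge0.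
have h := NP n Nn; rewrite /= sub0r normrN in h.
apply: (@le_trans _ _ (\int[mu]_(x in J) `|u x - complex.Re (tpoly a n x)|)).
  by apply: le_Rintegral_subset => //; exact: (integrable_norm (iq n)).
have := Rintegral_norm_le_sqr mJ Jfin (mq n) (uB n) s0.
move/le_trans; apply.
have -> : s * fine (mu J) = e / 2.
  transitivity (s * (6 * pi)); first by rewrite -[6 * pi]/(fine (6 * pi)%:E) -muJ.
  by rewrite /s; move: (pi : R) pi0 => y y0; field; rewrite gt_eqF.
have : 6 * pi * tail_energy a n / s <= e / 2.
  rewrite ler_pdivrMr// [e / 2 * s]mulrC; apply: le_trans h; exact: ler_norm.
by move=> ?; lra.
Qed.

End Boundary.

(** * Convergence in the complex plane through real and imaginary parts *)

Section ComplexLimits.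
Variable R : realType.
Notation C := R[i].
Implicit Types z : C.

Lemma abs_Re_le z : `|complex.Re z| <= normc z.
Proof. by rewrite -(@ler_pXn2r _ 2)// ?nnegrE ?normc_ge0// real_normK ?num_real// Re_sqr_le. Qed.

Lemma abs_Im_le z : `|complex.Im z| <= normc z.
Proof.
rewrite -(@ler_pXn2r _ 2)// ?nnegrE ?normc_ge0// real_normK ?num_real//.
by rewrite normc_sqr lerDr sqr_ge0.
Qed.

Lemma normc_le_ReIm z : normc z <= `|complex.Re z| + `|complex.Im z|.
Proof.
rewrite -(@ler_pXn2r _ 2)// ?nnegrE ?normc_ge0 ?addr_ge0// normc_sqr sqrrD !real_normK ?num_real//.
by rewrite addrAC lerDl mulrn_wge0// mulr_ge0.
Qed.

Lemma normC_E z : `|z| = (normc z)%:C. Proof. by case: z. Qed.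

Lemma normcN z : normc (- z) = normc z.
Proof. by case: z => x y; rewrite /= !sqrrN. Qed.

Lemma normc_eq0 z : (normc z == 0) = (z == 0).
Proof. by apply/eqP/eqP => [/eq0_normc|->]//; rewrite normc0. Qed.

Section Filter.
Context {T : Type} {F : set_system T} {FF : Filter F}.
Implicit Types (f : T -> C) (l : C).

Lemma cvg_normcP f l : ((f x : C^o) @[x --> F] --> (l : C^o)) <->
  (forall e : R, 0 < e -> \forall x \near F, normc (l - f x) < e).
Proof.
split=> [/cvgrPdist_lt h e e0|h].
  have := h e%:C; rewrite ltcR => /(_ e0); apply: filterS => x.
  by rewrite normC_E ltcR.
(* In the order of R[i], a positive e has imaginary part 0. *)
apply/cvgrPdist_lt => -[e e'] /=; rewrite ltcE /= => /andP[/eqP -> e0].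
by have := h e e0; apply: filterS => x; rewrite normC_E ltcE /= eqxx.
Qed.

Lemma cvg_ReIm f l : complex.Re (f x) @[x --> F] --> complex.Re l ->
  complex.Im (f x) @[x --> F] --> complex.Im l -> (f x : C^o) @[x --> F] --> (l : C^o).
Proof.
move=> /cvgrPdist_lt hr /cvgrPdist_lt hi; apply/cvg_normcP => e e0.
have e2 : 0 < e / 2 by rewrite divr_gt0.
have := hr _ e2; have := hi _ e2; apply: filterS2 => x hi' hr'.
rewrite (le_lt_trans (normc_le_ReIm _))//.
case: l {hr hi} hr' hi' => l1 l2; case: (f x) => x1 x2 /=.
by move: `|_| `|_| => ? ? ? ?; lra.
Qed.

Lemma cvg_Re f l : (f x : C^o) @[x --> F] --> (l : C^o) ->
  complex.Re (f x) @[x --> F] --> complex.Re l.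
Proof.
move=> /cvg_normcP h; apply/cvgrPdist_lt => e e0; have := h e e0; apply: filterS => x.
by apply: le_lt_trans; rewrite -complex_ReB abs_Re_le.
Qed.

Lemma cvg_Im f l : (f x : C^o) @[x --> F] --> (l : C^o) ->
  complex.Im (f x) @[x --> F] --> complex.Im l.
Proof.
move=> /cvg_normcP h; apply/cvgrPdist_lt => e e0; have := h e e0; apply: filterS => x.
apply: le_lt_trans; rewrite (_ : _ - _ = complex.Im (l - f x)) ?abs_Im_le//.
by case: l {h} => ? ?; case: (f x).
Qed.

End Filter.
End ComplexLimits.

(** * Existence of boundary functions *)

Section BoundaryFunction.
Variable R : realType.
Notation C := R[i].
Notation mu := (@lebesgue_measure R).
Implicit Types (a : nat -> C) (f : disk R -> C) (g : R -> C).

Lemma measurable_angles : measurable (angles R : set (measurableTypeR R)).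
Proof. exact: measurable_itv. Qed.

Lemma angles_lt : 0 < 2 * pi :> R. Proof. by have := @pi_gt0 R; lra. Qed.

Lemma expit_angles : expit (2 * pi) = expit 0 :> C.
Proof. by rewrite -[RHS]expit_period add0r. Qed.

Lemma normc_polar r (t : R) : 0 <= r -> normc (r%:C * expit t) = r.
Proof. by move=> r0; rewrite normcM normc_expit mulr1 /= expr0n addr0 sqrtr_sqr ger0_norm. Qed.

Lemma disk_extE f (z : disk R) : disk_ext f (val z) = f z.
Proof. by rewrite /disk_ext valK. Qed.

Lemma tpoly_series a r t N :
  tpoly (fun n => a n * (r ^+ n)%:C) N t = series (fun n => a n * (r%:C * expit t) ^+ n) N.
Proof.
rewrite /tpoly /series /= big_mkord; apply: eq_bigr => n _.
by rewrite exprMn mulrA rmorphXn.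
Qed.

Lemma power_series_polar a f r t : power_series_of a f -> 0 <= r < 1 ->
  ((tpoly (fun n => a n * (r ^+ n)%:C) N t : C^o) @[N --> \oo] -->
   (disk_ext f (r%:C * expit t) : C^o)).
Proof.
move=> af /andP[r0 r1].
have zd : normc (r%:C * expit t) < 1 by rewrite normc_polar.
pose z : disk R := exist _ (r%:C * expit t) zd.
rewrite -[r%:C * expit t]/(val z) disk_extE.
under eq_fun do rewrite tpoly_series.
exact: af.
Qed.

Lemma energy_rot a : energy (fun n => - 'i * a n) = energy a.
Proof.
apply/funext => N; apply: eq_bigr => n _; rewrite normcM normcN.
by rewrite /normc /= expr0n add0r expr1n sqrtr1 mul1r.
Qed.

(** [boundary_Re] is applied to a and to -i a; each contributes 6 pi times the same tail energy. *)
Lemma boundary_exists a f : square_summable a -> power_series_of a f -> exists g,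
  [/\ circle_L2 g, has_radial_limits f g &
    forall N, (\int[mu]_(t in angles R) (normc (g t - tpoly a N t) ^+ 2)%:E <=
      (12 * pi * tail_energy a N)%:E)%E].
Proof.
move=> sa af; have pi0 := @pi_gt0 R.
have sa' : square_summable (fun n => - 'i * a n) by rewrite /square_summable energy_rot.
have [u [mu_ uB uL]] := boundary_Re sa; have [v [mv vB vL]] := boundary_Re sa'.
have AJ : angles R `<=` `[- (2 * pi), 4 * pi].
  by move=> x; rewrite /angles /= !in_itv/= => /andP[? ?]; apply/andP; split; lra.
pose g t := u t +i* v t.
have mA := measurable_angles.
have mp N : measurable_fun [set: measurableTypeR R] (fun x => complex.Re (tpoly a N x)).
  by apply: continuous_measurable_fun; exact: continuous_Re_tpoly.
have mq N : measurable_fun [set: measurableTypeR R] (fun x => complex.Im (tpoly a N x)).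
  by apply: continuous_measurable_fun; exact: continuous_Im_tpoly.
have gB N : (\int[mu]_(t in angles R) (normc (g t - tpoly a N t) ^+ 2)%:E <=
      (12 * pi * tail_energy a N)%:E)%E.
  have E t : normc (g t - tpoly a N t) ^+ 2 = (u t - complex.Re (tpoly a N t)) ^+ 2 +
      (v t - complex.Re (tpoly (fun n => - 'i * a n) N t)) ^+ 2.
    by rewrite -Im_tpoly /g; case: (tpoly a N t) => x y; rewrite normc_sqr.
  have mu2 : measurable_fun [set: measurableTypeR R]
      (fun t => ((u t - complex.Re (tpoly a N t)) ^+ 2)%:E).
    by apply/measurable_EFinP/measurable_funX; exact: measurable_funB.
  have mv2 : measurable_fun [set: measurableTypeR R]
      (fun t => ((v t - complex.Re (tpoly (fun n => - 'i * a n) N t)) ^+ 2)%:E).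
    apply/measurable_EFinP/measurable_funX; apply: measurable_funB => //.
    by apply: continuous_measurable_fun; exact: continuous_Re_tpoly.
  under eq_integral do rewrite E EFinD.
  rewrite ge0_integralD//; last 4 first.
  - by move=> x _; rewrite lee_fin sqr_ge0.
  - exact: measurable_funTS.
  - by move=> x _; rewrite lee_fin sqr_ge0.
  - exact: measurable_funTS.
  rewrite (_ : 12 * pi * tail_energy a N = 6 * pi * tail_energy a N + 6 * pi *
     tail_energy (fun n => - 'i * a n) N); last by rewrite /tail_energy !energy_rot; ring.
  rewrite EFinD; apply: leeD.
    apply: le_trans (uB N); apply: ge0_subset_integral => //; first exact: measurable_funTS.
    by move=> x _; rewrite lee_fin sqr_ge0.
  apply: le_trans (vB N); apply: ge0_subset_integral => //; first exact: measurable_funTS.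
  by move=> x _; rewrite lee_fin sqr_ge0.
exists g; split => //.
  split; [exact: measurable_funTS|exact: measurable_funTS|].
  apply: le_lt_trans (ltry (12 * pi * tail_energy a 0)); rewrite (le_trans _ (gB 0%N))//.
  rewrite le_eqVlt; apply/orP; left; apply/eqP.
  by apply: eq_integral => t _; rewrite tpoly0 subr0.
apply: ae_imply2 uL vL => t ut vt tA.
apply: cvg_ReIm.
  apply: ut => // r r01; apply: cvg_Re; exact: power_series_polar.
apply: vt => // r r01.
have -> : (fun N => complex.Re (tpoly (fun n => - 'i * a n * (r ^+ n)%:C) N t)) =
    (fun N => complex.Im (tpoly (fun n => a n * (r ^+ n)%:C) N t)).
  apply/funext => N; rewrite Im_tpoly; congr (complex.Re (tpoly _ _ _)).
  by apply/funext => n; rewrite mulrA.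
apply: cvg_Im; exact: power_series_polar.
Qed.

End BoundaryFunction.

(** * The Hilbert space L^2(T) *)

Section SquareIntegrable.
Context d (T : measurableType d) (R : realType) (mu : {measure set T -> \bar R}).
Variables (D : set T).
Hypotheses (mD : measurable D).
Implicit Types (x y : T -> R).

Definition sq_integrable x := measurable_fun D x /\ mu.-integrable D (EFin \o (fun t => x t ^+ 2)).

Lemma sq_integrableM x y : sq_integrable x -> sq_integrable y ->
  mu.-integrable D (EFin \o (fun t => x t * y t)).
Proof.
move=> [mx ix] [my iy].
have := integrableD mD ix iy; apply: le_integrable => //.
  by apply/measurable_EFinP; exact: measurable_funM.
move=> t _; rewrite /= lee_fin [leRHS]ger0_norm ?addr_ge0 ?sqr_ge0//.
rewrite normrM -[x t ^+ 2]real_normK ?num_real// -[y t ^+ 2]real_normK ?num_real//.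
move: (`|x t|) (`|y t|) (normr_ge0 (x t)) (normr_ge0 (y t)) => p q p0 q0.
have := sqr_ge0 (p - q); have := mulr_ge0 p0 q0; rewrite sqrrB => ? ?; lra.
Qed.

Lemma integrableD_EFin x y : mu.-integrable D (EFin \o x) -> mu.-integrable D (EFin \o y) ->
  mu.-integrable D (EFin \o (fun t => x t + y t)).
Proof. by move=> ix iy; have := integrableD mD ix iy; apply: eq_integrable. Qed.

Lemma integrableZ_EFin c x : mu.-integrable D (EFin \o x) ->
  mu.-integrable D (EFin \o (fun t => c * x t)).
Proof. by move=> ix; have := integrableZl mD c ix; apply: eq_integrable. Qed.

Lemma sq_integrable_lin c x y : sq_integrable x -> sq_integrable y ->
  sq_integrable (fun t => c * x t + y t).
Proof.
move=> sx sy; have [mx ix] := sx; have [my iy] := sy; split.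
  by apply: measurable_funD => //; apply: measurable_funM.
have h := integrableD_EFin (integrableD_EFin (integrableZ_EFin (c ^+ 2) ix)
  (integrableZ_EFin (2 * c) (sq_integrableM sx sy))) iy.
by apply: eq_integrable h => // t _ /=; congr EFin; ring.
Qed.

End SquareIntegrable.

Section CircleInner.
Variable R : realType.
Notation C := R[i].
Notation mu := (@lebesgue_measure R).
Notation D := (angles R).
Implicit Types (u v w phi : R -> C).

Lemma circle_L2P u : circle_L2 u <->
  sq_integrable mu D (fun t => complex.Re (u t)) /\ sq_integrable mu D (fun t => complex.Im (u t)).
Proof.
have mA := @measurable_angles R.
split=> [[mr mi iu]|[[mr ir] [mi ii]]].
  have ni : mu.-integrable D (EFin \o (fun t => normc (u t) ^+ 2)).
    apply/integrableP; split.
      apply/measurable_EFinP.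
      under eq_fun do rewrite normc_sqr.
      by apply: measurable_funD; exact: measurable_funX.
    apply: le_lt_trans iu; rewrite le_eqVlt; apply/orP; left; apply/eqP.
    by apply: eq_integral => t _ /=; rewrite ger0_norm// sqr_ge0.
  split; split => //; apply: le_integrable ni => //.
  - by apply/measurable_EFinP; exact: measurable_funX.
  - by move=> t _ /=; rewrite lee_fin !ger0_norm ?sqr_ge0// normc_sqr lerDl sqr_ge0.
  - by apply/measurable_EFinP; exact: measurable_funX.
  - by move=> t _ /=; rewrite lee_fin !ger0_norm ?sqr_ge0// normc_sqr lerDr sqr_ge0.
split => //; have := integrableD_EFin mA ir ii => /integrableP[_].
apply: le_lt_trans; rewrite le_eqVlt; apply/orP; left; apply/eqP.
by apply: eq_integral => t _ /=; rewrite -normc_sqr ger0_norm// sqr_ge0.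
Qed.

Lemma circle_L2_sq_integral u : circle_L2 u ->
  mu.-integrable D (EFin \o (fun t => normc (u t) ^+ 2)).
Proof.
move=> /circle_L2P[[_ ir] [_ ii]]; have := integrableD_EFin (@measurable_angles R) ir ii.
by apply: (eq_integrable (@measurable_angles R)) => t _ /=; rewrite normc_sqr.
Qed.

(** [Rcomplex R] is the complex plane as a real vector space, which makes functions into it an
    [lmodType R]. *)
Definition cip (u v : R -> Rcomplex R) : R := complex.Re (circle_inner u v).

Lemma cipE u v : cip u v = (2 * pi)^-1 *
  \int[mu]_(t in D) (complex.Re (u t) * complex.Re (v t) + complex.Im (u t) * complex.Im (v t)).
Proof.
rewrite /cip /circle_inner /circle_mean /=; congr (_ * _); apply: eq_Rintegral => t _.
by case: (u t) (v t) => [? ?] [? ?] /=; ring.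
Qed.

(** Conjugating i v brings out -i, and Re (-i z) = Im z. Complex orthogonality to a space stable
    under i thus reduces to real orthogonality. *)
Lemma circle_innerE u v : circle_inner u v = cip u v +i* cip u (fun t => 'i * v t).
Proof.
rewrite /cip /circle_inner /circle_mean /=; congr (_ +i* (_ * _)); apply: eq_Rintegral => t _.
by case: (u t) (v t) => [? ?] [? ?] /=; ring.
Qed.

Lemma cip_integrable u v : circle_L2 u -> circle_L2 v -> mu.-integrable D
  (EFin \o (fun t => complex.Re (u t) * complex.Re (v t) + complex.Im (u t) * complex.Im (v t))).
Proof.
move=> /circle_L2P[ur ui] /circle_L2P[vr vi]; have mA := @measurable_angles R.
by apply: integrableD_EFin => //; exact: sq_integrableM.
Qed.

Lemma circle_inner_on : inner_on (@circle_L2 R : set (R -> Rcomplex R)) cip.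
Proof.
have mA := @measurable_angles R.
have ReL c (z w : Rcomplex R) : complex.Re (c *: z + w) = c * complex.Re z + complex.Re w.
  by case: z w => [? ?] [? ?].
have ImL c (z w : Rcomplex R) : complex.Im (c *: z + w) = c * complex.Im z + complex.Im w.
  by case: z w => [? ?] [? ?].
split.
- apply/circle_L2P; split; split => //=;
    by under [X in EFin \o X]eq_fun do rewrite expr0n/=; exact: integrable0.
- move=> c u v /circle_L2P[ur ui] /circle_L2P[vr vi]; apply/circle_L2P; split.
    by have := sq_integrable_lin mA c ur vr; under [X in sq_integrable _ _ X]eq_fun do rewrite -ReL.
  by have := sq_integrable_lin mA c ui vi; under [X in sq_integrable _ _ X]eq_fun do rewrite -ImL.
- move=> c u v w uL vL wL; rewrite !cipE mulrCA -mulrDr; congr (_ * _).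
  rewrite -RintegralZl//; last exact: cip_integrable.
  rewrite -RintegralD//; [|exact/integrableZ_EFin/cip_integrable|exact: cip_integrable].
  by apply: eq_Rintegral => t _; rewrite ReL ImL; ring.
- by move=> u v _ _; rewrite !cipE; congr (_ * _); apply: eq_Rintegral => t _; ring.
- move=> u _; rewrite cipE mulr_ge0//; first by rewrite invr_ge0 ltW// angles_lt.
  by apply: Rintegral_ge0 => t _; rewrite -!expr2 addr_ge0 ?sqr_ge0.
Qed.

Lemma sqn_cipE u : sqn cip u = (2 * pi)^-1 * \int[mu]_(t in D) (normc (u t) ^+ 2).
Proof. by rewrite /sqn cipE; congr (_ * _); apply: eq_Rintegral => t _; rewrite normc_sqr. Qed.

Lemma sqn_cip_le u b : circle_L2 u ->
  (\int[mu]_(t in D) (normc (u t) ^+ 2)%:E <= (2 * pi * b)%:E)%E -> sqn cip u <= b.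
Proof.
move=> uL h; rewrite sqn_cipE mulrC ler_pdivrMr ?angles_lt// mulrC -lee_fin /Rintegral fineK//.
by apply: (integrable_fin_num _ (circle_L2_sq_integral uL)); exact: measurable_angles.
Qed.

Lemma circle_ae_eq u v : circle_L2 u -> circle_L2 v ->
  {ae mu, forall t, t \in D -> u t = v t} <-> sqn cip ((u : R -> Rcomplex R) - v) = 0.
Proof.
move=> uL vL; have mA := @measurable_angles R.
have wL : circle_L2 ((u : R -> Rcomplex R) - v) := innerB circle_inner_on uL vL.
have iw := circle_L2_sq_integral wL.
rewrite sqn_cipE; split=> [uv|].
  rewrite /Rintegral (_ : \int[mu]_(t in D) _ = 0)%E ?mulr0//.
  rewrite (ae_eq_integral (cst 0%E))//; first by rewrite integral0.
    exact: (measurable_int mu iw).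
  apply: ae_imply uv => t uvt tD; rewrite /= -[(_ - _) t]/(u t - v t) uvt ?inE//.
  by rewrite subrr normc0 expr0n.
move/eqP; rewrite mulf_eq0 invr_eq0 gt_eqF ?angles_lt//= => /eqP h.
have h0 : (\int[mu]_(t in D) `|(normc (((u : R -> Rcomplex R) - v) t) ^+ 2)%:E| = 0)%E.
  rewrite -[LHS]fineK; last first.
    apply: (integrable_fin_num mA); exact: integrable_abse.
  congr EFin; rewrite -[RHS]h; congr fine; apply: eq_integral => t _ /=.
  by rewrite ger0_norm// sqr_ge0.
have := (ae_eq_integral_abs _ mA (measurable_int mu iw)).1 h0.
apply: ae_imply => t h1 /set_mem tD; have := h1 tD => -[] /eqP.
by rewrite sqrf_eq0 normc_eq0 subr_eq0 => /eqP.
Qed.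

Lemma circle_L2_mul phi u K : measurable_fun D (fun t => complex.Re (phi t)) ->
  measurable_fun D (fun t => complex.Im (phi t)) ->
  {ae mu, forall t, t \in D -> normc (phi t) <= K} ->
  circle_L2 u -> circle_L2 (fun t => phi t * u t).
Proof.
move=> mr mi bd uL; have mA := @measurable_angles R; have [ur ui _] := uL.
have m1 : measurable_fun D (fun t => complex.Re (phi t * u t)).
  under eq_fun do rewrite complex_ReM.
  by apply: measurable_funB; exact: measurable_funM.
have m2 : measurable_fun D (fun t => complex.Im (phi t * u t)).
  under eq_fun do rewrite complex_ImM.
  by apply: measurable_funD; exact: measurable_funM.
split => //; have iu := integrableZ_EFin mA (K ^+ 2) (circle_L2_sq_integral uL).
have [mm iu'] := integrableP _ _ _ iu.
apply: le_lt_trans iu'; apply: ae_ge0_le_integral => //.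
- by move=> t _; rewrite lee_fin sqr_ge0.
- apply/measurable_EFinP; under eq_fun do rewrite normc_sqr.
  by apply: measurable_funD; exact: measurable_funX.
- by apply: measurableT_comp.
- apply: ae_imply bd => t h tD; rewrite /= lee_fin ger0_norm; last by apply: mulr_ge0; exact: sqr_ge0.
  have hK : normc (phi t) <= K by apply: h; rewrite inE.
  have K0 : 0 <= K by rewrite (le_trans (normc_ge0 (phi t))).
  by rewrite normcM exprMn ler_wpM2r ?sqr_ge0// ler_pXn2r// nnegrE normc_ge0.
Qed.

Lemma circle_L2_scale (c : C) u : circle_L2 u -> circle_L2 (fun t => c * u t).
Proof.
apply: (@circle_L2_mul (cst c) u (normc c)) => //=.
by apply: aeW => t _.
Qed.

Lemma sqn_cip_unimodular phi u : {ae mu, forall t, t \in D -> normc (phi t) = 1} ->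
  circle_L2 u -> circle_L2 (fun t => phi t * u t) -> sqn cip (fun t => phi t * u t) = sqn cip u.
Proof.
move=> h uL pL; have mA := @measurable_angles R.
rewrite !sqn_cipE; congr (_ * fine _); apply: ae_eq_integral => //.
- exact: (measurable_int mu (circle_L2_sq_integral pL)).
- exact: (measurable_int mu (circle_L2_sq_integral uL)).
- by apply: ae_imply h => t h tD; rewrite normcM h ?inE// mul1r.
Qed.

End CircleInner.

(** * Radial limits and boundary functions *)

Section ComplexLimitAlgebra.
Context {R : realType} {T : Type} {F : set_system T} {FF : Filter F}.
Implicit Types (f g : T -> R[i]) (c k l : R[i]).

Lemma cvgC_cst c : ((fun=> c) x : R[i]^o) @[x --> F] --> (c : R[i]^o).
Proof. exact: cvg_cst. Qed.

Lemma cvgC_mul f g k l : (f x : R[i]^o) @[x --> F] --> (k : R[i]^o) ->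
  (g x : R[i]^o) @[x --> F] --> (l : R[i]^o) ->
  (f x * g x : R[i]^o) @[x --> F] --> (k * l : R[i]^o).
Proof. exact: cvgM. Qed.

Lemma cvgC_lin c f g k l : (f x : R[i]^o) @[x --> F] --> (k : R[i]^o) ->
  (g x : R[i]^o) @[x --> F] --> (l : R[i]^o) ->
  (c * f x + g x : R[i]^o) @[x --> F] --> (c * k + l : R[i]^o).
Proof.
move=> fk gl; have h := cvgC_mul (@cvgC_cst c) fk.
exact: (cvgD h gl).
Qed.

End ComplexLimitAlgebra.

Section RadialLimits.
Variable R : realType.
Notation C := R[i].
Notation mu := (@lebesgue_measure R).
Notation D := (angles R).
Implicit Types (f h : disk R -> C) (u v : R -> C).

Lemma has_radial_limits_unique f u v : has_radial_limits f u -> has_radial_limits f v ->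
  {ae mu, forall t, t \in D -> u t = v t}.
Proof.
apply: ae_imply2 => t fu fv tD.
exact: (cvg_unique (@norm_hausdorff _ C^o) (fu tD) (fv tD)).
Qed.

Lemma bdryP f u : circle_L2 u -> has_radial_limits f u ->
  [/\ circle_L2 (bdry f), has_radial_limits f (bdry f) &
      {ae mu, forall t, t \in D -> bdry f t = u t}].
Proof.
move=> uL fu.
have [bL fb] : circle_L2 (bdry f) /\ has_radial_limits f (bdry f).
  exact: (@xgetPex _ (fun=> 0) [set g | circle_L2 g /\ has_radial_limits f g]
    (ex_intro _ u (conj uL fu))).
by split => //; exact: has_radial_limits_unique fb fu.
Qed.

Lemma disk_ext_lin (c : C) f h (w : C) :
  disk_ext (fun z => c * f z + h z) w = c * disk_ext f w + disk_ext h w.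
Proof. by rewrite /disk_ext; case: insubP => [//|_]; rewrite mulr0 addr0. Qed.

Lemma disk_ext_mul f h (w : C) :
  disk_ext (fun z => f z * h z) w = disk_ext f w * disk_ext h w.
Proof. by rewrite /disk_ext; case: insubP => [//|_]; rewrite mulr0. Qed.

Lemma has_radial_limits_lin c f h u v : has_radial_limits f u -> has_radial_limits h v ->
  has_radial_limits (fun z => c * f z + h z) (fun t => c * u t + v t).
Proof.
apply: ae_imply2 => t fu hv tD; under eq_fun do rewrite disk_ext_lin.
apply: cvgD; last exact: hv.
by apply: cvgMl_tmp; exact: fu.
Qed.

Lemma has_radial_limits_mul f h u v : has_radial_limits f u -> has_radial_limits h v ->
  has_radial_limits (fun z => f z * h z) (fun t => u t * v t).
Proof.
apply: ae_imply2 => t fu hv tD; under eq_fun do rewrite disk_ext_mul.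
by apply: cvgM; [exact: fu|exact: hv].
Qed.

Lemma has_radial_limits_cst (c : C) : has_radial_limits (fun=> c) (fun=> c).
Proof.
apply: aeW => t _; apply/cvg_normcP => e e0; near=> r.
have r1 : r < 1 by near: r; exact: nbhs_left_lt.
have r0 : 0 <= r by near: r; apply: nbhs_left_ge.
have zd : normc (r%:C * expit t) < 1 by rewrite normc_polar.
rewrite -[r%:C * expit t]/(val (exist _ (r%:C * expit t) zd : disk R)) disk_extE.
by rewrite subrr normc0.
Unshelve. all: by end_near. Qed.

Lemma has_radial_limits_id : has_radial_limits (fun z : disk R => val z) (@expit R).
Proof.
apply: aeW => t _; apply/cvg_normcP => e e0; near=> r.
have r1 : r < 1 by near: r; exact: nbhs_left_lt.
have r0 : 0 <= r by near: r; apply: nbhs_left_ge.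
have re : 1 - r < e.
  by rewrite ltrBlDr -ltrBlDl; near: r; apply: nbhs_left_gt; rewrite ltrBlDr ltrDl.
have zd : normc (r%:C * expit t) < 1 by rewrite normc_polar.
rewrite -[X in disk_ext _ X]/(val (exist _ (r%:C * expit t) zd : disk R)) disk_extE /=.
suff E : normc (expit t - r%:C * expit t) = 1 - r by rewrite -E in re; exact: re.
have -> : expit t - r%:C * expit t = (1 - r)%:C * expit t by rewrite rmorphB mulrBl mul1r.
by rewrite normc_polar// subr_ge0 ltW.
Unshelve. all: by end_near. Qed.

End RadialLimits.

(** * Power series with square-summable coefficients *)

Section PowerSeries.
Variable R : realType.
Notation C := R[i].
Implicit Types (a b : nat -> C) (f h : disk R -> C).

Definition psum a (z : C) N : C := \sum_(n < N) a n * z ^+ n.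

Lemma power_seriesP a f : power_series_of a f <->
  forall z, (psum a (val z) N : C^o) @[N --> \oo] --> (f z : C^o).
Proof.
have E z : psum a z = series (fun n => a n * z ^+ n).
  by apply/funext => N; rewrite /series /= big_mkord.
by split=> h z; have := h z; rewrite E.
Qed.

Lemma power_series_lin (c : C) a b f h : power_series_of a f -> power_series_of b h ->
  power_series_of (fun n => c * a n + b n) (fun z => c * f z + h z).
Proof.
move=> /power_seriesP af /power_seriesP bh; apply/power_seriesP => z.
have E N : psum (fun n => c * a n + b n) (val z) N = c * psum a (val z) N + psum b (val z) N.
  rewrite /psum mulr_sumr -big_split /=; apply: eq_bigr => n _.
  by rewrite mulrDl mulrA.
under eq_fun do rewrite E.
exact: (cvgC_lin (c:=c) (af z) (bh z)).
Qed.

Definition shift_coef a n : C := if n is m.+1 then a m else 0.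

Lemma power_series_shift a f : power_series_of a f ->
  power_series_of (shift_coef a) (fun z => val z * f z).
Proof.
move=> /power_seriesP af; apply/power_seriesP => z.
have S := @cvg_shiftS C^o (psum (shift_coef a) (val z)) (nbhs (val z * f z : C^o)).
have E N : psum (shift_coef a) (val z) N.+1 = val z * psum a (val z) N.
  rewrite /psum big_ord_recl mul0r add0r mulr_sumr; apply: eq_bigr => n _.
  by rewrite /= exprS mulrCA.
have h : (psum (shift_coef a) (val z) N.+1 : C^o) @[N --> \oo] --> (val z * f z : C^o).
  under eq_fun do rewrite E.
  exact: (cvgC_mul (@cvgC_cst _ _ _ _ (val z)) (af z)).
exact: (eq_ind _ (fun X : Prop => X) h _ S).
Qed.

Lemma energy_shift a N : energy (shift_coef a) N.+1 = energy a N.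
Proof. by rewrite /energy big_ord_recl (_ : shift_coef a _ = 0)// normc0 expr0n add0r. Qed.

Lemma normc2_lin_le (c z w : C) :
  normc (c * z + w) ^+ 2 <= 2 * normc c ^+ 2 * normc z ^+ 2 + 2 * normc w ^+ 2.
Proof.
have -> : 2 * normc c ^+ 2 * normc z ^+ 2 = 2 * normc (c * z) ^+ 2.
  by rewrite normcM; ring.
rewrite !normc_sqr; case: (c * z) w => [x y] [p q] /=.
have := sqr_ge0 (x - p); have := sqr_ge0 (y - q); rewrite !sqrrB !sqrrD => ? ?; lra.
Qed.

Lemma square_summable_lin (c : C) a b : square_summable a -> square_summable b ->
  square_summable (fun n => c * a n + b n).
Proof.
move=> sa sb; apply: (@energy_bounded _ _
  (2 * normc c ^+ 2 * limn (energy a) + 2 * limn (energy b))) => N.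
apply: (@le_trans _ _ (2 * normc c ^+ 2 * energy a N + 2 * energy b N)).
  rewrite /energy !mulr_sumr -big_split /=; apply: ler_sum => n _; exact: normc2_lin_le.
apply: lerD; apply: ler_wpM2l => //; try exact: energy_le_lim.
by apply: mulr_ge0 => //; exact: sqr_ge0.
Qed.

Lemma square_summable_shift a : square_summable a -> square_summable (shift_coef a).
Proof.
move=> sa; apply: (@energy_bounded _ _ (limn (energy a))) => -[|N].
  by rewrite {1}/energy big_ord0 (le_trans (energy_ge0 a 0))// energy_le_lim.
by rewrite energy_shift energy_le_lim.
Qed.

Lemma hardy2P f : hardy2 f <-> exists a, power_series_of a f /\ square_summable a.
Proof. by split=> -[a [af /square_summableP sa]]; exists a. Qed.

Lemma hardy2_lin (c : C) f h : hardy2 f -> hardy2 h -> hardy2 (fun z => c * f z + h z).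
Proof.
move=> /hardy2P[a [af sa]] /hardy2P[b [bh sb]]; apply/hardy2P.
by exists (fun n => c * a n + b n); split; [exact: power_series_lin|exact: square_summable_lin].
Qed.

Lemma hardy2_0 : hardy2 (fun _ : disk R => 0).
Proof.
apply/hardy2P; exists (fun _ => 0); split.
  apply/power_seriesP => z; have E N : psum (fun=> 0) (val z) N = 0.
    by rewrite /psum big1// => n _; rewrite mul0r.
  by under eq_fun do rewrite E; exact: cvgC_cst.
by apply: (@energy_bounded _ _ 0) => N; rewrite /energy big1// => n _; rewrite normc0 expr0n.
Qed.

Lemma hardy2_shift f : hardy2 f -> hardy2 (fun z => val z * f z).
Proof.
move=> /hardy2P[a [af sa]]; apply/hardy2P; exists (shift_coef a).
by split; [exact: power_series_shift|exact: square_summable_shift].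
Qed.

(** Comparison: |a_n| r^n <= |a_n|^2 + r^(2 n), where r = |z| < 1. *)
Lemma cvg_series_square_summable a (z : disk R) : square_summable a ->
  cvgn (fun N => complex.Re (psum a (val z) N)).
Proof.
move=> sa; set r := normc (val z).
have r0 : 0 <= r by exact: normc_ge0.
have r1 : r ^+ 2 < 1 by rewrite expr_lt1//; exact: (valP z).
have cs : cvgn (series (fun n => normc (a n) ^+ 2 + (r ^+ 2) ^+ n)).
  have -> : series (fun n => normc (a n) ^+ 2 + (r ^+ 2) ^+ n) =
      (fun N => energy a N + series (fun n => (r ^+ 2) ^+ n) N).
    by apply/funext => N; rewrite /series /energy /= big_split /= big_mkord.
  apply: is_cvgD => //; have := @is_cvg_geometric_series R 1 (r ^+ 2).
  rewrite ger0_norm ?sqr_ge0// => /(_ r1); rewrite /geometric /=.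
  by under [X in series X]eq_fun do rewrite mul1r.
have : cvgn (series (fun n => `|complex.Re (a n * val z ^+ n)|)).
  apply: (@series_le_cvg _ _ (fun n => normc (a n) ^+ 2 + (r ^+ 2) ^+ n)) => // n.
    by apply: addr_ge0; [exact: sqr_ge0|apply: exprn_ge0; exact: sqr_ge0].
  apply: le_trans (abs_Re_le _) _; rewrite normcM.
  have -> : normc (val z ^+ n) = r ^+ n.
    by elim: n => [|n IH]; rewrite ?normc1// !exprS normcM IH.
  rewrite -exprM mulnC exprM.
  have := sqr_ge0 (normc (a n) - r ^+ n); rewrite sqrrB => h.
  have := mulr_ge0 (normc_ge0 (a n)) (exprn_ge0 n r0) => ?; lra.
move/normed_cvg; rewrite (_ : series (fun n => complex.Re (a n * val z ^+ n)) =
  (fun N => complex.Re (psum a (val z) N)))//.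
by apply/funext => N; rewrite /psum complex_Re_sum /series /= big_mkord.
Qed.

Lemma power_series_exists a : square_summable a -> exists f, power_series_of a f.
Proof.
move=> sa.
have sa' : square_summable (fun n => - 'i * a n) by rewrite /square_summable energy_rot.
exists (fun z => limn (fun N => complex.Re (psum a (val z) N)) +i*
  limn (fun N => complex.Re (psum (fun n => - 'i * a n) (val z) N))) ; apply/power_seriesP => z.
apply: cvg_ReIm; first exact: cvg_series_square_summable.
have -> : (fun N => complex.Im (psum a (val z) N)) =
   (fun N => complex.Re (psum (fun n => - 'i * a n) (val z) N)).
  apply/funext => N; rewrite -ReNi /psum mulr_sumr; congr complex.Re.
  by apply: eq_bigr => n _; rewrite mulrA.
exact: cvg_series_square_summable.
Qed.

End PowerSeries.

(** * The Hilbert space H^2 *)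

Section HardyInner.
Variable R : realType.
Notation C := R[i].
Notation mu := (@lebesgue_measure R).
Notation D := (angles R).
Notation Circ := (R -> Rcomplex R).
Notation Disk := (disk R -> Rcomplex R).
Implicit Types (a b : nat -> C) (f g h : Disk) (u v w : Circ).

Let cio := @circle_inner_on R.

Lemma nrm_ae0 u v : circle_L2 u -> circle_L2 v ->
  {ae mu, forall t, t \in D -> u t = v t} -> nrm (@cip R) (u - v) = 0.
Proof. by move=> uL vL /(circle_ae_eq uL vL) h; rewrite /nrm h sqrtr0. Qed.

Lemma cip_ae_congrl u v w : circle_L2 u -> circle_L2 v -> circle_L2 w ->
  {ae mu, forall t, t \in D -> u t = v t} -> cip u w = cip v w.
Proof.
move=> uL vL wL uv; apply/eqP; rewrite -subr_eq0 -normr_eq0 eq_le normr_ge0 andbT.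
have uvL := innerB cio uL vL.
by rewrite -(ipBl cio)// (le_trans (cauchy_schwarz cio uvL wL))// nrm_ae0// mul0r.
Qed.

Lemma cip_ae_congr u u' v v' : circle_L2 u -> circle_L2 u' -> circle_L2 v -> circle_L2 v' ->
  {ae mu, forall t, t \in D -> u t = u' t} -> {ae mu, forall t, t \in D -> v t = v' t} ->
  cip u v = cip u' v'.
Proof.
move=> uL uL' vL vL' uu vv; rewrite (cip_ae_congrl uL uL' vL uu).
by rewrite (ip_sym cio uL' vL) (ip_sym cio uL' vL'); exact: cip_ae_congrl.
Qed.

Lemma circle_L2_tpoly a N : circle_L2 (tpoly a N).
Proof.
have sq (x : R -> R) : continuous x -> sq_integrable mu D x.
  move=> cx; split.
    by apply: measurable_funTS; exact: continuous_measurable_fun.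
  apply: continuous_integrable_itv => t; under eq_fun do rewrite expr2.
  by apply: cvgM; exact: cx.
apply/circle_L2P; split; apply: sq; [exact: continuous_Re_tpoly|exact: continuous_Im_tpoly].
Qed.

Lemma sqn_tpoly a N : sqn (@cip R) (tpoly a N) = energy a N.
Proof.
rewrite sqn_cipE (tpoly_parseval a N (@angles_lt R) (@expit_angles R)) subr0 mulrA mulVf ?mul1r//.
by rewrite gt_eqF// angles_lt.
Qed.

(** The factor 6 is 12 pi from [boundary_exists], divided by the normalization 2 pi. *)
Lemma hardy_bdry a f : square_summable a -> power_series_of a f ->
  [/\ circle_L2 (bdry f), has_radial_limits f (bdry f) &
      forall N, sqn (@cip R) ((bdry f : Circ) - tpoly a N) <= 6 * tail_energy a N].
Proof.
move=> sa af; have [g [gL fg gB]] := boundary_exists sa af.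
have [bL fb bg] := bdryP gL fg; split => // N.
have pL := circle_L2_tpoly a N.
have gpL : circle_L2 ((g : Circ) - tpoly a N) := innerB cio gL pL.
have bpL : circle_L2 ((bdry f : Circ) - tpoly a N) := innerB cio bL pL.
apply: (@le_trans _ _ (sqn (@cip R) ((g : Circ) - tpoly a N))).
  apply: (sqn_le cio bpL gpL); rewrite (le_trans (nrm_dist cio bL gL pL))//.
  by rewrite nrm_ae0// add0r.
apply: sqn_cip_le => //; apply: le_trans (gB N) _.
by rewrite lee_fin le_eqVlt; apply/orP; left; apply/eqP; ring.
Qed.

Lemma hardy2_bdry f : hardy2 f -> circle_L2 (bdry f) /\ has_radial_limits f (bdry f).
Proof. by move=> /hardy2P[a [af sa]]; have [] := hardy_bdry sa af. Qed.

Lemma hardy2_bdry_L2 f : hardy2 f -> circle_L2 (bdry f).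
Proof. by move=> /hardy2_bdry[]. Qed.

Lemma circle_L2_lin (c : C) u v : circle_L2 u -> circle_L2 v ->
  circle_L2 (fun t => (c : C) * (u t : C) + (v t : C)).
Proof. by move=> uL vL; exact: (innerD cio (circle_L2_scale c uL) vL). Qed.

(** Linear only almost everywhere, since [bdry] is chosen for each function separately. *)
Lemma bdry_lin (c : C) f h : hardy2 f -> hardy2 h ->
  {ae mu, forall t, t \in D ->
    bdry (fun z => c * (f z : C) + (h z : C)) t = c * bdry f t + bdry h t}.
Proof.
move=> /hardy2_bdry[fL ff] /hardy2_bdry[hL hh].
by have [_ _] := bdryP (circle_L2_lin c fL hL) (has_radial_limits_lin c ff hh).
Qed.

Definition hip f g : R := cip (bdry f) (bdry g).

Lemma hip_lin c f g h : hardy2 f -> hardy2 g -> hardy2 h ->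
  hip (c *: f + g) h = c * hip f h + hip g h.
Proof.
move=> fH gH hH; have scE : c *: f + g = (fun z => c%:C * (f z : C) + (g z : C)).
  apply/funext => z; change (c *: f z + g z = c%:C * (f z : C) + g z).
  by case: (f z) (g z) => [? ?] [? ?]; simpc.
have sL : hardy2 (c *: f + g) by rewrite scE; exact: hardy2_lin.
have fL := hardy2_bdry_L2 fH; have gL := hardy2_bdry_L2 gH; have hL := hardy2_bdry_L2 hH.
rewrite -[RHS](ip_linl cio c fL gL hL).
apply: cip_ae_congrl (hardy2_bdry_L2 sL) (inner_lin cio c fL gL) hL _.
have := bdry_lin c%:C fH gH; apply: ae_imply => t h1 tD; rewrite scE h1//.
change (c%:C * bdry f t + bdry g t = c *: (bdry f t : Rcomplex R) + bdry g t).
by case: (bdry f t) (bdry g t) => [? ?] [? ?]; simpc.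
Qed.

Lemma hardy_inner_on : inner_on (@hardy2 R : set Disk) hip.
Proof.
split.
- exact: hardy2_0.
- move=> c f g fH gH; have -> : c *: f + g = (fun z => c%:C * (f z : C) + (g z : C)).
    apply/funext => z; change (c *: f z + g z = c%:C * (f z : C) + g z).
    by case: (f z) (g z) => [? ?] [? ?]; simpc.
  exact: hardy2_lin.
- exact: hip_lin.
- by move=> f g fH gH; apply: (ip_sym cio); exact: hardy2_bdry_L2.
- by move=> f fH; apply: (ip_ge0 cio); exact: hardy2_bdry_L2.
Qed.

Let hio := hardy_inner_on.

(** The partial sums converge to [bdry f] in norm, hence so do their norms, which are the partial
    energies. It links the boundary norm to the coefficients, on which definiteness and completeness
    rest. *)
Lemma hardy_sqn a f : square_summable a -> power_series_of a f -> sqn hip f = limn (energy a).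
Proof.
move=> sa af; have [bL _ bB] := hardy_bdry sa af.
have pL N := circle_L2_tpoly a N.
have n0 : (fun N => nrm (@cip R) ((bdry f : Circ) - tpoly a N)) @ \oo --> (0 : R).
  apply: cvg_sqn_nrm; apply: (@squeeze_cvgr _ _ _ _ (cst 0) (fun N => 6 * tail_energy a N)).
  - near=> N; rewrite bB andbT; exact: (sqn_ge0 cio (innerB cio bL (pL N))).
  - exact: cvg_cst.
  - by rewrite -(mulr0 6); apply: cvgMl_tmp; exact: tail_cvg0.
have cn : (fun N => nrm (@cip R) (tpoly a N)) @ \oo --> nrm (@cip R) (bdry f).
  apply/cvgrPdist_le => e e0; have [N _ NP] := proj1 (cvgrPdist_le _ _) n0 _ e0.
  exists N => // n Nn; apply: le_trans (NP n Nn).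
  rewrite /= sub0r normrN [leRHS]ger0_norm ?nrm_ge0//.
  rewrite ler_norml; apply/andP; split.
    rewrite lerNl opprB lerBlDr (nrm_distC cio bL (pL n)).
    have := nrmD cio (innerB cio (pL n) bL) bL; rewrite subrK.
    exact.
  rewrite lerBlDr; have := nrmD cio (innerB cio bL (pL n)) (pL n); rewrite subrK.
  exact.
have c2 : energy a @ \oo --> sqn hip f.
  rewrite -[sqn hip f]/(sqn (@cip R) (bdry f)) -(nrm_sqr cio)//.
  have -> : energy a = (fun N => nrm (@cip R) (tpoly a N) ^+ 2).
    by apply/funext => N; rewrite (nrm_sqr cio)// sqn_tpoly.
  rewrite expr2; under eq_fun do rewrite expr2.
  exact: cvgM.
by rewrite (cvg_lim _ c2).
Unshelve. all: by end_near. Qed.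

Lemma energy_le_sqn a f N : square_summable a -> power_series_of a f -> energy a N <= sqn hip f.
Proof. by move=> sa af; rewrite (hardy_sqn sa af) energy_le_lim. Qed.

Lemma coef_le_sqn a f n : square_summable a -> power_series_of a f ->
  normc (a n) ^+ 2 <= sqn hip f.
Proof.
move=> sa af; apply: le_trans (energy_le_sqn n.+1 sa af).
by rewrite energyS lerDr energy_ge0.
Qed.

Lemma hardy_definite : ip_definite (@hardy2 R : set Disk) hip.
Proof.
move=> f /hardy2P[a [af sa]] f0.
have a0 n : a n = 0.
  have := coef_le_sqn n sa af; rewrite f0 => h; apply/eqP; rewrite -normc_eq0 -sqrf_eq0.
  by rewrite eq_le h sqr_ge0.
apply/funext => z; have := (power_seriesP a f).1 af z.
have E N : psum a (val z) N = 0 by rewrite /psum big1// => n _; rewrite a0 mul0r.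
under eq_fun do rewrite E.
move=> h.
exact: (cvg_unique (@norm_hausdorff _ C^o) h (@cvgC_cst _ _ _ _ 0)).
Qed.

Lemma power_series_sub a b f g : power_series_of a f -> power_series_of b g ->
  power_series_of (fun n => - 1 * b n + a n) (f - g).
Proof.
move=> af bg; have := power_series_lin (c:=- 1) bg af.
rewrite (_ : (fun z => -1 * (g z : C) + (f z : C)) = f - g)//.
by apply/funext => z; rewrite mulN1r addrC.
Qed.

Lemma complex_cauchy_cvg (x : nat -> C) :
  (forall e : R, 0 < e -> exists N, forall m n, (N <= m)%N -> (N <= n)%N -> normc (x m - x n) < e) ->
  exists l, (x n : C^o) @[n --> \oo] --> (l : C^o).
Proof.
move=> cx.
have cauchy (y : nat -> R) : (forall m n, `|y m - y n| <= normc (x m - x n)) -> cvgn y.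
  move=> yx; apply/cauchy_cvgP/cauchy_exP => e e0; have [N NP] := cx e e0.
  exists (y N); exists N => // n Nn; rewrite /ball /=.
  by apply: le_lt_trans (yx _ _) (NP _ _ (leqnn N) Nn).
have cr : cvgn (fun n => complex.Re (x n)).
  by apply: cauchy => m n; rewrite -complex_ReB abs_Re_le.
have ci : cvgn (fun n => complex.Im (x n)).
  apply: cauchy => m n; apply: le_trans (abs_Im_le _).
  by case: (x m) (x n) => [? ?] [? ?].
by exists (limn (fun n => complex.Re (x n)) +i* limn (fun n => complex.Im (x n))); exact: cvg_ReIm.
Qed.

Lemma normc_cvg (x : nat -> C) (l : C) : (x n : C^o) @[n --> \oo] --> (l : C^o) ->
  forall c : C, (fun n => normc (c - x n) ^+ 2) @ \oo --> normc (c - l) ^+ 2.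
Proof.
move=> xl c; under eq_fun do rewrite normc_sqr; rewrite normc_sqr.
have sq (y : nat -> R) (k : R) : y @ \oo --> k -> (fun n => y n ^+ 2) @ \oo --> k ^+ 2.
  by move=> yk; rewrite expr2; under eq_fun do rewrite expr2; exact: cvgM.
have ImB z1 z2 : complex.Im (z1 - z2 : C) = complex.Im z1 - complex.Im z2.
  by case: z1 z2 => [? ?] [? ?].
apply: cvgD; apply: sq.
  rewrite complex_ReB; under eq_fun do rewrite complex_ReB.
  by apply: cvgB; [exact: cvg_cst|exact: cvg_Re].
rewrite ImB; under eq_fun do rewrite ImB.
by apply: cvgB; [exact: cvg_cst|exact: cvg_Im].
Qed.

(** Each coefficient sequence is Cauchy. The energy bound on finitely many coefficients of f_k - f_m
    passes to the limit in m, uniformly in the number N of coefficients, and then N grows. *)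
Lemma hardy_complete : ip_complete (@hardy2 R : set Disk) hip.
Proof.
move=> f fH cf.
have [a aP] := choice (fun k => (hardy2P (f k)).1 (fH k)).
have af k : power_series_of (a k) (f k) by have [] := aP k.
have sa k : square_summable (a k) by have [] := aP k.
have sd k m : square_summable (fun n => - 1 * a m n + a k n) by exact: square_summable_lin.
have dE k m n : - 1 * a m n + a k n = a k n - a m n by rewrite mulN1r addrC.
have cb k m n : normc (a k n - a m n) ^+ 2 <= sqn hip (f k - f m).
  by have := coef_le_sqn n (sd k m) (power_series_sub (af k) (af m)); rewrite dE.
have ca n : exists l, (a k n : C^o) @[k --> \oo] --> (l : C^o).
  apply: complex_cauchy_cvg => e e0; have [N NP] := cf _ (exprn_gt0 2 e0).
  exists N => k m Nk Nm; rewrite -(@ltr_pXn2r _ 2)// ?nnegrE ?normc_ge0 ?ltW//.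
  by apply: le_lt_trans (cb _ _ _) (NP _ _ Nk Nm).
have [al alP] := choice ca.
have ene k N : (fun m => energy (fun n => a k n - a m n) N) @ \oo -->
    energy (fun n => a k n - al n) N.
  rewrite /energy; elim: N => [|N IH].
    by rewrite big_ord0; under eq_fun do rewrite big_ord0; exact: cvg_cst.
  rewrite big_ord_recr /=; under eq_fun do rewrite big_ord_recr /=.
  by apply: cvgD => //; exact: normc_cvg.
have tail e : 0 < e -> exists K, forall k N, (K <= k)%N -> energy (fun n => a k n - al n) N <= e.
  move=> e0; have [K KP] := cf e e0; exists K => k N Kk.
  rewrite -(cvg_lim _ (ene k N))//; apply: limr_le; first by apply/cvg_ex; eexists; exact: ene.
  near=> m; have Km : (K <= m)%N by near: m; exact: nbhs_infty_ge.
  apply: le_trans (ltW (KP _ _ Kk Km)).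
  have := energy_le_sqn N (sd k m) (power_series_sub (af k) (af m)).
  by rewrite (_ : (fun n => - 1 * a m n + a k n) = (fun n => a k n - a m n))//; apply/funext.
have sdl k : (exists M, forall N, energy (fun n => a k n - al n) N <= M) ->
    square_summable (fun n => a k n - al n).
  by move=> [M]; exact: energy_bounded.
have [K1 K1P] := tail 1 ltr01.
have sal : square_summable al.
  have s1 : square_summable (fun n => a K1 n - al n) by apply: sdl; exists 1 => N; exact: K1P.
  have := square_summable_lin (c:=- 1) s1 (sa K1).
  by rewrite (_ : (fun n => _) = al)//; apply/funext => n; rewrite mulN1r opprB subrK.
have [l lP] := power_series_exists sal.
exists l; first by apply/hardy2P; exists al.
apply/cvgrPdist_le => e e0; have [K KP] := tail e e0.
exists K => // k Kk; rewrite /= sub0r normrN.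
have lH : hardy2 l by apply/hardy2P; exists al.
rewrite ger0_norm; last exact: (sqn_ge0 hio (innerB hio (fH k) lH)).
have ps := power_series_sub (af k) lP.
have sk : square_summable (fun n => - 1 * al n + a k n) by exact: square_summable_lin.
rewrite (hardy_sqn sk ps); apply: limr_le => //; near=> N.
rewrite (_ : (fun n => - 1 * al n + a k n) = (fun n => a k n - al n)); first exact: KP.
by apply/funext => n; rewrite mulN1r addrC.
Unshelve. all: by end_near. Qed.

Lemma hardy_innerE f g : hardy2 f -> hardy2 g ->
  hardy_inner f g = hip f g +i* hip f (fun z => 'i * (g z : C)).
Proof.
move=> fH gH; rewrite /hardy_inner circle_innerE; congr (_ +i* _).
have fL := hardy2_bdry_L2 fH; have gL := hardy2_bdry_L2 gH.
have igE : (fun z => 'i * (g z : C)) = (fun z => 'i * (g z : C) + 0) :> Disk.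
  by apply/funext => z; rewrite addr0.
have iH : hardy2 (fun z => 'i * (g z : C)) by rewrite igE; exact: (hardy2_lin 'i gH (hardy2_0 R)).
have iL := circle_L2_scale 'i gL; have iHL := hardy2_bdry_L2 iH.
have ff : {ae mu, forall t, t \in D -> bdry f t = bdry f t} by apply: aeW.
have ii : {ae mu, forall t, t \in D -> 'i * bdry g t = bdry (fun z => 'i * (g z : C)) t}.
  have [_ _] := bdryP iL (has_radial_limits_mul (has_radial_limits_cst 'i) (hardy2_bdry gH).2).
  by apply: ae_imply => t h tD; rewrite h.
exact: (cip_ae_congr fL fL iL iHL ff ii).
Qed.

End HardyInner.

(** * Bounded analytic functions lie in H^2 *)

Section BoundedAnalytic.
Variable R : realType.
Notation C := R[i].
Notation mu := (@lebesgue_measure R).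
Implicit Types (a : nat -> C) (f : disk R -> C).

Lemma normcX (z : C) n : normc (z ^+ n) = normc z ^+ n.
Proof. by elim: n => [|n IH]; rewrite ?normc1// !exprS normcM IH. Qed.

Lemma ler_normcD (z w : C) : normc (z + w) <= normc z + normc w.
Proof.
by have := ler_normD z w; rewrite !normC_E -rmorphD lecR.
Qed.

(** Convergence at s = (1 + r) / 2 bounds |a_n| s^n, and r / s < 1 gives a geometric majorant. *)
Lemma power_series_abs_cvg a f r : power_series_of a f -> 0 <= r < 1 ->
  cvgn (series (fun n => normc (a n) * r ^+ n)).
Proof.
move=> /power_seriesP af /andP[r0 r1]; pose s := (1 + r) / 2.
have s0 : 0 < s by rewrite divr_gt0// ltr_pwDl.
have s1 : s < 1 by rewrite /s; lra.
have rs : r < s by rewrite /s; lra.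
have sd : normc (s%:C : C) < 1 by rewrite /= expr0n addr0 sqrtr_sqr gtr0_norm.
pose z : disk R := exist _ (s%:C) sd.
have [N _ NP] := (cvg_normcP _ _).1 (af z) 1 ltr01.
have term n : (N <= n)%N -> normc (a n) * s ^+ n <= 2.
  move=> Nn; have := NP n Nn; have := NP n.+1 (leqW Nn) => /= h1 h2.
  have -> : normc (a n) * s ^+ n = normc ((f z - psum a s%:C n) - (f z - psum a s%:C n.+1)).
    rewrite /psum big_ord_recr /= -/(psum a s%:C n).
    have -> : f z - psum a s%:C n - (f z - (psum a s%:C n + a n * s%:C ^+ n)) = a n * s%:C ^+ n by ring.
    by rewrite normcM normcX /= expr0n addr0 sqrtr_sqr gtr0_norm.
  rewrite (le_trans (ler_normcD _ _))// normcN; move: h1 h2.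
  by move: (normc _) (normc _) => ? ? ? ?; lra.
pose B := 2 + \sum_(n < N) normc (a n) * s ^+ n.
have bd n : normc (a n) * s ^+ n <= B.
  have p0 m : 0 <= normc (a m) * s ^+ m by rewrite mulr_ge0 ?normc_ge0// exprn_ge0// ltW.
  have [Nn|nN] := leqP N n.
    by rewrite (le_trans (term n Nn))// lerDl sumr_ge0.
  rewrite /B (bigD1 (Ordinal nN))//= addrCA lerDl addr_ge0// sumr_ge0//.
have q0 : 0 <= r / s by apply: divr_ge0 => //; exact: ltW.
have rs1 : `|r / s| < 1 by rewrite ger0_norm// ltr_pdivrMr// mul1r.
apply: (@series_le_cvg _ _ (fun n => B * (r / s) ^+ n)).
- by move=> n; rewrite mulr_ge0 ?normc_ge0// exprn_ge0.
- move=> n; apply: mulr_ge0; last exact: exprn_ge0.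
  by rewrite addr_ge0// sumr_ge0// => m _; rewrite mulr_ge0 ?normc_ge0// exprn_ge0// ltW.
- move=> n; rewrite exprMn exprVn mulrA [B * _]mulrC -mulrA.
  rewrite [normc _ * _]mulrC ler_wpM2l ?exprn_ge0//.
  by rewrite ler_pdivlMr ?exprn_gt0.
- exact: is_cvg_geometric_series.
Qed.

(** On the circle of radius r the K-th partial sum is at most M plus the tail of an absolutely
    convergent series. Parseval bounds its energy by the square, and K tends to infinity. *)
Lemma energy_polar_le a f M r N : power_series_of a f -> (forall z, normc (f z) <= M) ->
  0 <= r < 1 -> energy (fun n => a n * (r ^+ n)%:C) N <= M ^+ 2.
Proof.
move=> af fM r01; have /andP[r0 r1] := r01.
pose c n := a n * (r ^+ n)%:C; pose s := series (fun n => normc (a n) * r ^+ n).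
have cs : cvgn s by exact: power_series_abs_cvg af r01.
have nd : nondecreasing_seq s.
  apply/nondecreasing_seqP => n; rewrite /s /series /= big_nat_recr//= lerDl.
  by rewrite mulr_ge0 ?normc_ge0// exprn_ge0.
have M0 : 0 <= M by rewrite (le_trans _ (fM (disk0 R)))// normc_ge0.
have diff K L t : (K <= L)%N -> normc (tpoly c L t - tpoly c K t) <= s L - s K.
  elim: L => [|L IH]; first by rewrite leqn0 => /eqP ->; rewrite !subrr normc0.
  rewrite leq_eqVlt => /predU1P[->|]; first by rewrite !subrr normc0.
  rewrite ltnS => KL; rewrite tpolyS addrAC (le_trans (ler_normcD _ _))//.
  rewrite /s /series /= big_nat_recr//= addrAC lerD ?IH// /c !normcM normcX normc_expit expr1n mulr1.
  by rewrite /= expr0n addr0 sqrtr_sqr ger0_norm// exprn_ge0.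
have close K t : normc (tpoly c K t) <= M + (limn s - s K).
  apply/ler_addgt0Pr => e e0.
  have zd : normc (r%:C * expit t : C) < 1 by rewrite normc_polar.
  have [L0 _ LP] := (cvg_normcP _ _).1 (@power_series_polar _ a f r t af r01) e e0.
  pose L := maxn L0 K; have h1 := LP L (leq_maxl _ _); have h2 := diff K L t (leq_maxr _ _).
  have h3 : normc (disk_ext f (r%:C * expit t)) <= M.
    by rewrite -[r%:C * expit t]/(val (exist _ (r%:C * expit t) zd : disk R)) disk_extE.
  have h4 : s L <= limn s by exact: nondecreasing_cvgn_le.
  have -> : tpoly c K t = disk_ext f (r%:C * expit t) -
      (disk_ext f (r%:C * expit t) - tpoly c L t) - (tpoly c L t - tpoly c K t) by ring.
  rewrite (le_trans (ler_normcD _ _))// normcN.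
  have := ler_normcD (disk_ext f (r%:C * expit t))
      (- (disk_ext f (r%:C * expit t) - tpoly c L t)).
  rewrite normcN => h5; move: h1 h2 h3 h4 h5 => /=.
  by move: (normc _) (normc _) (normc _) (normc _) => ? ? ? ? ? ? ? ? ?; lra.
have enK K : (N <= K)%N -> energy c N <= (M + (limn s - s K)) ^+ 2.
  move=> NK; apply: (@le_trans _ _ (energy c K)); first exact: energy_nd.
  have b0 : 0 <= M + (limn s - s K) by rewrite (le_trans _ (close K 0))// normc_ge0.
  rewrite -sqn_tpoly; apply: (sqn_cip_le (circle_L2_tpoly c K)).
  apply: (@le_trans _ _ (\int[mu]_(t in angles R) (cst ((M + (limn s - s K)) ^+ 2)%:E t))%E).
    apply: ge0_le_integral => //.
    - exact: measurable_angles.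
    - by move=> t _; rewrite lee_fin sqr_ge0.
    - apply/measurable_EFinP; apply: measurable_funTS; apply: continuous_measurable_fun.
      exact: continuous_normc2_tpoly.
    - by move=> t _; rewrite lee_fin ler_pXn2r// ?nnegrE ?normc_ge0.
  rewrite integral_cst; last exact: measurable_angles.
  have muE : mu (angles R) = (2 * pi)%:E.
    by rewrite /angles lebesgue_measure_itv/= lte_fin angles_lt -EFinD subr0.
  apply: (@le_trans _ _ (((M + (limn s - s K)) ^+ 2)%:E * (2 * pi)%:E)%E).
    by rewrite -muE.
  by rewrite -EFinM lee_fin mulrC.
have cl : (fun K => (M + (limn s - s K)) ^+ 2) @ \oo --> M ^+ 2.
  rewrite expr2; under eq_fun do rewrite expr2.
  have h : (fun K => M + (limn s - s K)) @ \oo --> M.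
    rewrite -[X in _ --> X]addr0 -(subrr (limn s)).
    by apply: cvgD; [exact: cvg_cst|apply: cvgB; [exact: cvg_cst|exact: cs]].
  exact: cvgM.
rewrite -(cvg_lim _ cl)//; apply: limr_ge; first by apply/cvg_ex; eexists; exact: cl.
by near=> K; apply: enK; near: K; exact: nbhs_infty_ge.
Unshelve. all: by end_near. Qed.

(** For n < N, r^N <= r^n, so (r^N)^2 times the energy up to N is at most M^2; then r tends to 1. *)
Lemma Hoo_hardy2 f : Hoo f -> hardy2 f.
Proof.
move=> [[a af] [M fM]]; apply/hardy2P; exists a; split => //.
apply: (@energy_bounded _ _ (M ^+ 2)) => N.
have cr : (fun r : R => (r ^+ N) ^+ 2 * energy a N) @ 1^'- --> (1 ^+ N) ^+ 2 * energy a N.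
  apply: cvgMr_tmp; apply: cvg_at_left_filter.
  have cX : continuous (fun r : R => r ^+ N) by exact: exprn_continuous.
  have h : (fun r : R => r ^+ N) @ (1 : R) --> (1 : R) ^+ N by exact: cX.
  by rewrite [X in _ --> X]expr2; under eq_fun do rewrite expr2; exact: cvgM.
rewrite !expr1n mul1r in cr.
apply: (@cvgr_to_le _ _ _ _ _ _ _ cr).
near=> r.
have r1 : r < 1 by near: r; exact: nbhs_left_lt.
have r0 : 0 <= r by near: r; apply: nbhs_left_ge.
have r01 : 0 <= r < 1 by rewrite r0.
apply: le_trans (energy_polar_le N af fM r01).
rewrite /energy mulr_sumr; apply: ler_sum => n _.
rewrite normcM exprMn mulrC ler_wpM2l ?sqr_ge0//.
have -> : normc ((r ^+ n)%:C : C) = r ^+ n.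
  by rewrite /= expr0n addr0 sqrtr_sqr ger0_norm// exprn_ge0.
rewrite ler_pXn2r ?nnegrE ?exprn_ge0//.
by apply: ler_wiXn2l => //; exact: ltnW.
Unshelve. all: by end_near. Qed.

End BoundedAnalytic.

(** * Multipliers and Toeplitz operators *)

Section Multipliers.
Variable R : realType.
Notation C := R[i].
Notation mu := (@lebesgue_measure R).
Notation D := (angles R).
Notation Circ := (R -> Rcomplex R).
Notation Disk := (disk R -> Rcomplex R).
Notation H2 := (@hardy2 R : set Disk).
Notation hip := (@hip R).
Notation cip := (@cip R).
Implicit Types (f g h : Disk) (u v w phi : Circ).

Let cio := @circle_inner_on R.
Let hio := @hardy_inner_on R.

Definition ae_on_circle u v := {ae mu, forall t, t \in D -> u t = v t}.

Lemma ae_on_sym u v : ae_on_circle u v -> ae_on_circle v u.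
Proof. by apply: ae_imply => t h tD; rewrite h. Qed.

Lemma ae_on_trans u v w : ae_on_circle u v -> ae_on_circle v w -> ae_on_circle u w.
Proof. by apply: ae_imply2 => t h1 h2 tD; rewrite h1// h2. Qed.

Lemma ae_on_map (F : R -> C -> C) u u' : ae_on_circle u u' ->
  ae_on_circle (fun t => F t (u t)) (fun t => F t (u' t)).
Proof. by apply: ae_imply => t h tD; rewrite h. Qed.

Lemma ae_on_map2 (F : C -> C -> C) u u' v v' : ae_on_circle u u' -> ae_on_circle v v' ->
  ae_on_circle (fun t => F (u t) (v t)) (fun t => F (u' t) (v' t)).
Proof. by apply: ae_imply2 => t h1 h2 tD; rewrite h1// h2. Qed.

Lemma ae_on_nrm u v : circle_L2 u -> circle_L2 v -> ae_on_circle u v <-> nrm cip (u - v) = 0.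
Proof.
move=> uL vL; split; first exact: nrm_ae0.
move=> h; apply/(circle_ae_eq uL vL).
by have := nrm_sqr cio (innerB cio uL vL); rewrite h expr0n => /esym.
Qed.

Lemma hip_nrmB f g : hardy2 f -> hardy2 g ->
  nrm hip (f - g) = nrm cip ((bdry f : Circ) - bdry g).
Proof.
move=> fH gH; have fL := hardy2_bdry_L2 fH; have gL := hardy2_bdry_L2 gH.
by congr Num.sqrt; rewrite (sqnB hio fH gH) (sqnB cio fL gL).
Qed.

Lemma bdry_inj f g : hardy2 f -> hardy2 g -> ae_on_circle (bdry f) (bdry g) -> f = g.
Proof.
move=> fH gH /(ae_on_nrm (hardy2_bdry_L2 fH) (hardy2_bdry_L2 gH)) h.
by apply: (nrm_le0_eq hio (@hardy_definite R) fH gH); rewrite hip_nrmB// h.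
Qed.

Definition multiplier phi :=
  [/\ circle_L2 phi, {ae mu, forall t, t \in D -> normc (phi t) <= 1} &
      forall f, hardy2 f -> exists2 h, hardy2 h &
        ae_on_circle (bdry h) (fun t => (phi t : C) * bdry f t)].

Lemma multiplier_L2 phi u : multiplier phi -> circle_L2 u ->
  circle_L2 (fun t => (phi t : C) * (u t : C)).
Proof. by move=> [[mr mi _] bd _] uL; exact: (@circle_L2_mul _ phi u 1 mr mi bd uL). Qed.

Lemma multiplier_ae phi psi : circle_L2 psi -> ae_on_circle psi phi -> multiplier phi ->
  multiplier psi.
Proof.
move=> pL pp [fL bd mul]; split => //.
  by move: pp bd; apply: ae_imply2 => t h1 h2 tD; rewrite h1// h2.
move=> f fH; have [h hH hE] := mul f fH; exists h => //.
by apply: (ae_on_trans hE); apply: ae_imply pp => t E tD; rewrite E.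
Qed.

Lemma multiplierM phi psi : multiplier phi -> multiplier psi ->
  multiplier (fun t => (phi t : C) * (psi t : C)).
Proof.
move=> mphi mpsi; have [pL pb pm] := mphi; have [qL qb qm] := mpsi; split.
- exact: multiplier_L2.
- move: pb qb; apply: ae_imply2 => t h1 h2 tD; rewrite normcM mulr_ile1 ?normc_ge0 ?h1 ?h2//.
- move=> f fH; have [g gH gE] := qm f fH; have [h hH hE] := pm g gH; exists h => //.
  apply: (ae_on_trans hE); apply: ae_imply gE => t E tD.
  by rewrite E// mulrA.
Qed.

Lemma multiplier_half phi : multiplier phi ->
  multiplier (fun t => (1 + (phi t : C) ^+ 2) / 2).
Proof.
move=> mphi; have [pL pb pm] := mphi; have [ppL ppb ppm] := multiplierM mphi mphi.
have c2 : (2 : C)^-1 = (2^-1 : R)%:C by rewrite fmorphV rmorph_nat.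
have oneL : circle_L2 (fun _ : R => 1 : C).
  have := circle_L2_tpoly (fun _ => 1 : C) 1.
  rewrite (_ : tpoly (fun _ => 1 : C) 1 = fun=> 1)//.
  by apply/funext => t; rewrite tpolyS tpoly0 add0r mulr1.
split.
- have := circle_L2_scale 2^-1 (circle_L2_lin 1 oneL ppL).
  rewrite (_ : (fun t => _) = (fun t => (1 + (phi t : C) ^+ 2) / 2))//.
  by apply/funext => t; rewrite mulrC mul1r expr2.
- move: pb; apply: ae_imply => t h tD; rewrite normcM.
  have n2 : normc (2^-1 : C) = 2^-1.
    by rewrite c2 /= expr0n addr0 sqrtr_sqr gtr0_norm.
  rewrite n2 ler_pdivrMr// mul1r (le_trans (ler_normcD _ _))// normc1 normcX.
  by rewrite -[leRHS]/(1 + 1 : R) lerD2l expr_le1// ?h// normc_ge0.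
- move=> f fH; have [h hH hE] := ppm f fH.
  have hf := hardy2_lin 1 fH hH.
  (* The factor 1 and the term 0 give the shape c * f + g of [hardy2_lin] and [bdry_lin]. *)
  exists (fun z => 2^-1 * (1 * f z + h z) + 0); first exact: (hardy2_lin 2^-1 hf (hardy2_0 R)).
  have e1 := bdry_lin 2^-1 hf (hardy2_0 R); have e2 := bdry_lin 1 fH hH.
  have e0 : {ae mu, forall t, t \in D -> bdry (fun _ : disk R => 0 : C) t = 0}.
    have zL : circle_L2 (fun _ : R => 0 : C) := inner0 cio.
    by have [_ _] := bdryP zL (has_radial_limits_cst 0).
  have e3 : {ae mu, forall t, t \in D -> bdry (fun z => 2^-1 * (1 * f z + h z) + 0) t =
      2^-1 * (1 * bdry f t + bdry h t)}.
    have e10 : {ae mu, forall t, t \in D -> bdry (fun z => 2^-1 * (1 * f z + h z) + 0) t =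
        2^-1 * bdry (fun z => 1 * f z + h z) t}.
      by move: e1 e0; apply: ae_imply2 => t E1 E2 tD; rewrite E1// E2// addr0.
    by move: e10 e2; apply: ae_imply2 => t E1 E2 tD; rewrite E1// E2.
  move: e3 hE; apply: ae_imply2 => t E1 E2 tD; rewrite E1// E2// expr2.
  by rewrite mul1r [RHS]mulrAC mulrDl mul1r [LHS]mulrC.
Qed.

(** The projection is a choice, so h must satisfy its specification and be the only solution: for
    another solution k, h - k is in H^2 and orthogonal to itself. *)
Lemma toeplitz_multiplier phi f : multiplier phi -> hardy2 f ->
  hardy2 (toeplitz phi f) /\
  ae_on_circle (bdry (toeplitz phi f)) (fun t => (phi t : C) * bdry f t).
Proof.
move=> mphi fH; have [_ _ pm] := mphi; have [h hH hE] := pm f fH.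
have fL := hardy2_bdry_L2 fH; have uL := multiplier_L2 mphi fL; have hL := hardy2_bdry_L2 hH.
pose S := [set k : disk R -> C | hardy2 k /\ forall g, hardy2 g ->
    circle_inner (fun t => phi t * bdry f t - bdry k t) (bdry g) = 0].
suff U : forall k, S k -> k = h.
  have Sh : S h.
    split => // g gH; rewrite circle_innerE.
    have gL := hardy2_bdry_L2 gH.
    have zL : circle_L2 (fun _ : R => 0 : C) := inner0 cio.
    have dL : circle_L2 (fun t => (phi t : C) * bdry f t - bdry h t) := innerB cio uL hL.
    have dz : ae_on_circle (fun t => (phi t : C) * bdry f t - bdry h t) (fun=> 0).
      by apply: ae_imply hE => t E tD; rewrite E// subrr.
    rewrite (cip_ae_congrl dL zL gL dz) (cip_ae_congrl dL zL (circle_L2_scale 'i gL) dz).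
    rewrite (ip0l cio gL) (ip0l cio (circle_L2_scale 'i gL)) //.
  have [] : S (toeplitz phi f) by exact: (@xgetPex _ (fun=> 0) S (ex_intro _ h Sh)).
  move=> tH tS; rewrite (U _ (conj tH tS)); exact: (conj hH hE).
move=> k [kH kS]; have kL := hardy2_bdry_L2 kH.
have hkH : hardy2 (h - k : Disk) := innerB hio hH kH.
have hkL := hardy2_bdry_L2 hkH.
have := kS _ hkH; rewrite circle_innerE => -[E _].
have z : hip (h - k) (h - k) = 0.
  rewrite (ipBl hio hH kH hkH) -E.
  have -> : cip (fun t => (phi t : C) * bdry f t - bdry k t) (bdry (h - k : Disk)) =
    cip (fun t => (phi t : C) * bdry f t) (bdry (h - k : Disk)) -
    cip (bdry k) (bdry (h - k : Disk)) := ipBl cio uL kL hkL.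
  by congr (_ - _); exact: (cip_ae_congrl hL uL hkL hE).
have := @hardy_definite R _ hkH z => /eqP; rewrite subr_eq0 => /eqP ->//.
Qed.

Section Toeplitz.
Variable phi : Circ.
Hypothesis mphi : multiplier phi.
Local Notation M := (toeplitz phi).
Local Notation M' := (toeplitz (fun t => conjc (phi t))).

Lemma toeplitz_H f : hardy2 f -> hardy2 (M f).
Proof. by move=> fH; have [] := toeplitz_multiplier mphi fH. Qed.

Lemma toeplitz_bdry f : hardy2 f -> ae_on_circle (bdry (M f)) (fun t => (phi t : C) * bdry f t).
Proof. by move=> fH; have [] := toeplitz_multiplier mphi fH. Qed.

Lemma toeplitz_unique f g : hardy2 f -> hardy2 g ->
  ae_on_circle (bdry g) (fun t => (phi t : C) * bdry f t) -> M f = g.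
Proof.
move=> fH gH gE; apply: (bdry_inj (toeplitz_H fH) gH).
exact: (ae_on_trans (toeplitz_bdry fH) (ae_on_sym gE)).
Qed.

Lemma toeplitz_linC (c : C) f g : hardy2 f -> hardy2 g ->
  M (fun z => c * (f z : C) + (g z : C)) = (fun z => c * (M f z : C) + (M g z : C)).
Proof.
move=> fH gH; have MfH := toeplitz_H fH; have MgH := toeplitz_H gH.
apply: (toeplitz_unique (hardy2_lin c fH gH) (hardy2_lin c MfH MgH)).
apply: (ae_on_trans (bdry_lin c MfH MgH)).
apply: (ae_on_trans (ae_on_map2 (fun p q : C => c * p + q) (toeplitz_bdry fH) (toeplitz_bdry gH))).
have E := ae_on_map (fun t p => (phi t : C) * p) (ae_on_sym (bdry_lin c fH gH)).
have -> : (fun t => c * ((phi t : C) * bdry f t) + (phi t : C) * bdry g t) =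
    (fun t => (phi t : C) * (c * bdry f t + bdry g t)).
  by apply/funext => t; rewrite mulrDr mulrCA.
exact: E.
Qed.

Lemma scale_addE (c : R) f g : c *: f + g = (fun z => c%:C * (f z : C) + (g z : C)).
Proof.
apply/funext => z; change (c *: f z + g z = c%:C * (f z : C) + g z).
by case: (f z) (g z) => [? ?] [? ?]; simpc.
Qed.

Lemma toeplitz_op : operator_on H2 M.
Proof.
split=> [f|c f g fH gH]; first exact: toeplitz_H.
by rewrite scale_addE toeplitz_linC// -scale_addE.
Qed.

Lemma toeplitz_nrm f : hardy2 f -> nrm hip (M f) <= nrm hip f.
Proof.
move=> fH; have fL := hardy2_bdry_L2 fH; have uL := multiplier_L2 mphi fL.
have MH := toeplitz_H fH; have ML := hardy2_bdry_L2 MH.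
apply: nrm_le; rewrite /sqn -[leLHS]/(sqn cip (bdry (M f))) -[leRHS]/(sqn cip (bdry f)).
rewrite !sqn_cipE; apply: ler_wpM2l; first by rewrite invr_ge0 ltW// angles_lt.
have [_ bd _] := mphi.
have b : {ae mu, forall t, t \in D -> normc (bdry (M f) t) <= normc (bdry f t)}.
  move: (toeplitz_bdry fH) bd; apply: ae_imply2 => t E h tD.
  by rewrite E// normcM ler_piMl ?normc_ge0 ?h.
have iM := circle_L2_sq_integral ML; have iF := circle_L2_sq_integral fL.
have mA := @measurable_angles R.
rewrite /Rintegral; apply: fine_le; [exact: (integrable_fin_num mA iM)|exact: (integrable_fin_num mA iF)|].
apply: ae_ge0_le_integral => //.
- by move=> t _; rewrite lee_fin sqr_ge0.
- exact: (measurable_int mu iM).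
- by move=> t _; rewrite lee_fin sqr_ge0.
- exact: (measurable_int mu iF).
- apply: ae_imply b => t h tD; rewrite lee_fin ler_pXn2r// ?nnegrE ?normc_ge0// h// inE//.
Qed.

Lemma cip_conj u v : cip (fun t => conjc (phi t) * (u t : C)) v = cip u (fun t => (phi t : C) * (v t : C)).
Proof.
rewrite !cipE; congr (_ * _); apply: eq_Rintegral => t _.
by case: (phi t) (u t) (v t) => [? ?] [? ?] [? ?] /=; ring.
Qed.

(** The product of conj phi and [bdry f] may leave H^2, so its projection comes from Riesz
    representation: g represents h |-> <M h, f>. For k in H^2, being the projection is equivalent to
    <k, h> = <f, M h> for all h; the imaginary part of the orthogonality is the real one tested on i
    h. *)
Lemma toeplitz_adjoint f : hardy2 f ->
  hardy2 (M' f) /\ forall h, hardy2 h -> hip (M' f) h = hip f (M h).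
Proof.
move=> fH; have fL := hardy2_bdry_L2 fH.
have [g gH gE] : exists2 g, H2 g & forall h, H2 h -> hip (M h) f = hip h g.
  apply: (@bounded_representation R Disk H2 hip hio M 1 f (@hardy_complete R) toeplitz_op _ fH).
  by move=> h hH; rewrite mul1r; exact: toeplitz_nrm.
have gL := hardy2_bdry_L2 gH.
have gE' h : hardy2 h -> hip g h = hip f (M h).
  move=> hH; exact: (etrans (ip_sym hio gH hH)
    (etrans (esym (gE h hH)) (ip_sym hio (toeplitz_H hH) fH))).
pose S := [set k : disk R -> C | hardy2 k /\ forall h, hardy2 h ->
    circle_inner (fun t => conjc (phi t) * bdry f t - bdry k t) (bdry h) = 0].
have [pL pb _] := mphi.
have cL : circle_L2 (fun t => conjc (phi t) * bdry f t).
  have [mr mi _] := pL; apply: (@circle_L2_mul _ (fun t => conjc (phi t)) _ 1) => //.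
  - have -> : (fun t => complex.Re (conjc (phi t))) = (fun t => complex.Re (phi t)).
      by apply/funext => t; case: (phi t).
    exact: mr.
  - have -> : (fun t => complex.Im (conjc (phi t))) = (fun t => - complex.Im (phi t)).
      by apply/funext => t; case: (phi t).
    exact: measurableT_comp.
  - apply: ae_imply pb => t h tD.
    by rewrite (_ : normc (conjc (phi t)) = normc (phi t)) ?h//; case: (phi t) => x y; rewrite /= sqrrN.
have adj h : hardy2 h -> cip (fun t => conjc (phi t) * bdry f t) (bdry h) = hip f (M h).
  move=> hH; rewrite cip_conj /hip.
  have hL := hardy2_bdry_L2 hH; have phL := multiplier_L2 mphi hL.
  have MhL := hardy2_bdry_L2 (toeplitz_H hH).
  rewrite (ip_sym cio fL phL) [RHS](ip_sym cio fL MhL).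
  exact: (cip_ae_congrl phL MhL fL (ae_on_sym (toeplitz_bdry hH))).
have Sip k : hardy2 k -> S k <-> forall h, hardy2 h -> hip k h = hip f (M h).
  move=> kH; have kL := hardy2_bdry_L2 kH.
  have subE h : hardy2 h -> cip (fun t => conjc (phi t) * bdry f t - bdry k t) (bdry h) =
      hip f (M h) - hip k h.
    move=> hH; rewrite -adj//; exact: (ipBl cio cL kL (hardy2_bdry_L2 hH)).
  split=> [[_ kS] h hH|kP].
    have := kS h hH; rewrite circle_innerE => -[E _].
    have /eqP := etrans (esym (subE h hH)) E; rewrite subr_eq0 => /eqP E'; exact: esym E'.
  have e0 h : hardy2 h -> cip (fun t => conjc (phi t) * bdry f t - bdry k t) (bdry h) = 0.
    move=> hH; apply: (etrans (subE h hH)); apply/eqP; rewrite subr_eq0; apply/eqP.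
    exact: esym (kP h hH).
  split=> // h hH; rewrite circle_innerE (e0 h hH).
  have hL := hardy2_bdry_L2 hH; have iL := circle_L2_scale 'i hL.
  have iH : hardy2 (fun z => 'i * h z + 0) := hardy2_lin 'i hH (hardy2_0 R).
  have ihL := hardy2_bdry_L2 iH.
  have ih : ae_on_circle (fun t => 'i * bdry h t) (bdry (fun z => 'i * h z + 0)).
    have [_ _ E] := bdryP iL (has_radial_limits_mul (has_radial_limits_cst 'i) (hardy2_bdry hH).2).
    have -> : (fun z => 'i * h z + 0) = (fun z => 'i * h z).
      by apply/funext => z; rewrite addr0.
    exact: ae_on_sym.
  have dL : circle_L2 (fun t => conjc (phi t) * bdry f t - bdry k t) := innerB cio cL kL.
  have i0 : cip (fun t => conjc (phi t) * bdry f t - bdry k t) (fun t => 'i * bdry h t) = 0.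
    exact: (etrans (ip_sym cio dL iL) (etrans (cip_ae_congrl iL ihL dL ih)
      (etrans (ip_sym cio ihL dL) (e0 _ iH)))).
  by rewrite i0.
have Sg : S g by apply/(Sip g gH).
have SM : S (M' f) by exact: (@xgetPex _ (fun=> 0) S (ex_intro _ g Sg)).
have MH : hardy2 (M' f) by case: SM.
exact: (conj MH ((Sip _ MH).1 SM)).
Qed.

End Toeplitz.
End Multipliers.

(** * Inner multipliers *)

Section InnerMultiplier.
Variable R : realType.
Notation C := R[i].
Notation mu := (@lebesgue_measure R).
Notation D := (angles R).
Notation Circ := (R -> Rcomplex R).
Notation Disk := (disk R -> Rcomplex R).
Notation hip := (@hip R).
Notation cip := (@cip R).

Let cio := @circle_inner_on R.
Let hio := @hardy_inner_on R.

Variable I : disk R -> C.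
Hypothesis I_inner : inner_function I.

Lemma circle_ae_nonempty (P : R -> Prop) :
  {ae mu, forall t, t \in D -> P t} -> exists t, P t.
Proof.
move=> [N [mN N0 sub]]; apply: contrapT => nP.
have DN : D `<=` N.
  move=> t tD; apply: sub => /= h; apply: nP; exists t; apply: h; exact: mem_set.
have : (mu D <= mu N)%E by apply: le_measure; rewrite ?inE//; exact: measurable_angles.
have muE : mu D = (2 * pi)%:E.
  by rewrite /angles lebesgue_measure_itv/= lte_fin angles_lt -EFinD subr0.
rewrite muE N0 lee_fin leNgt angles_lt //.
Qed.

(** Otherwise [bdry I] would be the default 0, contradicting modulus 1 almost everywhere on a circle
    of positive measure. *)
Lemma inner_bdry : circle_L2 (bdry I) /\ has_radial_limits I (bdry I).
Proof.
have [_ uI] := I_inner.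
have [[g [gL gI]]|ng] := pselect (exists g, circle_L2 g /\ has_radial_limits I g).
  by have [bL bI _] := bdryP gL gI.
exfalso; have [t] := circle_ae_nonempty uI.
rewrite /bdry xgetPN; last by move=> g gP; apply: ng; exists g.
by rewrite normc0 => /eqP; rewrite eq_sym oner_eq0.
Qed.

Lemma inner_unimodular : {ae mu, forall t, t \in D -> normc (bdry I t) = 1}.
Proof. by have [] := I_inner. Qed.

Lemma inner_L2_mul (u : Circ) : circle_L2 u -> circle_L2 (fun t => bdry I t * (u t : C)).
Proof.
move=> uL; have [[mr mi _] _] := inner_bdry.
apply: (@circle_L2_mul _ (bdry I) u 1 mr mi _ uL).
by apply: ae_imply inner_unimodular => t h tD; rewrite h.
Qed.

Lemma inner_mul_nrm (u : Circ) : circle_L2 u ->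
  nrm cip (fun t => bdry I t * (u t : C)) = nrm cip u.
Proof.
move=> uL; congr Num.sqrt.
exact: (sqn_cip_unimodular inner_unimodular uL (inner_L2_mul uL)).
Qed.

Lemma inner_mul_nrmB (u v : Circ) : circle_L2 u -> circle_L2 v ->
  nrm cip ((fun t => bdry I t * (u t : C)) - (fun t => bdry I t * (v t : C)) : Circ) =
  nrm cip (u - v).
Proof.
move=> uL vL; rewrite -(inner_mul_nrm (innerB cio uL vL)); congr (nrm cip _).
by apply/funext => t; exact: esym (mulrBr _ _ _).
Qed.

Lemma hardy2_monomial_mul n : hardy2 (fun z : disk R => val z ^+ n * I z).
Proof.
elim: n => [|n IH].
  have -> : (fun z : disk R => val z ^+ 0 * I z) = I by apply/funext => z; rewrite mul1r.
  by apply: Hoo_hardy2; case: I_inner.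
have -> : (fun z : disk R => val z ^+ n.+1 * I z) = (fun z => val z * (val z ^+ n * I z)).
  by apply/funext => z; rewrite exprS mulrA.
exact: hardy2_shift.
Qed.

Lemma hardy2_psum_mul (a : nat -> C) N : hardy2 (fun z : disk R => psum a (val z) N * I z).
Proof.
elim: N => [|N IH].
  have -> : (fun z : disk R => psum a (val z) 0 * I z) = (fun=> 0).
    by apply/funext => z; rewrite /psum big_ord0 mul0r.
  exact: hardy2_0.
have -> : (fun z : disk R => psum a (val z) N.+1 * I z) =
    (fun z => a N * (val z ^+ N * I z) + psum a (val z) N * I z).
  by apply/funext => z; rewrite /psum big_ord_recr /= mulrDl mulrA addrC.
exact: (hardy2_lin (a N) (hardy2_monomial_mul N) IH).
Qed.

Lemma radial_psum (a : nat -> C) N :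
  has_radial_limits (fun z : disk R => psum a (val z) N) (tpoly a N).
Proof.
have mono n : has_radial_limits (fun z : disk R => val z ^+ n) (fun t => expit t ^+ n).
  elim: n => [|n IH].
    have -> : (fun z : disk R => val z ^+ 0) = (fun=> 1) by apply/funext => z; rewrite expr0.
    exact: has_radial_limits_cst.
  have -> : (fun z : disk R => val z ^+ n.+1) = (fun z => val z * val z ^+ n).
    by apply/funext => z; rewrite exprS.
  have -> : (fun t : R => expit t ^+ n.+1) = (fun t => expit t * expit t ^+ n).
    by apply/funext => t; rewrite exprS.
  exact: (has_radial_limits_mul (@has_radial_limits_id R) IH).
elim: N => [|N IH].
  have -> : (fun z : disk R => psum a (val z) 0) = (fun=> 0).
    by apply/funext => z; rewrite /psum big_ord0.
  have -> : tpoly a 0 = (fun=> 0) by apply/funext => t; rewrite tpoly0.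
  exact: has_radial_limits_cst.
have -> : (fun z : disk R => psum a (val z) N.+1) =
    (fun z => a N * val z ^+ N + psum a (val z) N).
  by apply/funext => z; rewrite /psum big_ord_recr /= addrC.
have -> : tpoly a N.+1 = (fun t => a N * expit t ^+ N + tpoly a N t).
  by apply/funext => t; rewrite tpolyS addrC.
exact: (has_radial_limits_lin (a N) (mono N) IH).
Qed.

(* [bdry I * bdry f] is the L^2 limit of the boundary functions of the products of [I] with the
   partial sums of [f], which lie in H^2. *)
Lemma inner_multiplier : multiplier (bdry I).
Proof.
have [IL Irad] := inner_bdry; split=> //.
  by apply: ae_imply inner_unimodular => t h tD; rewrite h.
move=> f fH; have [a [af sa]] := (hardy2P f).1 fH; have fL := hardy2_bdry_L2 fH.
have [_ _ fB] := hardy_bdry sa af.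
pose u N : Disk := fun z => psum a (val z) N * I z.
pose p N : Circ := tpoly a N.
have pL N : circle_L2 (p N) by exact: circle_L2_tpoly.
have uH N : hardy2 (u N) by exact: hardy2_psum_mul.
have uL N := hardy2_bdry_L2 (uH N).
have gpL N := inner_L2_mul (pL N).
have uE N : ae_on_circle (bdry (u N)) (fun t => bdry I t * (p N t : C)).
  have -> : (fun t => bdry I t * (p N t : C)) = (fun t => (p N t : C) * bdry I t).
    by apply/funext => t; rewrite mulrC.
  have gpL' : circle_L2 (fun t => (p N t : C) * bdry I t).
    have -> : (fun t => (p N t : C) * bdry I t) = (fun t => bdry I t * (p N t : C)).
      by apply/funext => t; rewrite mulrC.
    exact: gpL.
  by have [_ _] := bdryP gpL' (has_radial_limits_mul (radial_psum a N) Irad).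
have pf : (fun N => nrm cip (p N - (bdry f : Circ))) @ \oo --> (0 : R).
  have -> : (fun N => nrm cip (p N - (bdry f : Circ))) = (fun N => nrm cip ((bdry f : Circ) - p N)).
    by apply/funext => N; exact: (nrm_distC cio (pL N) fL).
  apply: cvg_sqn_nrm; apply: (@squeeze_cvgr _ _ _ _ (cst 0) (fun N => 6 * tail_energy a N)).
  - near=> N; apply/andP; split; last exact: fB.
    exact: (sqn_ge0 cio (innerB cio fL (pL N))).
  - exact: cvg_cst.
  - by rewrite -(mulr0 6); apply: cvgMl_tmp; exact: tail_cvg0.
have u_gp N : nrm cip ((bdry (u N) : Circ) - (fun t => bdry I t * (p N t : C))) = 0.
  exact: (nrm_ae0 (uL N) (gpL N) (uE N)).
(* Multiplication by the unimodular [bdry I] preserves distances, so [u] inherits the Cauchy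
   property of the partial sums. *)
have dist m n : nrm hip (u m - u n) <= nrm cip (p m - p n).
  rewrite (hip_nrmB (uH m) (uH n)) -(inner_mul_nrmB (pL m) (pL n)).
  apply: (le_trans (nrm_dist cio (uL m) (gpL m) (uL n))).
  rewrite u_gp add0r; apply: (le_trans (nrm_dist cio (gpL m) (gpL n) (uL n))).
  by rewrite [X in _ + X](nrm_distC cio (gpL n) (uL n)) u_gp addr0.
have cau : ip_cauchy hip u.
  move=> e e0; have s0 : 0 < Num.sqrt e by rewrite sqrtr_gt0.
  have [N _ NP] := proj1 (cvgrPdist_lt _ _) pf _ (divr_gt0 s0 (ltr0Sn R 1)).
  exists N => m n Nm Nn; rewrite -(nrm_sqr hio (innerB hio (uH m) (uH n))).
  rewrite -[ltRHS]sqr_sqrtr 1?ltW// ltr_pXn2r// ?nnegrE ?nrm_ge0 ?sqrtr_ge0//.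
  have := NP m Nm; have := NP n Nn; rewrite /= !sub0r !normrN !ger0_norm ?nrm_ge0//.
  move=> h1 h2; apply: (le_lt_trans (dist m n)).
  apply: (le_lt_trans (nrm_dist cio (pL m) fL (pL n))).
  rewrite [X in _ + X](nrm_distC cio fL (pL n)).
  by move: (nrm _ _) (nrm _ _) h1 h2 => ? ? ? ?; lra.
have [h hH hlim] := hardy_complete uH cau.
exists h => //; have hL := hardy2_bdry_L2 hH; have gfL := inner_L2_mul fL.
apply/(ae_on_nrm hL gfL)/eqP; rewrite eq_le nrm_ge0 andbT.
have cs : (fun N => nrm hip (u N - h) + nrm cip (p N - (bdry f : Circ))) @ \oo --> (0 : R).
  by rewrite -(addr0 0); apply: cvgD => //; exact: cvg_sqn_nrm.
rewrite -(cvg_lim _ cs)//; apply: limr_ge; first by apply/cvg_ex; exists 0.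
near=> N; rewrite (hip_nrmB (uH N) hH) (nrm_distC cio (uL N) hL).
rewrite -(inner_mul_nrmB (pL N) fL).
apply: (le_trans (nrm_dist cio hL (uL N) gfL)); apply: lerD => //.
apply: (le_trans (nrm_dist cio (uL N) (gpL N) gfL)).
by rewrite u_gp add0r.
Unshelve. all: by end_near. Qed.

Lemma inner_toeplitz_isometry (f : Disk) : hardy2 f -> sqn hip (toeplitz (bdry I) f) = sqn hip f.
Proof.
move=> fH; have fL := hardy2_bdry_L2 fH; have uL := inner_L2_mul fL.
have [tH tE] := toeplitz_multiplier inner_multiplier fH; have tL := hardy2_bdry_L2 tH.
apply: (etrans (cip_ae_congr tL uL tL uL tE tE)).
exact: (sqn_cip_unimodular inner_unimodular fL uL).
Qed.

End InnerMultiplier.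

(** * Square roots of defect operators *)

Lemma defectE (R : realType) (b : disk R -> R[i]) (f : disk R -> Rcomplex R) :
  defect b f = f - toeplitz (bdry b) (toeplitz (fun t => conjc (bdry b t)) f) :> (disk R -> Rcomplex R).
Proof. by []. Qed.

(* Unification otherwise unfolds these definitions when it compares two different operators. *)
#[local] Opaque nrm defect hip cip bdry toeplitz hardy2 op_sqrt.

Section DefectRange.
Variable R : realType.
Notation C := R[i].
Notation Disk := (disk R -> Rcomplex R).
Notation H2 := (@hardy2 R : set Disk).
Notation hip := (@hip R).
Notation cip := (@cip R).
Implicit Types (f g h : Disk) (M A : Disk -> Disk).

Let cio := @circle_inner_on R.
Let hio := @hardy_inner_on R.
Let hdef := @hardy_definite R.
Let hcompl := @hardy_complete R.

(** Complex scalars are not part of the real module [Disk]; complex linearity is additivity and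
    commutation with every [cscale c]. *)
Definition cscale (c : C) f : Disk := fun z => c * (f z : C).

Lemma cscaleE c f : cscale c f = (fun z => c * (f z : C) + 0).
Proof. by apply/funext => z; rewrite addr0. Qed.

Lemma hardy2_scale c f : hardy2 f -> hardy2 (cscale c f).
Proof. by move=> fH; rewrite cscaleE; exact: (hardy2_lin c fH (hardy2_0 R)). Qed.

Lemma bdry_scale c f : hardy2 f -> ae_on_circle (bdry (cscale c f)) (fun t => c * bdry f t).
Proof.
move=> fH; have [fL frad] := hardy2_bdry fH.
by have [_ _] := bdryP (circle_L2_scale c fL)
  (has_radial_limits_mul (has_radial_limits_cst c) frad).
Qed.

Lemma cip_scale c (u v : R -> C) :
  cip (fun t => c * u t) v = cip u (fun t => conjc c * v t).
Proof.
rewrite !cipE; congr (_ * _); apply: eq_Rintegral => t _.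
by case: c (u t) (v t) => [? ?] [? ?] [? ?] /=; ring.
Qed.

Lemma hip_scale c f g : hardy2 f -> hardy2 g -> hip (cscale c f) g = hip f (cscale (conjc c) g).
Proof.
move=> fH gH; have fL := hardy2_bdry_L2 fH; have gL := hardy2_bdry_L2 gH.
have cfL := hardy2_bdry_L2 (hardy2_scale c fH).
have cgL := hardy2_bdry_L2 (hardy2_scale (conjc c) gH).
have E1 := cip_ae_congrl cfL (circle_L2_scale c fL) gL (bdry_scale c fH).
have E2 := cip_ae_congrl cgL (circle_L2_scale (conjc c) gL) fL (bdry_scale (conjc c) gH).
apply: (etrans E1); apply: (etrans (cip_scale c (bdry f) (bdry g))).
apply: (etrans (ip_sym cio fL (circle_L2_scale (conjc c) gL))).
apply: (etrans (esym E2)); exact: (ip_sym cio cgL fL).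
Qed.

Lemma cscaleA c d f : cscale c (cscale d f) = cscale (c * d) f.
Proof. by apply/funext => z; rewrite /cscale mulrA. Qed.

Lemma cscale1 f : cscale 1 f = f.
Proof. by apply/funext => z; rewrite /cscale mul1r. Qed.

Lemma cscaleN1 f : cscale (- 1) f = - f.
Proof. by apply/funext => z; rewrite /cscale mulN1r. Qed.

Lemma scale_cscale (c : R) f : c *: f = cscale c%:C f.
Proof.
apply/funext => z; change (c *: f z = c%:C * (f z : C)).
by case: (f z) => [? ?]; simpc.
Qed.

Lemma sqn_cscale c f : hardy2 f -> sqn hip (cscale c f) = normc c ^+ 2 * sqn hip f.
Proof.
move=> fH; rewrite /sqn (hip_scale c fH (hardy2_scale c fH)) cscaleA.
have -> : conjc c * c = (normc c ^+ 2)%:C by rewrite mulrC -normc_sqr_mul.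
by rewrite -scale_cscale (ipZr hio).
Qed.

Lemma hip_ext f g : hardy2 f -> hardy2 g -> (forall h, hardy2 h -> hip f h = hip g h) -> f = g.
Proof.
move=> fH gH E; apply/eqP; rewrite -subr_eq0; apply/eqP.
have dH : H2 (f - g) := innerB hio fH gH.
by apply: (hdef dH); rewrite /sqn (ipBl hio fH gH dH) E// subrr.
Qed.

(** The linearity and contractivity of M' follow from adjunction, so only its values are constrained
    here. *)
Record adjoint_pair M M' : Prop := AdjointPair {
  ap_H : forall f, hardy2 f -> hardy2 (M f);
  ap_D : forall f g, hardy2 f -> hardy2 g -> M (f + g) = M f + M g;
  ap_scale : forall c f, hardy2 f -> M (cscale c f) = cscale c (M f);
  ap_nrm : forall f, hardy2 f -> nrm hip (M f) <= nrm hip f;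
  ap_H' : forall f, hardy2 f -> hardy2 (M' f);
  ap_adj : forall f h, hardy2 f -> hardy2 h -> hip (M' f) h = hip f (M h) }.

Lemma toeplitz_adjoint_pair (phi : R -> C) : multiplier phi ->
  adjoint_pair (toeplitz phi) (toeplitz (fun t => conjc (phi t))).
Proof.
move=> mphi; split.
- exact: (toeplitz_H mphi).
- move=> f g fH gH; have := toeplitz_linC mphi 1 fH gH.
  have E (k l : Disk) : (fun z => 1 * (k z : C) + (l z : C)) = k + l.
    by apply/funext => z; rewrite mul1r.
  by rewrite !E.
- move=> c f fH; rewrite cscaleE (toeplitz_linC mphi c fH (hardy2_0 R)).
  have -> : toeplitz phi (fun=> 0) = (fun=> 0).
    apply: (toeplitz_unique mphi (hardy2_0 R) (hardy2_0 R)).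
    have zL : circle_L2 (fun _ : R => 0 : C) := inner0 cio.
    have [_ _ E] := bdryP zL (has_radial_limits_cst 0).
    by apply: ae_imply E => t Et tD; rewrite Et// mulr0.
  by rewrite cscaleE.
- exact: (toeplitz_nrm mphi).
- by move=> f fH; have [] := toeplitz_adjoint mphi fH.
- by move=> f h fH hH; have [_ E] := toeplitz_adjoint mphi fH; exact: E.
Qed.

Section Pair.
Variables (M M' : Disk -> Disk).
Hypothesis MM : adjoint_pair M M'.

Lemma ap_D' f g : hardy2 f -> hardy2 g -> M' (f + g) = M' f + M' g.
Proof.
move=> fH gH; have fgH : H2 (f + g) := innerD hio fH gH.
have f'H : H2 (M' f) := ap_H' MM fH; have g'H : H2 (M' g) := ap_H' MM gH.
apply: (hip_ext (ap_H' MM fgH) (innerD hio f'H g'H)) => h hH.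
have MhH : H2 (M h) := ap_H MM hH.
by rewrite (ap_adj MM fgH hH) (ipDl hio fH gH MhH) (ipDl hio f'H g'H hH) (ap_adj MM fH hH) (ap_adj MM gH hH).
Qed.

Lemma ap_scale' c f : hardy2 f -> M' (cscale c f) = cscale c (M' f).
Proof.
move=> fH; have cfH := hardy2_scale c fH; have f'H := ap_H' MM fH.
apply: (hip_ext (ap_H' MM cfH) (hardy2_scale c f'H)) => h hH.
have MhH := ap_H MM hH.
have ccH := hardy2_scale (conjc c) hH.
rewrite (ap_adj MM cfH hH) (hip_scale c fH MhH) (hip_scale c f'H hH) (ap_adj MM fH ccH).
by rewrite (ap_scale MM _ hH).
Qed.

Lemma ap_op : operator_on H2 M.
Proof.
split=> [f fH|c f g fH gH]; first exact: (ap_H MM fH).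
by rewrite !scale_cscale (ap_D MM (hardy2_scale _ fH) gH) (ap_scale MM _ fH).
Qed.

Lemma ap_op' : operator_on H2 M'.
Proof.
split=> [f fH|c f g fH gH]; first exact: (ap_H' MM fH).
by rewrite !scale_cscale (ap_D' (hardy2_scale _ fH) gH) (ap_scale' _ fH).
Qed.

(** |M' f|^2 = <f, M M' f> <= |f| |M' f|. *)
Lemma ap_nrm' f : hardy2 f -> nrm hip (M' f) <= nrm hip f.
Proof.
move=> fH; have f'H := ap_H' MM fH; have Mf'H := ap_H MM f'H.
have [->|n0] := eqVneq (nrm hip (M' f)) 0; first exact: nrm_ge0.
have np : 0 < nrm hip (M' f) by rewrite lt_def n0 nrm_ge0.
have e : nrm hip (M' f) ^+ 2 = hip f (M (M' f)).
  exact: (etrans (nrm_sqr hio f'H) (ap_adj MM fH f'H)).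
have := le_trans (ler_norm _) (cauchy_schwarz hio fH Mf'H); rewrite -e.
have := ap_nrm MM f'H; have := nrm_ge0 hip f; move: np.
by move: (nrm hip (M' f)) (nrm hip f) (nrm hip (M (M' f))) => x y z x0 y0 zx h; nra.
Qed.

Let Y f := M (M' f).

Lemma gram_op : operator_on H2 Y.
Proof.
split=> [f fH|c f g fH gH]; first exact: (ap_H MM (ap_H' MM fH)).
by rewrite /Y (op_lin ap_op' c fH gH) (op_lin ap_op c (ap_H' MM fH) (ap_H' MM gH)).
Qed.

Lemma gramE f g : hardy2 f -> hardy2 g -> hip (Y f) g = hip (M' f) (M' g).
Proof.
move=> fH gH; have f'H := ap_H' MM fH; have g'H := ap_H' MM gH.
have YH := ap_H MM f'H.
by rewrite (ip_sym hio YH gH) -(ap_adj MM gH f'H) (ip_sym hio g'H f'H).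
Qed.

Lemma gram_sym : symmetric_on H2 hip Y.
Proof.
move=> f g fH gH; have Yg : H2 (Y g) := ap_H MM (ap_H' MM gH).
rewrite (gramE fH gH) (ip_sym hio fH Yg) (gramE gH fH).
by rewrite (ip_sym hio (ap_H' MM fH) (ap_H' MM gH)).
Qed.

Lemma gram_nrm f : hardy2 f -> nrm hip (Y f) <= nrm hip f.
Proof. by move=> fH; exact: (le_trans (ap_nrm MM (ap_H' MM fH)) (ap_nrm' fH)). Qed.

Lemma gram_scale c f : hardy2 f -> cscale c (Y f) = Y (cscale c f).
Proof. by move=> fH; rewrite /Y (ap_scale' c fH) (ap_scale MM c (ap_H' MM fH)). Qed.

(** The real theory gives a symmetric root; the complex requirements follow because Y commutes with
    complex scalars, hence so does the root. *)
Lemma defect_sqrt_exists : exists2 A, positive_operator A &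
  forall f, hardy2 f -> A (A f) = f - Y f.
Proof.
have self_opp (x : R) : x = - x -> x = 0 by move=> ?; lra.
have oY := gram_op; have sY := gram_sym; have nY := gram_nrm.
pose A := sqrt_op H2 hip Y.
have oA : operator_on H2 A := sqrt_op_op hio hcompl hdef oY nY.
have sA : symmetric_on H2 hip A := sqrt_op_sym hio hcompl oY sY nY.
have AH f : hardy2 f -> hardy2 (A f) := @op_in _ _ _ _ oA f.
have Ac c f : hardy2 f -> cscale c (A f) = A (cscale c f).
  move=> fH; have oc : operator_on H2 (cscale c).
    split=> [g|d g h gH hH]; first exact: hardy2_scale.
    by rewrite !scale_cscale cscaleA mulrC -cscaleA; apply/funext => z; exact: mulrDr.
  apply: (@sqrt_op_commute R Disk H2 hip hio Y hcompl hdef oY nY (cscale c) (normc c) oc _ _ f fH).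
  - move=> g gH; rewrite !nrmE (sqn_cscale c gH) sqrtrM ?sqr_ge0// sqrtr_sqr.
    by rewrite ger0_norm ?normc_ge0.
  - by move=> g gH; exact: gram_scale.
exists A; last by move=> f fH; exact: (sqrt_op_sqr hio hcompl hdef oY nY fH).
split.
  split; first exact: AH.
    move=> c f g fH gH.
    have -> : (fun z => c * f z + g z) = cscale c f + g by [].
    by rewrite (opD oA (hardy2_scale c fH) gH) -Ac.
  by exists 2 => f fH; exact: (sqrt_op_le hio hcompl oY nY fH).
move=> f fH; have AfH := AH f fH.
rewrite (hardy_innerE AfH fH) -/(cscale 'i f).
have ifH := hardy2_scale 'i fH; have iAH := hardy2_scale 'i AfH.
(* This number is the imaginary part of <A f, f>. Symmetry of A and anti-symmetry of i make it its
   own opposite. *)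
have E1 : hip (A f) (cscale 'i f) = hip f (cscale 'i (A f)).
  by rewrite (sA f (cscale 'i f) fH ifH) -Ac.
have E2 : hip f (cscale 'i (A f)) = - hip (A f) (cscale 'i f).
  rewrite (ip_sym hio fH iAH) (hip_scale 'i AfH fH).
  have -> : conjc ('i : C) = -1 * 'i by rewrite mulN1r; simpc.
  by rewrite -cscaleA cscaleN1 (ipNr hio ifH AfH).
have := sqrt_op_ge0 hio hcompl oY nY fH; have := etrans E1 E2; rewrite -/A.
move: (hip (A f) (cscale 'i f)) (hip (A f) f) => x y xN y0.
by rewrite (self_opp x xN) lecE y0 andbT; apply/eqP.
Qed.

End Pair.

(** Positivity makes <A f, f> real, that is <A f, i f> = 0 in the real inner product. Polarizing in
    f and g and replacing g by i g yields <A f, g> = <A g, f>. *)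
Lemma positive_operator_sym A : positive_operator A ->
  operator_on H2 A /\ symmetric_on H2 hip A.
Proof.
move=> [[AH Alin _] Apos].
have AD f g : hardy2 f -> hardy2 g -> A (f + g) = A f + A g.
  move=> fH gH; have E (k l : Disk) : k + l = (fun z => 1 * (k z : C) + (l z : C)).
    by apply/funext => z; rewrite mul1r.
  by rewrite !E; exact: Alin.
have A0 : A 0 = 0.
  have := AD 0 0 (hardy2_0 R) (hardy2_0 R); rewrite addr0 => /eqP.
  by rewrite addrC -subr_eq subrr eq_sym => /eqP.
have As c f : hardy2 f -> A (cscale c f) = cscale c (A f).
  move=> fH; rewrite cscaleE; have -> := Alin c f _ fH (hardy2_0 R).
  have -> : A (fun=> 0) = (fun=> 0) := A0.
  by rewrite cscaleE.
have oA : operator_on H2 A.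
  split=> [f fH|c f g fH gH]; first exact: (AH f fH).
  by rewrite !scale_cscale (AD _ _ (hardy2_scale _ fH) gH) (As _ _ fH).
split; first exact: oA.
have im0 f : hardy2 f -> hip (A f) (cscale 'i f) = 0.
  move=> fH; have := Apos f fH; rewrite (hardy_innerE (AH f fH) fH).
  by rewrite lecE => /andP[/eqP E _]; exact: E.
have pol f g : hardy2 f -> hardy2 g -> hip (A f) (cscale 'i g) + hip (A g) (cscale 'i f) = 0.
  move=> fH gH; have := im0 _ (innerD hio fH gH).
  have AfH := AH f fH; have AgH := AH g gH.
  have ifH := hardy2_scale 'i fH; have igH := hardy2_scale 'i gH.
  have -> : cscale 'i (f + g) = cscale 'i f + cscale 'i g by apply/funext => z; exact: mulrDr.
  rewrite (AD f g fH gH) (ipDl hio AfH AgH (innerD hio ifH igH)).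
  rewrite (ipDr hio ifH igH AfH) (ipDr hio ifH igH AgH) (im0 f fH) (im0 g gH).
  move: (hip (A f) _) (hip (A g) _) => x y E.
  by rewrite add0r addr0 in E.
move=> g f gH fH; have AfH := AH f fH; have AgH := AH g gH.
have igH := hardy2_scale 'i gH.
have := pol f (cscale 'i g) fH igH; rewrite cscaleA.
have -> : 'i * 'i = - 1 :> C by simpc.
rewrite cscaleN1 (ipNr hio gH AfH) (As 'i g gH) (hip_scale 'i AgH (hardy2_scale 'i fH)).
rewrite cscaleA; have -> : conjc 'i * 'i = 1 :> C by simpc.
rewrite cscale1 => E; rewrite (ip_sym hio gH AfH).
apply/eqP; rewrite -subr_eq0 addrC; apply/eqP; exact: E.
Qed.

Lemma op_sqrt_defectP (b : disk R -> C) : multiplier (bdry b) ->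
  positive_operator (op_sqrt (defect b)) /\
  forall f, hardy2 f -> op_sqrt (defect b) (op_sqrt (defect b) f) = defect b f.
Proof.
move=> mb; have [A Apos AA] := defect_sqrt_exists (toeplitz_adjoint_pair mb).
have AE f : hardy2 f -> A (A f) = defect b f by move=> fH; rewrite defectE; exact: AA.
exact: (@xgetPex _ (fun _ _ => 0)
  [set A | positive_operator A /\ forall f, hardy2 f -> A (A f) = defect b f]
  (ex_intro _ A (conj Apos AE))).
Qed.

(** |A f|^2 = <A (A f), f> by symmetry. This is the form in which defects are compared. *)
Lemma sqn_op_sqrt_defect (b : disk R -> C) f : multiplier (bdry b) -> hardy2 f ->
  sqn hip (op_sqrt (defect b) f) =
  sqn hip f - sqn hip (toeplitz (fun t => conjc (bdry b t)) f).
Proof.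
move=> mb fH; have [Apos AA] := op_sqrt_defectP mb.
have [oA sA] := positive_operator_sym Apos; have AfH := op_in oA fH.
rewrite {1}/sqn (sA f _ fH AfH) (AA f fH).
have MM := toeplitz_adjoint_pair mb; have YH := op_in (gram_op MM) fH.
by rewrite defectE (ipBr hio fH YH fH) (ip_sym hio fH YH) (gramE MM fH fH).
Qed.

Lemma dbr_subset (b1 b2 : disk R -> C) (c : R) : 0 <= c ->
  multiplier (bdry b1) -> multiplier (bdry b2) ->
  (forall f, hardy2 f ->
    sqn hip f - sqn hip (toeplitz (fun t => conjc (bdry b1 t)) f) <=
    c * (sqn hip f - sqn hip (toeplitz (fun t => conjc (bdry b2 t)) f))) ->
  dbr b1 `<=` dbr b2.
Proof.
have le_eq (x y x' y' : R) : x = x' -> y = y' -> x' <= c * y' -> x <= c * y by move=> -> ->.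
move=> c0 m1 m2 le12 _ [f fH <-].
have [P1 _] := op_sqrt_defectP m1; have [P2 _] := op_sqrt_defectP m2.
have [A1o A1s] := positive_operator_sym P1; have [A2o A2s] := positive_operator_sym P2.
have le_sq h : hardy2 h ->
    sqn hip (op_sqrt (defect b1) h) <= c * sqn hip (op_sqrt (defect b2) h).
  move=> hH; exact: (le_eq _ _ _ _ (sqn_op_sqrt_defect m1 hH) (sqn_op_sqrt_defect m2 hH) (le12 h hH)).
have [g gH gE] := douglas hio hcompl hdef c0 A1o A2o A1s A2s le_sq fH.
exists g; [exact: gH|exact: esym gE].
Qed.

End DefectRange.

(** * The two symbols built from an inner function *)

Section InnerSymbols.
Variables (R : realType) (I : disk R -> R[i]).
Hypothesis I_inner : inner_function I.
Notation C := R[i].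
Notation Disk := (disk R -> Rcomplex R).
Notation V := (toeplitz (bdry I)).
Notation V' := (toeplitz (fun t => conjc (bdry I t))).
Notation b2 := (fun z => (1 + I z ^+ 2) / 2).
Notation b1 := (fun z => I z * (1 + I z ^+ 2) / 2).
Notation phi2 := (fun t => (1 + bdry I t ^+ 2) / 2).
Implicit Types (f k : Disk).

Let mI := inner_multiplier I_inner.
Let hio := @hardy_inner_on R.
Let half (f : Disk) : Disk := 2^-1 *: (f + V (V f)).

Lemma half_radial : has_radial_limits b2 phi2.
Proof.
have [_ Irad] := inner_bdry I_inner.
have E (x : C) : (1 + x ^+ 2) / 2 = (1 * (x * x) + 1) * 2^-1 by rewrite mul1r expr2 addrC.
have -> : b2 = (fun z => (1 * (I z * I z) + 1) * 2^-1) by apply/funext => z; exact: E.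
have -> : phi2 = (fun t => (1 * (bdry I t * bdry I t) + 1) * 2^-1).
  by apply/funext => t; exact: E.
exact: (has_radial_limits_mul (has_radial_limits_lin 1 (has_radial_limits_mul Irad Irad)
  (has_radial_limits_cst 1)) (has_radial_limits_cst 2^-1)).
Qed.

Lemma half_multiplier : multiplier (bdry b2) /\ ae_on_circle (bdry b2) phi2.
Proof.
have m2 := multiplier_half mI; have [L2 _ _] := m2.
by have [bL _ E] := bdryP L2 half_radial; split; [exact: multiplier_ae bL E m2|].
Qed.

Lemma shifted_half_multiplier :
  multiplier (bdry b1) /\ ae_on_circle (bdry b1) (fun t => bdry I t * bdry b2 t).
Proof.
have [m2 E2] := half_multiplier; have m1 := multiplierM mI (multiplier_half mI).
have [L1 _ _] := m1; have [_ Irad] := inner_bdry I_inner.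
have rad : has_radial_limits b1 (fun t => bdry I t * phi2 t).
  have -> : b1 = (fun z => I z * ((1 + I z ^+ 2) / 2)) by apply/funext => z; rewrite mulrA.
  exact: (has_radial_limits_mul Irad half_radial).
have [bL _ E] := bdryP L1 rad; split; first exact: multiplier_ae bL E m1.
by move: E E2; apply: ae_imply2 => t e1 e2 tD; rewrite e1// e2.
Qed.

Let VH f : hardy2 f -> hardy2 (V f).
Proof. exact: (toeplitz_H mI). Qed.

Lemma half_H f : hardy2 f -> hardy2 (half f).
Proof.
move=> fH; have VVH := VH (VH fH).
exact: (innerZ hio 2^-1 (innerD hio fH VVH)).
Qed.

Lemma toeplitz_half f : hardy2 f -> toeplitz (bdry b2) f = half f.
Proof.
move=> fH; have [m2 E2] := half_multiplier; have VVH := VH (VH fH).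
apply: (toeplitz_unique m2 fH (half_H fH)).
have sumE : f + V (V f) = (fun z => 1 * (f z : C) + (V (V f) z : C)).
  by apply/funext => z; rewrite mul1r.
have c2 : (2^-1 : R)%:C = (2 : C)^-1 by rewrite fmorphV rmorph_nat.
rewrite /half scale_cscale c2 sumE.
have E3 := bdry_scale 2^-1 (hardy2_lin 1 fH VVH); have E4 := bdry_lin 1 fH VVH.
have E5 : ae_on_circle (bdry (V (V f))) (fun t => bdry I t * (bdry I t * bdry f t)).
  have := toeplitz_bdry mI (VH fH); have := toeplitz_bdry mI fH.
  by apply: ae_imply2 => t e1 e2 tD; rewrite e2// e1.
have E6 : ae_on_circle (fun t => 1 * bdry f t + bdry (V (V f)) t)
    (fun t => 1 * bdry f t + bdry I t * (bdry I t * bdry f t)).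
  by move: E5; apply: ae_imply => t e tD; rewrite e.
apply: (ae_on_trans E3).
move: (ae_on_trans E4 E6) E2; apply: ae_imply2 => t e1 e2 tD; rewrite e1// e2//.
by rewrite mul1r mulrA -expr2 -{1}[bdry f t]mul1r -mulrDl mulrA [2^-1 * _]mulrC.
Qed.

Lemma toeplitz_shifted_half f : hardy2 f -> toeplitz (bdry b1) f = V (half f).
Proof.
move=> fH; have [m1 E1] := shifted_half_multiplier; have [m2 _] := half_multiplier.
apply: (toeplitz_unique m1 fH (VH (half_H fH))).
have := toeplitz_bdry mI (half_H fH); rewrite -(toeplitz_half fH) => E3.
apply: (ae_on_trans E3); move: (toeplitz_bdry m2 fH) E1.
by apply: ae_imply2 => t e1 e2 tD; rewrite e1// e2// mulrA.
Qed.

(** One inclusion for each inequality of [shift_adjoint_defect], with V the isometry of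
    multiplication by I. *)
Lemma shifted_half_dbr : dbr b1 = dbr b2.
Proof.
have [m1 _] := shifted_half_multiplier; have [m2 _] := half_multiplier.
have p1 := toeplitz_adjoint_pair m1; have p2 := toeplitz_adjoint_pair m2.
have pI := toeplitz_adjoint_pair mI.
have adj2 f k : hardy2 f -> hardy2 k ->
    hip (toeplitz (fun t => conjc (bdry b2 t)) f) k = hip f (half k).
  by move=> fH kH; exact: (etrans (ap_adj p2 fH kH) (congr1 (hip f) (toeplitz_half kH))).
have adj1 f k : hardy2 f -> hardy2 k ->
    hip (toeplitz (fun t => conjc (bdry b1 t)) f) k = hip f (V (half k)).
  by move=> fH kH; exact: (etrans (ap_adj p1 fH kH) (congr1 (hip f) (toeplitz_shifted_half kH))).
have le f (fH : hardy2 f) := shift_adjoint_defect hio (@hardy_definite R) (ap_op pI) (ap_op' pI)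
  (@inner_toeplitz_isometry R I I_inner) (ap_adj pI) (ap_H' p2) adj2 (ap_H' p1) adj1 fH.
have c0 : 0 <= 5 :> R by [].
by apply/seteqP; split;
  [apply: (dbr_subset c0 m1 m2) => f fH; exact: (le f fH).1
  |apply: (dbr_subset c0 m2 m1) => f fH; exact: (le f fH).2].
Qed.

End InnerSymbols.

Theorem proposition2 (R : realType) (I : disk R -> R[i])
    (I_inner : inner_function I)
    (I_nonconstant : ~ exists c : R[i], forall z : disk R, I z = c)
    (I_at0 : I (disk0 R) = 0) :
  dbr (fun z => I z * (1 + I z ^+ 2) / 2) = dbr (fun z => (1 + I z ^+ 2) / 2).
Proof. exact: (shifted_half_dbr I_inner). Qed.
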